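(* Let $0<p,q,u,v<\infty$ and $-2<\alpha,\beta<\infty$. Then $\mathcal{AT}_{q,\alpha}^{p}\subseteq\mathcal{AT}_{u,\beta}^{v}$ if and only if one of the following conditions holds: (i) $p<v$ and $\frac1p-\frac1v+\frac{\alpha+2}{q}-\frac{\beta+2}{u}\le 0$; (ii) $p\ge v$ and either $\frac{\alpha+2}{q}-\frac{\beta+2}{u}<0$, or [$\frac{\alpha+2}{q}-\frac{\beta+2}{u}=0$ and $q\le u$].
   Context: $\mathbb{D}$ is the open unit disk, $\mathbb{T}$ the unit circle, $|d\xi|$ Lebesgue (arc length) measure on $\mathbb{T}$, $dA$ Euclidean area measure on $\mathbb{D}$, and $H(\mathbb{D})$ the space of analytic functions on $\mathbb{D}$. For $\xi\in\mathbb{T}$ let $\Gamma(\xi)=\{z\in\mathbb{D}: |1-z\bar\xi|<1-|z|^2\}$. Analytic tent spaces: for $0<p,q<\infty$ and $\alpha>-2$, $\mathcal{AT}_{q,\alpha}^p$ is the space of all $f\in H(\mathbb{D})$ with $$\|f\|_{\mathcal{AT}_{q,\alpha}^p}^p=\int_{\mathbb{T}}\left(\int_{\Gamma(\xi)}|f(z)|^q(1-|z|^2)^\alpha\,dA(z)\right)^{p/q}|d\xi|<\infty .$$ *)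

(* Defs.v *)
From mathcomp Require Import all_boot all_order all_algebra.
From mathcomp Require Import all_classical all_reals all_analysis.
From mathcomp Require Export complex.

Set Implicit Arguments.
Unset Strict Implicit.
Unset Printing Implicit Defensive.

Import Order.TTheory GRing.Theory Num.Theory.
Import numFieldNormedType.Exports.
Import ComplexField.Normc.

Local Open Scope classical_set_scope.
Local Open Scope ring_scope.

Definition unit_disk (R : realType) : set R[i] := [set z | normc z < 1].

(* [derivable] over the field [R[i]]: the limit of the difference quotient is
   taken as the complex increment tends to 0. *)
Definition analytic_on_disk (R : realType) (f : R[i] -> R[i]) : Prop :=
  forall z : R[i], unit_disk z -> derivable (f : R[i]^o -> R[i]^o) z 1.

Definition Gamma (R : realType) (xi : R[i]) : set R[i] :=
  [set z | unit_disk z /\ normc (1 - z * conjc xi) < 1 - normc z ^+ 2].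

(* Integral over [S] with respect to area measure, the plane being
   parametrized by pairs of reals. *)
Definition area_integral (R : realType) (S : set R[i]) (g : R[i] -> \bar R) :
    \bar R :=
  (\int[(@lebesgue_measure R \x @lebesgue_measure R)%E]_(w in
     [set w : R * R | S (Complex w.1 w.2)]) g (Complex w.1 w.2))%E.

(* Integral over the unit circle with respect to arc length. *)
Definition circle_integral (R : realType) (g : R[i] -> \bar R) : \bar R :=
  (\int[@lebesgue_measure R]_(t in `[0%R, (2 * pi)%R])
     g (Complex (cos t) (sin t)))%E.

(* The [p]-th power of the norm, possibly [+oo]. The inner power is [poweR],
   with [+oo `^ r = +oo] for [r != 0]. *)
Definition tent_norm_pow (R : realType) (q alpha p : R) (f : R[i] -> R[i]) :
    \bar R :=
  circle_integral (fun xi =>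
    poweR
      (area_integral (Gamma xi) (fun z =>
         (powR (normc (f z)) q * powR (1 - normc z ^+ 2) alpha)%:E))
      (p / q)).

(* Functions on the disk are represented by total functions on [R[i]]; both
   conditions only involve the values on the disk. *)
Definition AT (R : realType) (q alpha p : R) : set (R[i] -> R[i]) :=
  [set f | analytic_on_disk f /\ (tent_norm_pow q alpha p f < +oo)%E].

(* Main.v *)
Require Import Defs.
From mathcomp Require Import all_boot all_order all_algebra.
From mathcomp Require Import all_classical all_reals all_analysis.
From mathcomp Require Import measurable_realfun.
From mathcomp Require Import ring lra.
Set Implicit Arguments.
Unset Strict Implicit.
Unset Printing Implicit Defensive.
Import Order.TTheory GRing.Theory Num.Theory.
Import numFieldNormedType.Exports.
Import ComplexField.Normc.
Local Open Scope classical_set_scope.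
Local Open Scope ring_scope.

(* Write [s = (alpha+2)/q], [sigma = (beta+2)/u], [h = 1 - |z|], and let [Phi(xi)] be the inner
   integral over [Gamma xi].

   Sufficiency. Subharmonicity of [|f|^q] gives [|f z|^q h^(alpha+2) <= C Phi(eta)] for [eta] in an
   arc of length comparable to [h] near [z/|z|]. By the Hardy-Littlewood maximal theorem there is
   therefore an integrable [W >= 1] on the circle with [(|f z| h^s)^p <= W(xi)] on [Gamma xi], and
   averaging over the arc gives [|f z| h^(s+1/p) <= K]. Summing over the dyadic shells
   [h ~ 2^-k], these bounds show in each of the listed cases that the [v/u]-th power of the inner
   integral for [(u, beta)] is at most [C (W + Phi^(p/q))], which is integrable.

   Necessity. If [1/v + sigma < 1/p + s], then [(1 + z)^(-1/v - sigma)] belongs to the first space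
   but not to the second. If [sigma < s], or [sigma = s] and [u < q], the same holds for the lacunary
   series [sum_k n_k^sigma (k+1)^(-1/u) z^(n_k)], [n_k = lam^k], whose inner integrals are
   uniformly bounded for [(q, alpha)] and infinite at every point for [(u, beta)]. *)

(** * Complex derivatives *)

Local Notation Re := complex.Re.
Local Notation Im := complex.Im.

Section ComplexPlane.
Variable R : realType.
Implicit Types (x y z w h : R[i]) (f : R[i] -> R[i]).

(** The maximal function of an integrable function is in general not integrable, so [W] cannot be
    taken to be that of [Phi^(p/q)]. Integrability is saved because [|f z|] is controlled by
    [Phi(eta)] for every [eta] of an arc, not merely on average. A level set of [Phi^(p/q)] then
    contains the whole arc, the maximal function of its indicator exceeds a fixed number at the
    vertex, and the weak inequality is needed at that one height only, once for each dyadic level.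

    Subharmonicity has to come from bare complex differentiability and for every [q > 0]. Squares
    take the place of disks: contour integrals along their sides are ordinary integrals, and
    averaging over concentric squares is Fubini's theorem.

    The cases differ in the margin left on the shells. For [p < v] the two pointwise bounds have
    exponents on either side of the critical one, so that both geometric sums converge even when (i)
    is an equality. For [v <= p] the bound by [W] stands alone: it needs [sigma > s], or, if
    [sigma = s], a factor [|f|^q] kept under the integral. The power [v/p] that results is at most
    [1] and is harmless because [W >= 1]. *)

Lemma ler_normcD z w : normc (z + w) <= normc z + normc w.
Proof. exact: le_normcD. Qed.

Lemma normc_opp z : normc (- z) = normc z.
Proof. exact: normcN. Qed.

Lemma normc_dist z w : normc (z - w) = normc (w - z).
Proof. by rewrite -normc_opp opprB. Qed.

Lemma ler_normcB z w : normc (z - w) <= normc z + normc w.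
Proof. by rewrite -(normc_opp w); exact: ler_normcD. Qed.

Lemma ler_normc_dist w z1 z2 : normc (z1 - z2) <= normc (z1 - w) + normc (w - z2).
Proof. by rewrite -[z1 - z2](subrKA w) ler_normcD. Qed.

Lemma lerB_normc z w : normc z - normc w <= normc (z - w).
Proof. by rewrite lerBlDr -{1}(subrK w z) ler_normcD. Qed.

Lemma dist_normc z w : `|normc z - normc w| <= normc (z - w).
Proof. by rewrite ler_norml lerB_normc andbT lerNl opprB normc_dist lerB_normc. Qed.

Lemma normc_ge0 z : 0 <= normc z.
Proof. by case: z => a b; rewrite sqrtr_ge0. Qed.

Lemma normc_real (a : R) : normc a%:C%C = `|a|.
Proof. by rewrite /normc /= expr0n addr0 sqrtr_sqr. Qed.

Lemma normc_sqr z : normc z ^+ 2 = Re z ^+ 2 + Im z ^+ 2.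
Proof. by case: z => a b; rewrite sqr_sqrtr //= addr_ge0 ?sqr_ge0. Qed.

Lemma normc_le z (r : R) : 0 <= r -> (normc z <= r) = (Re z ^+ 2 + Im z ^+ 2 <= r ^+ 2).
Proof. by move=> r0; rewrite -normc_sqr ler_pXn2r ?nnegrE ?normc_ge0. Qed.

Lemma normc_lt z (r : R) : 0 <= r -> (normc z < r) = (Re z ^+ 2 + Im z ^+ 2 < r ^+ 2).
Proof. by move=> r0; rewrite -normc_sqr ltr_pXn2r ?nnegrE ?normc_ge0. Qed.

Lemma normc_conj z : normc (conjc z) = normc z.
Proof. by case: z => a b; rewrite /= sqrrN. Qed.

Lemma ler_Re_normc z : `|Re z| <= normc z.
Proof.
by rewrite -(ler_pXn2r (ltn0Sn 1)) ?nnegrE ?normc_ge0// normc_sqr real_normK ?num_real// lerDl sqr_ge0.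
Qed.

Lemma ler_Im_normc z : `|Im z| <= normc z.
Proof.
by rewrite -(ler_pXn2r (ltn0Sn 1)) ?nnegrE ?normc_ge0// normc_sqr real_normK ?num_real// lerDr sqr_ge0.
Qed.

Lemma ler_normc_ReIm z : normc z <= `|Re z| + `|Im z|.
Proof.
rewrite normc_le ?addr_ge0// sqrrD !real_normK ?num_real//.
by rewrite lerD2r lerDl mulrn_wge0// mulr_ge0.
Qed.

Lemma normcX z n : normc (z ^+ n) = normc z ^+ n.
Proof. by elim: n => [|n IH]; rewrite ?expr0 ?normc1// !exprS normcM IH. Qed.

Lemma normc_eq0 z : (normc z == 0) = (z == 0).
Proof. by apply/eqP/eqP => [/eq0_normc|->]; rewrite ?normc0. Qed.

Lemma normc_gt0 z : (0 < normc z) = (z != 0).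
Proof. by rewrite lt_neqAle normc_ge0 andbT eq_sym normc_eq0. Qed.

Lemma normrC_normc z : `|z| = (normc z)%:C%C.
Proof. by case: z. Qed.

(** Differentiability as a first-order estimate with real [e] and [r]: nothing is divided by [h], so
    [h = 0] is no exception and all estimates take place in [R]. *)
Definition is_cderive f z d := forall e : R, 0 < e -> exists2 r : R, 0 < r &
  forall h, normc h < r -> normc (f (z + h) - f z - h * d) <= e * normc h.

Let diffquotE (d h a : R[i]) : h != 0 -> d - h^-1 * a = h^-1 * (h * d - a).
Proof. by move=> h0; rewrite mulrBr mulKf. Qed.

Lemma derivable_is_cderive f z :
  derivable (f : R[i]^o -> R[i]^o) z 1 <-> exists d, is_cderive f z d.
Proof.
split.
  move=> /cvg_ex[d /cvgrPdist_le dP]; exists d => e e0.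
  have e0' : (0 : R[i]) < e%:C%C by rewrite ltcR.
  have := dP _ e0'.
  rewrite /dnbhs /= near_withinE => /nbhs_ballP[r /= r0 rP].
  have rE : r = (Re r)%:C%C.
    by apply/esym; apply: RRe_real; exact: gtr0_real.
  exists (Re r); first by rewrite -ltcR -rE.
  move=> h hr; have [->|h0] := eqVneq h 0.
    by rewrite addr0 subrr mul0r subr0 normc0 mulr0.
  have : ball_ [eta Num.Def.normr] 0 r h.
    by rewrite /= sub0r normrN rE normrC_normc ltcR.
  move=> /rP /(_ h0) /=; rewrite normrC_normc lecR.
  have -> : d - h^-1 *: (f (h%:A + z) - f z) = h^-1 * (h * d - (f (z + h) - f z)).
    by rewrite [h%:A]mulr1 (addrC h); exact: diffquotE.
  rewrite normcM normcV mulrC ler_pdivrMr ?normc_gt0// => H.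
  by rewrite normc_dist in H.
move=> [d dP]; apply/cvg_ex; exists d; apply/cvgrPdist_le => e e0.
have eE : e = (Re e)%:C%C by apply/esym; apply: RRe_real; exact: gtr0_real.
have [|r r0 rP] := dP (Re e); first by rewrite -ltcR -eE.
rewrite /dnbhs /= near_withinE; apply/nbhs_ballP; exists r%:C%C => /=.
  by rewrite ltcR.
move=> h /=; rewrite /ball /= sub0r normrN normrC_normc ltcR => hr h0.
rewrite normrC_normc eE lecR.
have -> : d - h^-1 *: (f (h%:A + z) - f z) = h^-1 * (h * d - (f (z + h) - f z)).
  by rewrite [h%:A]mulr1 (addrC h); exact: diffquotE.
by rewrite normcM normcV mulrC ler_pdivrMr ?normc_gt0// normc_dist rP.
Qed.

Lemma is_cderive_continuous f z d : is_cderive f z d ->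
  forall e : R, 0 < e -> exists2 r : R, 0 < r &
    forall h, normc h < r -> normc (f (z + h) - f z) < e.
Proof.
move=> fd e e0; have [r r0 rP] := fd 1 ltr01.
have d1 : 0 < 1 + normc d by rewrite ltr_wpDr ?normc_ge0.
exists (Num.min r (e / (1 + normc d))); first by rewrite lt_min r0 divr_gt0.
move=> h; rewrite lt_min ltr_pdivlMr// => /andP[/rP hr he].
rewrite -[f _ - _](subrK (h * d)); apply: le_lt_trans (ler_normcD _ _) _.
by apply: le_lt_trans he; rewrite mulrDr mulr1 normcM lerD2r (le_trans hr)// mul1r.
Qed.

End ComplexPlane.

(** * Goursat's lemma and mean values *)

Section Goursat.
Variable R : realType.
Implicit Types (f : R[i] -> R[i]) (a b c d x y r : R) (g : R -> R).
Local Notation mu := (@lebesgue_measure R).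

(** Serves for [phi] equal to [Re], [Im] or [normc], all of them 1-Lipschitz, and for [gam] running
    along a side of a rectangle. *)
Lemma continuous_along f (gam : R -> R[i]) (phi : R[i] -> R) (x : R) (D : R[i]) :
  is_cderive f (gam x) D ->
  (forall t, normc (gam t - gam x) <= `|t - x|) ->
  (forall z w, `|phi z - phi w| <= normc (z - w)) ->
  {for x, continuous (fun t => phi (f (gam t)))}.
Proof.
move=> fD gamP phiP; apply/cvgrPdist_lt => e e0.
have [r r0 rP] := is_cderive_continuous fD e0.
apply: (filterS _ (nbhsx_ballx x r r0)) => t; rewrite /ball/= => tr.
rewrite distrC (le_lt_trans (phiP _ _))//.
by rewrite -(subrKC (gam x) (gam t)) rP// (le_lt_trans (gamP _))// distrC.
Qed.

Lemma continuous_itv_integrable g a b :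
  (forall x, a <= x <= b -> {for x, continuous g}) ->
  mu.-integrable `[a, b] (EFin \o g).
Proof.
move=> gc; apply: continuous_compact_integrable; first exact: segment_compact.
by apply: continuous_in_subspaceT => x; rewrite inE/= in_itv/= => /gc.
Qed.

Lemma Rintegral_itv_split g a m b : a <= m <= b ->
  mu.-integrable `[a, b] (EFin \o g) ->
  \int[mu]_(x in `[a, b]) g x =
  \int[mu]_(x in `[a, m]) g x + \int[mu]_(x in `[m, b]) g x.
Proof.
move=> /andP[am mb] ig; apply/eqP; rewrite addrC -subr_eq.
rewrite (Rintegral_itvB ig) ?bnd_simp// Rintegral_itv_obnd_cbnd//.
apply: integrableS ig => //.
by apply: subset_itv; rewrite bnd_simp.
Qed.

Lemma integrable_itvB g1 g2 a b : mu.-integrable `[a, b] (EFin \o g1) ->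
  mu.-integrable `[a, b] (EFin \o g2) ->
  mu.-integrable `[a, b] (EFin \o (fun x => g1 x - g2 x)).
Proof. by move=> i1 i2; have := integrableB _ i1 i2; apply. Qed.

Lemma fine_measure_itv a b : a <= b -> fine (mu `[a, b]) = b - a.
Proof.
move=> ab; rewrite lebesgue_measure_itv/=; case: ifPn => //=.
by rewrite lte_fin -leNgt => ba; apply/esym/eqP; rewrite subr_eq0 eq_le ab ba.
Qed.

Lemma Rintegral_itv_near_cst g a b k e : a <= b ->
  mu.-integrable `[a, b] (EFin \o g) ->
  (forall x, a <= x <= b -> `|g x - k| <= e) ->
  `|\int[mu]_(x in `[a, b]) g x - k * (b - a)| <= e * (b - a).
Proof.
move=> ab ig gk.
have muE := fine_measure_itv ab.
have ic m : mu.-integrable `[a, b] (EFin \o cst m).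
  by apply: continuous_itv_integrable => x _; exact: cst_continuous.
rewrite -muE -(Rintegral_cst mu (measurable_itv _) k).
rewrite -RintegralB// ; last exact: ic.
rewrite (le_trans (le_normr_Rintegral _ _))//.
  exact: integrable_itvB ig (ic k).
rewrite -[leRHS](Rintegral_cst mu (measurable_itv _) e).
apply: le_Rintegral => //.
- apply: (@integrable_norm _ _ _ mu _ (fun x => g x - k)) => //.
  exact: integrable_itvB ig (ic k).
- exact: ic.
Qed.

Lemma nested_intervals (u v : nat -> R) : (forall n, u n <= u n.+1) ->
  (forall n, v n.+1 <= v n) -> (forall n, u n <= v n) ->
  exists x, forall n, u n <= x <= v n.
Proof.
move=> ui vd uv.
have um n m : (n <= m)%N -> u n <= u m by apply: (homo_leq (r := <=%R)) => //; exact: le_trans.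
have vm n m : (n <= m)%N -> v m <= v n.
  by apply: (homo_leq (r := fun p q => q <= p)) => // p q r' qp rq; exact: le_trans rq qp.
have uvmn n m : u n <= v m.
  apply: le_trans (um _ _ (leq_maxl n m)) _.
  exact: le_trans (uv _) (vm _ _ (leq_maxr n m)).
exists (sup (range u)) => n; apply/andP; split.
  apply: ub_le_sup; last by exists n.
  by exists (v 0%N) => _ [m _ <-].
by apply: ge_sup; [exists (u 0%N); exists 0%N|move=> _ [m _ <-]].
Qed.

(* The imaginary part of the integral of [f dz] over the positively oriented
   boundary of [a, b] x [c, d]. *)
Definition im_contour f a b c d : R :=
  \int[mu]_(x in `[a, b]) (Im (f (Complex x c)) - Im (f (Complex x d))) +
  \int[mu]_(y in `[c, d]) (Re (f (Complex b y)) - Re (f (Complex a y))).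

Definition cdiff_on f a b c d := forall x y, a <= x <= b -> c <= y <= d ->
  exists D, is_cderive f (Complex x y) D.

Lemma cdiff_onS f a b c d a' b' c' d' : a <= a' -> b' <= b -> c <= c' -> d' <= d ->
  cdiff_on f a b c d -> cdiff_on f a' b' c' d'.
Proof.
move=> aa bb cc dd fd x y /andP[ax xb] /andP[cy yd].
by apply: fd; [rewrite (le_trans aa)//= (le_trans xb)|rewrite (le_trans cc)//= (le_trans yd)].
Qed.

Definition cdiff_hline f a b y := forall x, a <= x <= b ->
  exists D, is_cderive f (Complex x y) D.

Definition cdiff_vline f c d x := forall y, c <= y <= d ->
  exists D, is_cderive f (Complex x y) D.

Lemma cdiff_on_hline f a b c d y : cdiff_on f a b c d -> c <= y <= d -> cdiff_hline f a b y.
Proof. by move=> fd cyd x axb; exact: fd. Qed.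

Lemma cdiff_on_vline f a b c d x : cdiff_on f a b c d -> a <= x <= b -> cdiff_vline f c d x.
Proof. by move=> fd cyd y axb; exact: fd. Qed.

Lemma cdiff_hlineS f a b y a' b' : a <= a' -> b' <= b -> cdiff_hline f a b y -> cdiff_hline f a' b' y.
Proof. by move=> aa bb fd x /andP[? ?]; apply: fd; rewrite (le_trans aa)// (le_trans _ bb). Qed.

Lemma cdiff_vlineS f c d x c' d' : c <= c' -> d' <= d -> cdiff_vline f c d x -> cdiff_vline f c' d' x.
Proof. by move=> aa bb fd y /andP[? ?]; apply: fd; rewrite (le_trans aa)// (le_trans _ bb). Qed.

Lemma continuous_hline (phi : R[i] -> R) f a b y : cdiff_hline f a b y ->
  (forall z w, `|phi z - phi w| <= normc (z - w)) ->
  mu.-integrable `[a, b] (EFin \o (fun x => phi (f (Complex x y)))).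
Proof.
move=> fd phiP; apply: continuous_itv_integrable => x axb.
have [D fD] := fd _ axb.
refine (@continuous_along f (fun t => Complex t y) phi x D fD _ phiP) => t.
by rewrite -normc_real /= !subrr.
Qed.

Lemma continuous_vline (phi : R[i] -> R) f c d x : cdiff_vline f c d x ->
  (forall z w, `|phi z - phi w| <= normc (z - w)) ->
  mu.-integrable `[c, d] (EFin \o (fun y => phi (f (Complex x y)))).
Proof.
move=> fd phiP; apply: continuous_itv_integrable => y cyd.
have [D fD] := fd _ cyd.
refine (@continuous_along f (fun t => Complex x t) phi y D fD _ phiP) => t.
by rewrite /= subrr expr0n add0r sqrtr_sqr.
Qed.

Lemma integrable_hline f a b y : cdiff_hline f a b y ->
  mu.-integrable `[a, b] (EFin \o (fun x => Im (f (Complex x y)))).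
Proof.
move=> /(@continuous_hline (@complex.Im R)); apply=> z w.
by apply: le_trans (ler_Im_normc _); case: z w => ? ? [].
Qed.

Lemma integrable_vline f c d x : cdiff_vline f c d x ->
  mu.-integrable `[c, d] (EFin \o (fun y => Re (f (Complex x y)))).
Proof.
move=> /(@continuous_vline (@complex.Re R)); apply=> z w.
by apply: le_trans (ler_Re_normc _); case: z w => ? ? [].
Qed.

Lemma im_contourE f a b c d : cdiff_hline f a b c -> cdiff_hline f a b d ->
  cdiff_vline f c d a -> cdiff_vline f c d b ->
  im_contour f a b c d =
  \int[mu]_(x in `[a, b]) Im (f (Complex x c)) -
  \int[mu]_(x in `[a, b]) Im (f (Complex x d)) +
  (\int[mu]_(y in `[c, d]) Re (f (Complex b y)) -
   \int[mu]_(y in `[c, d]) Re (f (Complex a y))).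
Proof.
by move=> hc hd va vb; rewrite /im_contour !RintegralB//;
  [exact: integrable_vline|exact: integrable_vline|
   exact: integrable_hline|exact: integrable_hline].
Qed.

Lemma im_contour_splith f a m b c d : a <= m <= b ->
  cdiff_hline f a b c -> cdiff_hline f a b d ->
  cdiff_vline f c d a -> cdiff_vline f c d m -> cdiff_vline f c d b ->
  im_contour f a b c d = im_contour f a m c d + im_contour f m b c d.
Proof.
move=> amb hc hd va vm vb; have /andP[am mb] := amb; have ab := le_trans am mb.
rewrite !im_contourE//;
  try by [apply: cdiff_hlineS hc|apply: cdiff_hlineS hd].
rewrite !(@Rintegral_itv_split _ a m b)//; [|exact: integrable_hline..].
by move: (\int[mu]_(x in _) _) => *; ring.
Qed.

Lemma im_contour_splitv f a b c m d : c <= m <= d ->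
  cdiff_hline f a b c -> cdiff_hline f a b m -> cdiff_hline f a b d ->
  cdiff_vline f c d a -> cdiff_vline f c d b ->
  im_contour f a b c d = im_contour f a b c m + im_contour f a b m d.
Proof.
move=> cmd hc hm hd va vb; have /andP[cm md] := cmd; have cd := le_trans cm md.
rewrite !im_contourE//;
  try by [apply: cdiff_vlineS va|apply: cdiff_vlineS vb].
rewrite !(@Rintegral_itv_split _ c m d)//; [|exact: integrable_vline..].
by move: (\int[mu]_(x in _) _) => *; ring.
Qed.

(** An affine function has contour integral zero: the horizontal sides contribute
    [Re B * (c - d) * (b - a)] and the vertical ones the opposite. What remains is the error, at
    most [2 * e] per unit length since each integrand is a difference of two values. *)
Lemma im_contour_near_affine f a b c d (A B z0 : R[i]) e :
  a <= b -> c <= d -> cdiff_hline f a b c -> cdiff_hline f a b d ->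
  cdiff_vline f c d a -> cdiff_vline f c d b ->
  (forall x y, a <= x <= b -> c <= y <= d ->
    normc (f (Complex x y) - A - (Complex x y - z0) * B) <= e) ->
  `|im_contour f a b c d| <= 2 * e * ((b - a) + (d - c)).
Proof.
move=> ab cd hc hd va vb near.
have H1 : `|\int[mu]_(x in `[a, b]) (Im (f (Complex x c)) - Im (f (Complex x d)))
           - (Re B * (c - d)) * (b - a)| <= (2 * e) * (b - a).
  apply: Rintegral_itv_near_cst => //.
    by apply: integrable_itvB; exact: integrable_hline.
  move=> x xab.
  have n1 := le_trans (ler_Im_normc _) (near x c xab ltac:(by rewrite cd lexx)).
  have n2 := le_trans (ler_Im_normc _) (near x d xab ltac:(by rewrite cd lexx)).
  move: n1 n2; case: (f _) => u1 v1; case: (f _) => u2 v2; case: A {near} => A1 A2.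
  case: B => B1 B2; case: z0 => z1 z2 /=; rewrite !ler_norml => /andP[? ?] /andP[? ?].
  by apply/andP; split; lra.
have H2 : `|\int[mu]_(y in `[c, d]) (Re (f (Complex b y)) - Re (f (Complex a y)))
           - (Re B * (b - a)) * (d - c)| <= (2 * e) * (d - c).
  apply: Rintegral_itv_near_cst => //.
    by apply: integrable_itvB; exact: integrable_vline.
  move=> y ycd.
  have n1 := le_trans (ler_Re_normc _) (near b y ltac:(by rewrite ab lexx) ycd).
  have n2 := le_trans (ler_Re_normc _) (near a y ltac:(by rewrite ab lexx) ycd).
  move: n1 n2; case: (f _) => u1 v1; case: (f _) => u2 v2; case: A {near H1} => A1 A2.
  case: B => B1 B2; case: z0 => z1 z2 /=; rewrite !ler_norml => /andP[? ?] /andP[? ?].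
  by apply/andP; split; lra.
rewrite /im_contour; move: H1 H2; set I1 := \int[_]_(x in _) _.
set I2 := \int[_]_(x in _) _; rewrite !ler_norml => /andP[? ?] /andP[? ?].
by apply/andP; split; lra.
Qed.

Lemma exp2_gt x : exists n, x < 2 ^+ n.
Proof.
exists (Num.truncn x).+1; apply: lt_trans (truncnS_gt x) _ => //.
by rewrite -natrX ltr_nat ltn_expl.
Qed.

(** The contours of the four quarters add up to the whole one, so one of them carries at least a
    quarter of its modulus. Sides are written [w + w] and [l + l] to make the halves syntactically
    visible. *)
Lemma im_contour_quadrisect f a c w l : 0 <= w -> 0 <= l ->
  cdiff_on f a (a + (w + w)) c (c + (l + l)) ->
  exists a' c', [/\ a <= a' <= a + w, c <= c' <= c + l &
    `|im_contour f a (a + (w + w)) c (c + (l + l))| <=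
    4 * `|im_contour f a' (a' + w) c' (c' + l)|].
Proof.
move=> w0 l0 fd.
have H1 : a <= a + w <= a + (w + w) by rewrite addrA !lerDl w0.
have H2 : c <= c + l <= c + (l + l) by rewrite addrA !lerDl l0.
have E : im_contour f a (a + (w + w)) c (c + (l + l)) =
    im_contour f a (a + w) c (c + l) +
    im_contour f a (a + w) (c + l) (c + l + l) +
    (im_contour f (a + w) (a + w + w) c (c + l) +
     im_contour f (a + w) (a + w + w) (c + l) (c + l + l)).
  have /andP[a1 a2] := H1; have /andP[c1 c2] := H2.
  have a3 := le_trans a1 a2; have c3 := le_trans c1 c2.
  rewrite -(addrA c) -(addrA a) (im_contour_splith H1);
    try by [apply: cdiff_on_vline fd _; rewrite ?lexx ?a1 ?a2 ?a3
           |apply: cdiff_on_hline fd _; rewrite ?lexx ?c1 ?c2 ?c3].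
  by congr (_ + _); apply: im_contour_splitv => //;
    try by [apply: cdiff_on_vline fd _; rewrite ?lexx ?a1 ?a2 ?a3
           |apply: cdiff_hlineS (cdiff_on_hline fd _); rewrite ?lexx ?c1 ?c2 ?c3].
set X := `|im_contour f a (a + (w + w)) c (c + (l + l))|.
have [J1|J1] := leP X (4 * `|im_contour f a (a + w) c (c + l)|).
  by exists a, c; rewrite J1 !lexx !lerDl w0 l0.
have [J2|J2] := leP X (4 * `|im_contour f a (a + w) (c + l) (c + l + l)|).
  by exists a, (c + l); rewrite J2 !lexx !lerDl w0 l0.
have [J3|J3] := leP X (4 * `|im_contour f (a + w) (a + w + w) c (c + l)|).
  by exists (a + w), c; rewrite J3 !lexx !lerDl w0 l0.
exists (a + w), (c + l); rewrite !lexx !lerDl w0 l0; split=> //.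
have X0 : X <= `|im_contour f a (a + w) c (c + l)| +
    `|im_contour f a (a + w) (c + l) (c + l + l)| +
    (`|im_contour f (a + w) (a + w + w) c (c + l)| +
     `|im_contour f (a + w) (a + w + w) (c + l) (c + l + l)|).
  by rewrite /X E; apply: le_trans (ler_normD _ _) (lerD (ler_normD _ _) (ler_normD _ _)).
move: J1 J2 J3 X0; clear; lra.
Qed.

Lemma nested_quadrisection f a b c d : a <= b -> c <= d -> cdiff_on f a b c d ->
  exists x y (s : nat -> R * R),
  [/\ a <= x <= b, c <= y <= d & forall n, let w := (b - a) / 2 ^+ n in
    let l := (d - c) / 2 ^+ n in
    [/\ a <= (s n).1 /\ (s n).1 + w <= b,
        c <= (s n).2 /\ (s n).2 + l <= d,
        (s n).1 <= x <= (s n).1 + w, (s n).2 <= y <= (s n).2 + l &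
        `|im_contour f a b c d| <=
        4 ^+ n * `|im_contour f (s n).1 ((s n).1 + w) (s n).2 ((s n).2 + l)|]].
Proof.
move=> ab cd fd; pose w n := (b - a) / 2 ^+ n; pose l n := (d - c) / 2 ^+ n.
have p2 n : (0 : R) < 2 ^+ n by rewrite exprn_gt0.
have wE n : w n = w n.+1 + w n.+1 by rewrite /w exprS invfM; field; rewrite gt_eqF.
have lE n : l n = l n.+1 + l n.+1 by rewrite /l exprS invfM; field; rewrite gt_eqF.
have w0 n : 0 <= w n by rewrite divr_ge0// ?subr_ge0// ltW.
have l0 n : 0 <= l n by rewrite divr_ge0// ?subr_ge0// ltW.
pose inv n (s : R * R) := [/\ a <= s.1 /\ s.1 + w n <= b, c <= s.2 /\ s.2 + l n <= d &
  `|im_contour f a b c d| <= 4 ^+ n * `|im_contour f s.1 (s.1 + w n) s.2 (s.2 + l n)|].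
(* The successor corner is chosen for every index and corner, with the invariant as a premise; the
   sequence is then a plain recursion. *)
have /choice[next nextP] : forall ns : nat * (R * R), exists s' : R * R,
    inv ns.1 ns.2 -> [/\ inv ns.1.+1 s',
      ns.2.1 <= s'.1 <= ns.2.1 + w ns.1.+1 & ns.2.2 <= s'.2 <= ns.2.2 + l ns.1.+1].
  move=> [n [a0 c0]] /=.
  have [iv|] := pselect (inv n (a0, c0)); last by exists (a0, c0).
  have [[/= i1 i2] [/= i3 i4] /= i5] := iv; rewrite wE lE in i2 i4 i5.
  have [|a' [c' [H1 H2 H3]]] := @im_contour_quadrisect f a0 c0 _ _ (w0 n.+1) (l0 n.+1).
    exact: cdiff_onS fd.
  exists (a', c') => _; split => //; split => /=.
  - by move: H1 i1 i2; clear; lra.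
  - by move: H2 i3 i4; clear; lra.
  - by rewrite exprSr -mulrA (le_trans i5)// ler_wpM2l// exprn_ge0.
pose s := fix s n := if n is m.+1 then next (m, s m) else (a, c).
have sP n : inv n (s n).
  elim: n => [|n /(nextP (n, _))[]//].
  by rewrite /inv /w /l /= !divr1 expr0 mul1r !subrKC !lexx.
have [x xP] : exists x, forall n, (s n).1 <= x <= (s n).1 + w n.
  apply: nested_intervals => n; last by rewrite lerDl.
    by have [_ /andP[]] := nextP (n, _) (sP n).
  have [_ /andP[_ /=]] := nextP (n, _) (sP n).
  by rewrite (wE n) addrA lerD2r.
have [y yP] : exists y, forall n, (s n).2 <= y <= (s n).2 + l n.
  apply: nested_intervals => n; last by rewrite lerDl.
    by have [_ _ /andP[]] := nextP (n, _) (sP n).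
  have [_ _ /andP[_ /=]] := nextP (n, _) (sP n).
  by rewrite (lE n) addrA lerD2r.
exists x, y, s; split.
- by have := xP 0%N; rewrite /w /= divr1 subrKC.
- by have := yP 0%N; rewrite /l /= divr1 subrKC.
- by move=> n; have [? ? ?] := sP n; split.
Qed.

(** Near the common point of the nested rectangles [f] is affine up to [e] times the half-perimeter.
    The contour integral of the [n]-th rectangle is therefore [O(e * 4^-n)], which cancels the
    factor [4^n] lost in the subdivision. *)
Lemma goursat f a b c d : a <= b -> c <= d -> cdiff_on f a b c d ->
  im_contour f a b c d = 0.
Proof.
move=> ab cd fd; apply/eqP; rewrite -normr_le0.
have [x [y [s [xab ycd sP]]]] := nested_quadrisection ab cd fd.
have [D fD] := fd _ _ xab ycd.
pose p := (b - a) + (d - c).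
have p0 : 0 <= p by rewrite addr_ge0 ?subr_ge0.
suff H e : 0 < e -> `|im_contour f a b c d| <= e * (2 * p ^+ 2).
  apply/ler_addgt0Pr => e e0; rewrite add0r.
  have q0 : 0 < 2 * p ^+ 2 + 1 by rewrite ltr_wpDl// mulr_ge0 ?sqr_ge0.
  have := H (e / (2 * p ^+ 2 + 1)) ltac:(by rewrite divr_gt0).
  move/le_trans; apply; rewrite -mulrA; apply: ler_piMr; first exact: ltW.
  by rewrite mulrC ler_pdivrMr// mul1r lerDl.
move=> e0; have [r r0 rP] := fD _ e0.
(* The [n]-th rectangle has half-perimeter [p / 2^n < r], so it lies where the first-order estimate
   with [e] is valid. *)
have [n nP] := exp2_gt (p / r).
have n0 : (0 : R) < 2 ^+ n by rewrite exprn_gt0.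
have [[i1 i2] [i3 i4] xn yn] := sP n.
move/le_trans; apply.
have nE : (4 : R) ^+ n = (2 ^+ n) ^+ 2 by rewrite -exprM mulnC exprM; congr (_ ^+ n); ring.
set w := (b - a) / 2 ^+ n in i1 i2 xn *; set l := (d - c) / 2 ^+ n in i3 i4 yn *.
have w0 : 0 <= w by rewrite divr_ge0// ?subr_ge0// ltW.
have l0 : 0 <= l by rewrite divr_ge0// ?subr_ge0// ltW.
have wl : w + l = p / 2 ^+ n by rewrite -mulrDl.
have wlr : w + l < r by rewrite wl ltr_pdivrMr// mulrC -ltr_pdivrMr.
set a0 := (s n).1 in i1 i2 xn *; set c0 := (s n).2 in i3 i4 yn *.
have sd : cdiff_on f a0 (a0 + w) c0 (c0 + l) by exact: cdiff_onS fd.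
have : `|im_contour f a0 (a0 + w) c0 (c0 + l)| <=
    2 * (e * (w + l)) * ((a0 + w - a0) + (c0 + l - c0)).
  apply: (@im_contour_near_affine _ _ _ _ _ (f (Complex x y)) D (Complex x y)).
  - by rewrite lerDl.
  - by rewrite lerDl.
  - by apply: cdiff_on_hline sd _; rewrite lexx lerDl ?andbT.
  - by apply: cdiff_on_hline sd _; rewrite lexx lerDl ?andbT.
  - by apply: cdiff_on_vline sd _; rewrite lexx lerDl ?andbT.
  - by apply: cdiff_on_vline sd _; rewrite lexx lerDl ?andbT.
  move=> x' y' H1 H2.
  have zr : normc (Complex x' y' - Complex x y) <= w + l.
    apply: le_trans (ler_normc_ReIm _) _ => /=.
    move: xn yn H1 H2; clear => ? ? ? ?.
    by apply: lerD; rewrite ler_norml; lra.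
  have := rP (Complex x' y' - Complex x y).
  rewrite subrKC => H; apply: le_trans (H (le_lt_trans zr wlr)) _.
  by rewrite ler_wpM2l// ltW.
rewrite (addrC a0) addrK (addrC c0) addrK => H.
rewrite nE; apply: le_trans (ler_wpM2l _ H) _; first by rewrite sqr_ge0.
rewrite wl; have -> : (2 ^+ n) ^+ 2 * (2 * (e * (p / 2 ^+ n)) * (p / 2 ^+ n)) = e * (2 * p ^+ 2).
  by field; rewrite gt_eqF.
exact: lexx.
Qed.

End Goursat.

(** * Cauchy's estimate on the boundary of a square *)

Section CauchySquare.
Variable R : realType.
Implicit Types (f : R[i] -> R[i]) (x y r s : R).
Local Notation mu := (@lebesgue_measure R).

Definition cdiff_at f z := exists D, is_cderive f z D.

Lemma derivable_quotient (K : numFieldType) (f : K^o -> K^o) (A B z0 z : K) :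
  z != z0 -> derivable f z 1 ->
  derivable (fun w : K^o => B * (f w - A) / (w - z0) : K^o) z 1.
Proof.
move=> zz0 fz.
have d1 : derivable (fun w : K^o => B * (f w - A) : K^o) z 1.
  apply: (@derivableM _ _ (cst B : K^o -> K^o) (fun w : K^o => f w - A : K^o)).
    exact: derivable_cst.
  by apply: (@derivableB _ _ _ f (cst A : K^o -> K^o)); [exact: fz|exact: derivable_cst].
have d2 : derivable (fun w : K^o => (w - z0)^-1 : K^o) z 1.
  apply: (@derivableV _ _ (fun w : K^o => w - z0 : K^o)); first by rewrite subr_eq0.
  by apply: (@derivableB _ _ _ (id : K^o -> K^o) (cst z0 : K^o -> K^o));
    [exact: derivable_id|exact: derivable_cst].
exact: (@derivableM _ _ (fun w : K^o => B * (f w - A) : K^o) (fun w : K^o => (w - z0)^-1 : K^o)).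
Qed.

Lemma cdiff_at_quotient f (A B z0 : R[i]) z : z != z0 -> cdiff_at f z ->
  cdiff_at (fun w => B * (f w - A) / (w - z0)) z.
Proof.
move=> zz0 /derivable_is_cderive fz; apply/derivable_is_cderive.
exact: derivable_quotient.
Qed.

Lemma normc_bounds_square (z : R[i]) r : 0 < r ->
  `|Re z| <= r -> `|Im z| <= r -> `|Re z| = r \/ `|Im z| = r ->
  r ^+ 2 <= Re z ^+ 2 + Im z ^+ 2 <= 2 * r ^+ 2.
Proof.
move=> r0 a b ab.
have a2 : Re z ^+ 2 <= r ^+ 2 by rewrite -real_normK ?num_real// ler_pXn2r ?nnegrE// ltW.
have b2 : Im z ^+ 2 <= r ^+ 2 by rewrite -real_normK ?num_real// ler_pXn2r ?nnegrE// ltW.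
apply/andP; split; last by move: a2 b2; clear; lra.
by case: ab => <-; rewrite real_normK ?num_real// ?lerDl ?lerDr sqr_ge0.
Qed.

(** Here [z] points from the centre to the boundary of the square and [phi] is the component along
    the outward normal ([Re] or [Im], up to sign). On a side [phi (a / z) = a * r / |z|^2], which is
    at least [a / (2 * r)] because even a corner satisfies [|z|^2 <= 2 * r^2]. *)
Lemma side_bound (F z : R[i]) (a r : R) (phi : R[i] -> R) : 0 < r -> 0 <= a ->
  r ^+ 2 <= normc z ^+ 2 <= 2 * r ^+ 2 ->
  (forall w, phi w <= normc w) -> (forall u w, phi (u - w) = phi u - phi w) ->
  phi (a%:C%C / z) = a * r / normc z ^+ 2 ->
  phi ((F - a%:C%C) / z) <= normc F / r - a / (2 * r).
Proof.
move=> r0 a0 /andP[z1 z2] phi1 phiB phiz.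
have z0 : 0 < normc z ^+ 2 by apply: lt_le_trans z1; rewrite exprn_gt0.
have rz : r <= normc z by rewrite -(ler_pXn2r (ltn0Sn 1)) ?nnegrE ?normc_ge0// ltW.
rewrite mulrBl phiB phiz; apply: lerB.
  apply: le_trans (phi1 _) _; rewrite normcM normcV ler_wpM2l ?normc_ge0//.
  by rewrite lef_pV2 ?posrE// (lt_le_trans r0).
rewrite ler_pdivlMr// mulrAC ler_pdivrMr ?mulr_gt0//.
by rewrite -mulrA ler_wpM2l//; move: z2; clear; lra.
Qed.

Lemma phi_real_div (a : R) (z : R[i]) :
  Re (a%:C%C / z) = a * Re z / normc z ^+ 2 /\
  Im (a%:C%C / z) = - (a * Im z / normc z ^+ 2).
Proof.
rewrite normc_sqr; case: z => x y /=; split.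
  by rewrite mul0r subr0 mulrA.
by rewrite mul0r addr0 mulrN mulrA.
Qed.

Lemma Rintegral_itv_affine (g : R -> R) a b k m : a <= b ->
  mu.-integrable `[a, b] (EFin \o g) ->
  \int[mu]_(x in `[a, b]) (k * g x - m) = k * \int[mu]_(x in `[a, b]) g x - m * (b - a)
  /\ mu.-integrable `[a, b] (EFin \o (fun x => k * g x - m)).
Proof.
move=> ab ig.
have ik : mu.-integrable `[a, b] (EFin \o (fun x => k * g x)).
  by have := integrableZl _ k ig; apply.
have ic : mu.-integrable `[a, b] (EFin \o cst m).
  by apply: continuous_itv_integrable => x _; exact: cst_continuous.
split; last exact: integrable_itvB.
rewrite -(fine_measure_itv ab) -(Rintegral_cst mu (measurable_itv _) m) RintegralB//.
by rewrite RintegralZl.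
Qed.

Lemma im_contour_bounded f a b c d M : a <= b -> c <= d ->
  cdiff_hline f a b c -> cdiff_hline f a b d ->
  cdiff_vline f c d a -> cdiff_vline f c d b ->
  (forall x y, a <= x <= b -> c <= y <= d -> normc (f (Complex x y)) <= M) ->
  `|im_contour f a b c d| <= 2 * M * ((b - a) + (d - c)).
Proof.
move=> ab cd hc hd va vb fM.
apply: (@im_contour_near_affine _ f a b c d 0 0 0) => // x y xab ycd.
by rewrite mulr0 !subr0; exact: fM.
Qed.

(** By Goursat the square can be shrunk around the puncture without changing the contour integral;
    as [f] stays bounded there, the integral is of the order of the side and hence zero. *)
Lemma im_contour_punctured f x0 y0 r M : 0 < r ->
  (forall x y, `|x - x0| <= r -> `|y - y0| <= r -> Complex x y != Complex x0 y0 ->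
     cdiff_at f (Complex x y)) ->
  (exists2 d, 0 < d & forall z, normc (z - Complex x0 y0) < d -> normc (f z) <= M) ->
  im_contour f (x0 - r) (x0 + r) (y0 - r) (y0 + r) = 0.
Proof.
move=> r0 fd [d d0 fM].
have M0 : 0 <= M.
  by apply: le_trans (normc_ge0 _) (fM (Complex x0 y0) _); rewrite subrr normc0.
have neqx x y : x != x0 -> Complex x y != Complex x0 y0.
  by apply: contra => /eqP[->].
have neqy x y : y != y0 -> Complex x y != Complex x0 y0.
  by apply: contra => /eqP[_ ->].
have hl s (b : bool) : 0 < s <= r -> cdiff_hline f (x0 - r) (x0 + r) (if b then y0 + s else y0 - s).
  move=> /andP[s0 sr] x xr; apply: fd.
  - by rewrite ler_distl.
  - by case: b; rewrite ler_distl; move: s0 sr; clear; lra.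
  - by apply: neqy; case: b; rewrite neq_lt ?ltrDl ?gtrBl s0 ?orbT.
have vl s (b : bool) : 0 < s <= r -> cdiff_vline f (y0 - r) (y0 + r) (if b then x0 + s else x0 - s).
  move=> /andP[s0 sr] x xr; apply: fd.
  - by case: b; rewrite ler_distl; move: s0 sr; clear; lra.
  - by rewrite ler_distl.
  - by apply: neqx; case: b; rewrite neq_lt ?ltrDl ?gtrBl s0 ?orbT.
have main s : 0 < s < r -> im_contour f (x0 - r) (x0 + r) (y0 - r) (y0 + r) =
    im_contour f (x0 - s) (x0 + s) (y0 - s) (y0 + s).
  move=> /andP[s0 sr]; have sr' : 0 < s <= r by rewrite s0 ltW.
  have rr : 0 < r <= r by rewrite r0 lexx.
  have h1 := hl _ true rr; have h2 := hl _ false rr; have h3 := hl _ true sr'; have h4 := hl _ false sr'.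
  have v1 := vl _ true rr; have v2 := vl _ false rr; have v3 := vl _ true sr'; have v4 := vl _ false sr'.
  (* The four rectangles that surround the small square avoid the puncture, so their contours
     vanish. *)
  have side a b c e : (b < x0 \/ x0 < a) \/ (e < y0 \/ y0 < c) ->
      a <= b -> c <= e ->
      x0 - r <= a -> b <= x0 + r -> y0 - r <= c -> e <= y0 + r ->
      im_contour f a b c e = 0.
    move=> off ab ce a1 b1 c1 e1; apply: goursat => // x y xab yce; apply: fd.
    - by rewrite ler_distl; move: xab a1 b1; clear; lra.
    - by rewrite ler_distl; move: yce c1 e1; clear; lra.
    - have : x != x0 \/ y != y0.
        move: off xab yce; rewrite !neq_lt; clear.
        case=> [[]|[]] => H /andP[X1 X2] /andP[Y1 Y2].
        + by left; rewrite (le_lt_trans X2 H).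
        + by left; rewrite (lt_le_trans H X1) orbT.
        + by right; rewrite (le_lt_trans Y2 H).
        + by right; rewrite (lt_le_trans H Y1) orbT.
      by case=> [/neqx|/neqy].
  rewrite (@im_contour_splith _ _ _ (x0 - s) (x0 + r)) //; last by move: s0 sr; clear; lra.
  rewrite side ?add0r; try by (try left; try left; move: s0 sr; clear; lra).
  rewrite (@im_contour_splith _ _ _ (x0 + s) (x0 + r)) //;
    try by [move: s0 sr; clear; lra | apply: (cdiff_hlineS _ _ h1); move: s0 sr; clear; lra
           | apply: (cdiff_hlineS _ _ h2); move: s0 sr; clear; lra].
  rewrite (side (x0 + s)) ?addr0; try by (try left; try right; move: s0 sr; clear; lra).
  have sub b : cdiff_hline f (x0 - r) (x0 + r) b -> cdiff_hline f (x0 - s) (x0 + s) b.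
    by apply: cdiff_hlineS; move: s0 sr; clear; lra.
  rewrite (@im_contour_splitv _ _ _ _ _ (y0 - s)) //;
    try by [move: s0 sr; clear; lra | exact: sub].
  rewrite side ?add0r; try by (try right; try left; move: s0 sr; clear; lra).
  rewrite (@im_contour_splitv _ _ _ _ _ (y0 + s)) //;
    try by [move: s0 sr; clear; lra | exact: sub
           | apply: (cdiff_vlineS _ _ v3); move: s0 sr; clear; lra
           | apply: (cdiff_vlineS _ _ v4); move: s0 sr; clear; lra].
  rewrite (side _ _ (y0 + s)) ?addr0; try by (try right; try right; move: s0 sr; clear; lra).
apply/eqP; rewrite -normr_le0; apply/ler_addgt0Pr => e e0; rewrite add0r.
have M1 : 0 < 8 * M + 1 by rewrite ltr_wpDl// mulr_ge0.
(* The bound [d / 3] puts the small square, whose points are within [2 * s] of the centre, inside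
   the region where [f] is bounded. The last entry makes the trivial bound [8 * M * s] at most
   [e]. *)
pose s := Num.min (r / 2) (Num.min (d / 3) (e / (8 * M + 1))).
have s0 : 0 < s by rewrite !lt_min !divr_gt0.
have sr : s < r by rewrite /s gt_min ltr_pdivrMr// ltr_pMr// ltr1n.
have sd : s <= d / 3 by rewrite /s !ge_min lexx !orbT.
have se : s * (8 * M + 1) <= e by rewrite -ler_pdivlMr// /s !ge_min lexx !orbT.
have ssr : 0 < s <= r by rewrite s0 ltW.
rewrite (main s) ?s0//.
have : `|im_contour f (x0 - s) (x0 + s) (y0 - s) (y0 + s)| <=
   2 * M * ((x0 + s - (x0 - s)) + (y0 + s - (y0 - s))).
  apply: im_contour_bounded.
  - by move: s0; clear; lra.
  - by move: s0; clear; lra.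
  - by apply: cdiff_hlineS (hl s false ssr); move: s0 sr; clear; lra.
  - by apply: cdiff_hlineS (hl s true ssr); move: s0 sr; clear; lra.
  - by apply: cdiff_vlineS (vl s false ssr); move: s0 sr; clear; lra.
  - by apply: cdiff_vlineS (vl s true ssr); move: s0 sr; clear; lra.
  move=> x y xs ys; apply: fM; apply: le_lt_trans (ler_normc_ReIm _) _ => /=.
  have H1 : `|x - x0| <= s by rewrite ler_distl.
  have H2 : `|y - y0| <= s by rewrite ler_distl.
  by apply: le_lt_trans (lerD H1 H2) _; move: sd d0; clear; lra.
move/le_trans; apply.
apply: le_trans se; move: s0; clear -M0 => s0.
by rewrite -subr_ge0 (_ : _ - _ = s) ?ltW//; ring.
Qed.

(* Goursat applied to [conj (f z0) * (f z - f z0) / (z - z0)]: only the imaginary part of the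
   contour integral is needed, because the factor [conj (f z0)] makes the singular part real. *)
Lemma cauchy_square f x0 y0 r : 0 < r ->
  (forall x y, `|x - x0| <= r -> `|y - y0| <= r -> cdiff_at f (Complex x y)) ->
  4 * r * normc (f (Complex x0 y0)) <=
  \int[mu]_(x in `[x0 - r, x0 + r])
    (normc (f (Complex x (y0 - r))) + normc (f (Complex x (y0 + r)))) +
  \int[mu]_(y in `[y0 - r, y0 + r])
    (normc (f (Complex (x0 + r) y)) + normc (f (Complex (x0 - r) y))).
Proof.
move=> r0 fd; set z0 := Complex x0 y0; set A := f z0.
have [A0|A0] := eqVneq A 0.
  rewrite A0 normc0 mulr0 addr_ge0// Rintegral_ge0// => x _;
    by rewrite addr_ge0 ?normc_ge0.
have nA : 0 < normc A by rewrite normc_gt0.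
pose g z := conjc A * (f z - A) / (z - z0).
have gd x y : `|x - x0| <= r -> `|y - y0| <= r -> Complex x y != z0 -> cdiff_at g (Complex x y).
  by move=> xr yr zz; apply: cdiff_at_quotient => //; exact: fd.
have g0 : im_contour g (x0 - r) (x0 + r) (y0 - r) (y0 + r) = 0.
  have [D fD] : cdiff_at f z0 by apply: fd; rewrite subrr normr0 ltW.
  apply: (@im_contour_punctured g x0 y0 r (normc A * (normc D + 1))) => //.
  have [d d0 dP] := fD _ ltr01.
  (* At [z0] itself the quotient is [0], since [0^-1 = 0]; elsewhere differentiability bounds it by
     [normc D + 1]. *)
  exists d => // z zd; rewrite /g; have [->|zz] := eqVneq z z0.
    by rewrite (subrr z0) invr0 mulr0 normc0 mulr_ge0 ?addr_ge0 ?normc_ge0.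
  rewrite -mulrA normcM normc_conj ler_wpM2l ?normc_ge0// normcM normcV.
  rewrite ler_pdivrMr ?normc_gt0 ?subr_eq0//.
  have := dP _ zd; rewrite -/z0 subrKC mul1r => H.
  rewrite -[f z - A](subrK ((z - z0) * D)); apply: le_trans (ler_normcD _ _) _.
  by rewrite normcM [leRHS]mulrC mulrDr mulr1 addrC lerD2l.
pose a := normc A ^+ 2.
have aE : conjc A * A = a%:C%C.
  by rewrite /a normc_sqr; case: (A) => p q; simpc => /=; congr Complex; ring.
have gE z : g z = (conjc A * f z - a%:C%C) / (z - z0) by rewrite /g mulrBr aE.
have a0 : 0 <= a by rewrite sqr_ge0.
pose h u v := normc A * (normc (f u) + normc (f v)) / r - a / r.
have bnd z (phi : R[i] -> R) : `|Re (z - z0)| <= r -> `|Im (z - z0)| <= r ->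
    `|Re (z - z0)| = r \/ `|Im (z - z0)| = r ->
    (forall w, phi w <= normc w) -> (forall u w, phi (u - w) = phi u - phi w) ->
    phi (a%:C%C / (z - z0)) = a * r / normc (z - z0) ^+ 2 ->
    phi (g z) <= normc A * normc (f z) / r - a / (2 * r).
  move=> h1 h2 h3 h4 h5 h6; rewrite gE -(normc_conj A) -normcM.
  by apply: side_bound => //; rewrite normc_sqr; exact: normc_bounds_square.
have ReB (u w : R[i]) : Re (u - w) = Re u - Re w by case: u w => ? ? [].
have ImB (u w : R[i]) : Im (u - w) = Im u - Im w by case: u w => ? ? [].
have NRe (u : R[i]) : `|Re u| <= normc u by exact: ler_Re_normc.
have NIm (u : R[i]) : `|Im u| <= normc u by exact: ler_Im_normc.
have nr : `|r| = r by rewrite gtr0_norm.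
have Hx x : `|x - x0| <= r ->
    Im (g (Complex x (y0 - r))) - Im (g (Complex x (y0 + r))) <=
    h (Complex x (y0 - r)) (Complex x (y0 + r)).
  move=> xr.
  have E1 : y0 - r - y0 = - r by ring.
  have E2 : y0 + r - y0 = r by ring.
  have B1 : Im (g (Complex x (y0 - r))) <= normc A * normc (f (Complex x (y0 - r))) / r - a / (2 * r).
    apply: (bnd (Complex x (y0 - r)) (@complex.Im R)) => //.
    - by rewrite /= E1 normrN nr.
    - by right; rewrite /= E1 normrN nr.
    - by move=> w; exact: le_trans (ler_norm _) (NIm w).
    - by rewrite (phi_real_div _ _).2 /= E1 mulrN mulNr opprK.
  have B2 : - Im (g (Complex x (y0 + r))) <= normc A * normc (f (Complex x (y0 + r))) / r - a / (2 * r).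
    apply: (bnd (Complex x (y0 + r)) (fun w => - Im w)) => //.
    - by rewrite /= E2 nr.
    - by right; rewrite /= E2 nr.
    - by move=> w; apply: le_trans (NIm w); rewrite -normrN ler_norm.
    - by move=> u w; rewrite ImB opprB opprK addrC.
    - by rewrite (phi_real_div _ _).2 /= E2 opprK.
  apply: le_trans (lerD B1 B2) _; rewrite /h le_eqVlt; apply/orP; left; apply/eqP.
  by field; rewrite gt_eqF.
have Hy y : `|y - y0| <= r ->
    Re (g (Complex (x0 + r) y)) - Re (g (Complex (x0 - r) y)) <=
    h (Complex (x0 + r) y) (Complex (x0 - r) y).
  move=> yr.
  have E1 : x0 - r - x0 = - r by ring.
  have E2 : x0 + r - x0 = r by ring.
  have B1 : Re (g (Complex (x0 + r) y)) <= normc A * normc (f (Complex (x0 + r) y)) / r - a / (2 * r).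
    apply: (bnd (Complex (x0 + r) y) (@complex.Re R)) => //.
    - by rewrite /= E2 nr.
    - by left; rewrite /= E2 nr.
    - by move=> w; exact: le_trans (ler_norm _) (NRe w).
    - by rewrite (phi_real_div _ _).1 /= E2.
  have B2 : - Re (g (Complex (x0 - r) y)) <= normc A * normc (f (Complex (x0 - r) y)) / r - a / (2 * r).
    apply: (bnd (Complex (x0 - r) y) (fun w => - Re w)) => //.
    - by rewrite /= E1 normrN nr.
    - by left; rewrite /= E1 normrN nr.
    - by move=> w; apply: le_trans (NRe w); rewrite -normrN ler_norm.
    - by move=> u w; rewrite ReB opprB opprK addrC.
    - by rewrite (phi_real_div _ _).1 /= E1 mulrN mulNr opprK.
  apply: le_trans (lerD B1 B2) _; rewrite /h le_eqVlt; apply/orP; left; apply/eqP.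
  by field; rewrite gt_eqF.
have ihl y : `|y - y0| <= r ->
    mu.-integrable `[x0 - r, x0 + r] (EFin \o (fun x => normc (f (Complex x y)))).
  by move=> yr; apply: (continuous_hline _ (@dist_normc R)) => x xr; apply: fd => //; rewrite ler_distl.
have ivl x : `|x - x0| <= r ->
    mu.-integrable `[y0 - r, y0 + r] (EFin \o (fun y => normc (f (Complex x y)))).
  by move=> xr; apply: (continuous_vline _ (@dist_normc R)) => y yr; apply: fd => //; rewrite ler_distl.
have itvD (g1 g2 : R -> R) u v : mu.-integrable `[u, v] (EFin \o g1) ->
    mu.-integrable `[u, v] (EFin \o g2) ->
    mu.-integrable `[u, v] (EFin \o (fun x => g1 x + g2 x)).
  by move=> i1 i2; have := integrableD _ i1 i2; apply.
have yp : `|y0 + r - y0| <= r by rewrite addrAC subrr add0r nr.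
have ym : `|y0 - r - y0| <= r by rewrite addrAC subrr add0r normrN nr.
have xp : `|x0 + r - x0| <= r by rewrite addrAC subrr add0r nr.
have xm : `|x0 - r - x0| <= r by rewrite addrAC subrr add0r normrN nr.
have rN u : u - r <= u + r by move: r0; clear; lra.
have [EX iX] := Rintegral_itv_affine (normc A / r) (a / r) (rN x0) (itvD _ _ _ _ (ihl _ ym) (ihl _ yp)).
have [EY iY] := Rintegral_itv_affine (normc A / r) (a / r) (rN y0) (itvD _ _ _ _ (ivl _ xp) (ivl _ xm)).
set FX := (fun x => normc (f (Complex x (y0 - r))) + normc (f (Complex x (y0 + r)))) in EX iX *.
set FY := (fun y => normc (f (Complex (x0 + r) y)) + normc (f (Complex (x0 - r) y))) in EY iY *.
set IX := \int[mu]_(x in _) FX x in EX *; set IY := \int[mu]_(y in _) FY y in EY *.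
have neqy x y : `|y - y0| = r -> Complex x y != z0.
  by move=> yr; apply/eqP => -[_ E]; move: yr r0; rewrite E subrr normr0 => <-; rewrite ltxx.
have neqx x y : `|x - x0| = r -> Complex x y != z0.
  by move=> yr; apply/eqP => -[E _]; move: yr r0; rewrite E subrr normr0 => <-; rewrite ltxx.
have yp' : `|y0 + r - y0| = r by rewrite addrAC subrr add0r nr.
have ym' : `|y0 - r - y0| = r by rewrite addrAC subrr add0r normrN nr.
have xp' : `|x0 + r - x0| = r by rewrite addrAC subrr add0r nr.
have xm' : `|x0 - r - x0| = r by rewrite addrAC subrr add0r normrN nr.
have LX : \int[mu]_(x in `[x0 - r, x0 + r])
    (Im (g (Complex x (y0 - r))) - Im (g (Complex x (y0 + r)))) <=
    normc A / r * IX - a / r * (x0 + r - (x0 - r)).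
  rewrite -EX; apply: le_Rintegral => //.
    by apply: integrable_itvB; apply: integrable_hline => x xr;
      (apply: gd => //; [by rewrite ler_distl|exact: neqy]).
  move=> x; rewrite /= in_itv/= -ler_distl => xr.
  by apply: le_trans (Hx _ xr) _; rewrite /h mulrAC.
have LY : \int[mu]_(y in `[y0 - r, y0 + r])
    (Re (g (Complex (x0 + r) y)) - Re (g (Complex (x0 - r) y))) <=
    normc A / r * IY - a / r * (y0 + r - (y0 - r)).
  rewrite -EY; apply: le_Rintegral => //.
    by apply: integrable_itvB; apply: integrable_vline => x xr;
      (apply: gd => //; [by rewrite ler_distl|exact: neqx]).
  move=> x; rewrite /= in_itv/= -ler_distl => xr.
  by apply: le_trans (Hy _ xr) _; rewrite /h mulrAC.
(* The left-hand side is the contour integral of [g], which is zero. On the right the constants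
   [a / r] integrate to [4 * a = 4 * normc A ^+ 2]; dividing by [normc A / r] leaves the claim. *)
have := lerD LX LY; rewrite -/(im_contour g _ _ _ _) g0.
have -> : normc A / r * IX - a / r * (x0 + r - (x0 - r)) +
   (normc A / r * IY - a / r * (y0 + r - (y0 - r))) =
   (normc A / r) * (IX + IY - 4 * r * normc A).
  by rewrite /a; field; rewrite gt_eqF.
by rewrite pmulr_rge0 ?divr_gt0// subr_ge0.
Qed.
End CauchySquare.

(** * Integration on the line and measurability in the plane *)

Section MeasurePrelim.
Local Open Scope ereal_scope.

(** The integral of a nonnegative function is the supremum over the simple functions below it, and a
    larger function has more of these. This compares arbitrary integrands, in particular powers of
    cone integrals with their majorants. *)
Lemma ge0_le_integral_nomeas d (T : measurableType d) (R : realType)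
    (mu : {measure set T -> \bar R}) (D : set T) (f g : T -> \bar R) :
  (forall x, D x -> 0 <= f x) -> (forall x, D x -> f x <= g x) ->
  \int[mu]_(x in D) f x <= \int[mu]_(x in D) g x.
Proof.
move=> f0 fg; rewrite !ge0_integralE//; last first.
  by move=> x Dx; exact: le_trans (f0 _ Dx) (fg _ Dx).
apply: le_ereal_sup => _ [h /= hf <-]; exists h => //= x.
apply: le_trans (hf x) _; rewrite !patchE; case: ifPn => // xD.
by apply: fg; rewrite inE in xD.
Qed.

Lemma ge0_le_integral_set d (T : measurableType d) (R : realType)
    (mu : {measure set T -> \bar R}) (D E : set T) (f g : T -> \bar R) :
  (forall x, D x -> 0 <= f x) -> (forall x, D x -> E x /\ f x <= g x) ->
  (forall x, E x -> 0 <= g x) ->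
  \int[mu]_(x in D) f x <= \int[mu]_(x in E) g x.
Proof.
move=> f0 fg g0; rewrite integral_mkcond [leRHS]integral_mkcond.
apply: ge0_le_integral_nomeas => x _; rewrite !patchE; case: ifPn => // xD.
- by apply: f0; rewrite inE in xD.
- by rewrite inE in xD; have [Ex fgx] := fg _ xD; rewrite mem_set.
- by case: ifPn => // xE; apply: g0; rewrite inE in xE.
Qed.

Context {R : realType}.
Local Notation mu := (@lebesgue_measure R).

(** The preimage of a half-open interval is an interval of the same length, and Lebesgue measure is
    determined by these lengths. *)
Lemma lebesgue_measure_affine (s c : R) (A : set (measurableTypeR R)) : (s = 1 \/ s = -1)%R ->
  measurable A ->
  pushforward mu (fun x : measurableTypeR R => (s * x + c)%R : measurableTypeR R) A = mu A.
Proof.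
move=> s1 mA; apply/esym.
have mphi : measurable_fun setT (fun x : measurableTypeR R => (s * x + c)%R : measurableTypeR R).
  by apply: measurable_funD => //; apply: measurable_funM.
have := @lebesgue_measure_unique R (pushforward mu (fun x : measurableTypeR R => (s * x + c)%R : measurableTypeR R)).
move=> /(_ mphi) H; apply: H => // _ [[a b]] _ <-.
case: s1 => s1; rewrite {}s1 in mphi *.
  rewrite [RHS](_ : _ = mu `](a - c)%R, (b - c)%R]); last first.
    congr (mu _); apply/seteqP; split => x /=; rewrite !in_itv/= mul1r => /andP[? ?]; apply/andP; split; lra.
  rewrite !lebesgue_measure_itv/= !lte_fin ltrD2r; case: ifP => //= _.
  by rewrite -!EFinB; congr EFin; ring.
rewrite [RHS](_ : _ = mu `[(c - b)%R, (c - a)%R[); last first.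
  congr (mu _); apply/seteqP; split => x /=; rewrite !in_itv/= mulN1r => /andP[? ?]; apply/andP; split; lra.
rewrite !lebesgue_measure_itv/= !lte_fin ltrD2l ltrN2; case: ifP => //= _.
by rewrite -!EFinB; congr EFin; ring.
Qed.

Lemma ge0_integral_affine (s c : R) (g : R -> \bar R) : (s = 1 \/ s = -1)%R ->
  measurable_fun [set: R] g -> (forall x, 0 <= g x) ->
  \int[mu]_x g (s * x + c)%R = \int[mu]_x g x.
Proof.
move=> s1 mg g0.
have mphi : measurable_fun setT (fun x : measurableTypeR R => (s * x + c)%R : measurableTypeR R).
  by apply: measurable_funD => //; apply: measurable_funM.
have := @ge0_integral_pushforward _ _ (measurableTypeR R) (measurableTypeR R) R _ mphi mu setT g.
rewrite preimage_setT => <- //.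
by apply: eq_measure_integral => A mA _; exact: lebesgue_measure_affine.
Qed.

(** An open set is the countable union of the open squares with rational centre and rational
    half-side that it contains. *)
Lemma open_measurable2 (O : set (R * R)) :
  (forall w, O w -> exists2 r : R, (0 < r)%R &
     forall w', (`|w'.1 - w.1| < r)%R -> (`|w'.2 - w.2| < r)%R -> O w') ->
  measurable (O : set (measurableTypeR R * measurableTypeR R)).
Proof.
move=> Oo.
pose B (q : rat * rat * rat) : set (measurableTypeR R * measurableTypeR R) :=
  `](ratr q.1.1 - ratr q.2 : R)%R, (ratr q.1.1 + ratr q.2)%R[ `*`
  `](ratr q.1.2 - ratr q.2 : R)%R, (ratr q.1.2 + ratr q.2)%R[.
pose F q : set (measurableTypeR R * measurableTypeR R) :=
  if `[< B q `<=` O >] then B q else set0.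
have -> : (O : set (measurableTypeR R * measurableTypeR R)) = \bigcup_q F q.
  apply/seteqP; split => [w Ow|w [q _]]; last first.
    by rewrite /F; case: asboolP => // BO /BO.
  have [r r0 rP] := Oo _ Ow.
  (* Half-side in [(r/4, r/2)], centre within [r/4] of [w]: the square contains [w] and stays within
     [3 r / 4] of it. *)
  have [q3] := @rat_in_itvoo R (r / 4) (r / 2) ltac:(lra).
  rewrite in_itv/= => /andP[q31 q32].
  have [q1] := @rat_in_itvoo R (w.1 - r / 4) (w.1 + r / 4) ltac:(lra).
  rewrite in_itv/= => /andP[q11 q12].
  have [q2] := @rat_in_itvoo R (w.2 - r / 4) (w.2 + r / 4) ltac:(lra).
  rewrite in_itv/= => /andP[q21 q22].
  exists (q1, q2, q3) => //; rewrite /F; case: asboolP => [_|[]].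
    by split; rewrite /= in_itv/=; apply/andP; split; lra.
  move=> w' [/=]; rewrite !in_itv/= => /andP[? ?] /andP[? ?].
  by apply: rP; rewrite ltr_norml; apply/andP; split; lra.
apply: countable_bigcupT_measurable; first exact: countableP.
move=> q; rewrite /F; case: ifP => _ //; exact: measurableX.
Qed.

Lemma continuous_measurable2 (S : set (measurableTypeR R * measurableTypeR R)) (phi : R * R -> R) :
  measurable S ->
  (forall w, S w -> forall e : R, (0 < e)%R -> exists2 r : R, (0 < r)%R &
     forall w', (`|w'.1 - w.1| < r)%R -> (`|w'.2 - w.2| < r)%R -> (`|phi w' - phi w| < e)%R) ->
  measurable_fun S (phi : measurableTypeR R * measurableTypeR R -> R).
Proof.
move=> mS phic; apply: (measurability _ (RGenOInfty.measurableE R)) => //.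
move=> /= _ [_ [a ->]] <-.
pose O : set (R * R) := [set w | exists2 r : R, (0 < r)%R &
  forall w', (`|w'.1 - w.1| < r)%R -> (`|w'.2 - w.2| < r)%R -> (a < phi w')%R].
have -> : S `&` phi @^-1` `]a, +oo[ = S `&` O.
  apply/seteqP; split => w [Sw] /=; rewrite in_itv/= ?andbT.
    move=> aw; split=> //; have [|r r0 rP] := phic _ Sw (phi w - a)%R; first by rewrite subr_gt0.
    exists r => // w' h1 h2; have := rP _ h1 h2.
    by rewrite ltr_norml => /andP[]; lra.
  by move=> [r r0 rP]; split => //; apply: rP; rewrite subrr normr0.
apply: measurableI => //; apply: open_measurable2 => w [r r0 rP].
exists (r / 2)%R; first by rewrite divr_gt0.
move=> w' h1 h2; exists (r / 2)%R; first by rewrite divr_gt0.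
move=> w'' h3 h4; apply: rP.
  have := ltrD h1 h3; rewrite -splitr; apply: le_lt_trans.
  by rewrite [leRHS]addrC ler_distD.
have := ltrD h2 h4; rewrite -splitr; apply: le_lt_trans.
by rewrite [leRHS]addrC ler_distD.
Qed.

End MeasurePrelim.

Section AreaMean.
Context {R : realType}.
Implicit Types (f : R[i] -> R[i]) (x y r : R).
Local Notation mu := (@lebesgue_measure R).
Local Notation T2 := (measurableTypeR R * measurableTypeR R)%type.

Local Notation area := (@lebesgue_measure R \x @lebesgue_measure R)%E.

Definition square x y r : set T2 := `[x - r, x + r] `*` `[y - r, y + r].

Lemma squareE x y r (w : T2) : square x y r w <-> `|w.1 - x| <= r /\ `|w.2 - y| <= r.
Proof. by rewrite /square /= !in_itv/= -!ler_distl. Qed.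

Lemma measurable_square x y r : measurable (square x y r).
Proof. by apply: measurableX. Qed.

Lemma area_square x y r : 0 <= r -> area (square x y r) = (4 * r ^+ 2)%:E.
Proof.
move=> r0.
have L z : mu `[(z - r)%R, (z + r)%R] = (2 * r)%:E.
  rewrite lebesgue_measure_itv/= lte_fin; rewrite le_eqVlt in r0; case/predU1P: r0 => [<-|r0].
    by rewrite subr0 addr0 ltxx mulr0.
  by rewrite ifT; [rewrite -EFinB; congr EFin; ring|lra].
rewrite /square product_measure1E//.
transitivity ((2 * r)%:E * (2 * r)%:E)%E; first by congr (_ * _)%E; exact: L.
by rewrite -EFinM; congr EFin; ring.
Qed.

Lemma normc_pair (w w' : T2) : normc (Complex w'.1 w'.2 - Complex w.1 w.2) <= `|w'.1 - w.1| + `|w'.2 - w.2|.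
Proof. exact: ler_normc_ReIm. Qed.

Lemma cdiff_continuous2 f (w : T2) : cdiff_at f (Complex w.1 w.2) ->
  forall e : R, 0 < e -> exists2 r : R, 0 < r &
    forall w' : T2, `|w'.1 - w.1| < r -> `|w'.2 - w.2| < r ->
      `|normc (f (Complex w'.1 w'.2)) - normc (f (Complex w.1 w.2))| < e.
Proof.
move=> [D fD] e e0; have [r r0 rP] := is_cderive_continuous fD e0.
exists (r / 2); first by rewrite divr_gt0.
move=> w' h1 h2.
have H : normc (f (Complex w'.1 w'.2) - f (Complex w.1 w.2)) < e.
  rewrite -(subrKC (Complex w.1 w.2) (Complex w'.1 w'.2)); apply: rP.
  by apply: le_lt_trans (normc_pair _ _) _; rewrite (splitr r) ltrD.
exact: le_lt_trans (dist_normc _ _) H.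
Qed.

Lemma measurable_normc f (S : set T2) : measurable S ->
  (forall w, S w -> cdiff_at f (Complex w.1 w.2)) ->
  measurable_fun S (fun w : T2 => normc (f (Complex w.1 w.2))).
Proof.
by move=> mS fd; apply: continuous_measurable2 => // w Sw; exact/cdiff_continuous2/fd.
Qed.

Local Open Scope ereal_scope.

(** The hypothesis on [r] is integrated over [[rho/2, rho]]: the left side is there at least
    [2 * rho * A], which gives [rho^2 * A], and each of the four terms on the right is, after a
    reflection or a translation, part of an integral equal to [I]. *)
Lemma four_sides_average (F G : R -> \bar R) (I : \bar R) (x0 y0 rho A : R) :
  (0 < rho)%R -> (0 <= A)%R ->
  measurable_fun setT F -> measurable_fun setT G ->
  (forall x, 0 <= F x) -> (forall x, 0 <= G x) ->
  \int[mu]_x F x = I -> \int[mu]_x G x = I ->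
  (forall r : R, (0 < r <= rho)%R ->
    (4 * r * A)%:E <= G (y0 - r)%R + G (y0 + r)%R + (F (x0 + r)%R + F (x0 - r)%R)) ->
  (rho ^+ 2 * A)%:E <= 4%:E * I.
Proof.
move=> rho0 A0 mF mG F0 G0 intF intG side.
have mcomp (g : R -> \bar R) (s c : R) : measurable_fun setT g -> measurable_fun setT (fun r => g (s * r + c)%R).
  move=> mg; apply: (measurableT_comp mg).
  by apply: measurable_funD => //; apply: measurable_funM.
have I0 : 0 <= I by rewrite -intF; apply: integral_ge0.
have sum2 (g : R -> \bar R) (c : R) : measurable_fun setT g -> (forall x, 0 <= g x) -> 
    \int[mu]_x g x = I ->
    [/\ measurable_fun setT (fun r => g (-1 * r + c)%R + g (1 * r + c)%R),
      forall r : R, 0 <= g (-1 * r + c)%R + g (1 * r + c)%R &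
      \int[mu]_r (g (-1 * r + c)%R + g (1 * r + c)%R) = I + I].
  move=> mg g0 ig; split.
  - by apply: emeasurable_funD; exact: mcomp.
  - by move=> r; rewrite adde_ge0.
  rewrite ge0_integralD//; [|exact: mcomp|exact: mcomp].
  rewrite (ge0_integral_affine c _ mg g0) ?(ge0_integral_affine c _ mg g0) ?ig//; [by left|by right].
have [mF2 F2 iF2] := sum2 F x0 mF F0 intF.
have [mG2 G2 iG2] := sum2 G y0 mG G0 intG.
have : \int[mu]_(r in `[(rho / 2)%R, rho]) (2 * rho * A)%:E <=
   \int[mu]_r ((G (-1 * r + y0)%R + G (1 * r + y0)%R) + (F (-1 * r + x0)%R + F (1 * r + x0)%R)).
  apply: ge0_le_integral_set.
  - by move=> r _; rewrite lee_fin !mulr_ge0// ltW.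
  - move=> r; rewrite /= in_itv/= => /andP[r1 r2]; split=> //.
    have r0 : (0 < r)%R by apply: lt_le_trans r1; rewrite divr_gt0.
    rewrite !mulN1r !mul1r !(addrC _ y0) !(addrC _ x0) (addeC (F (x0 - r)%R)).
    apply: le_trans (side r _); last by rewrite r0.
    by rewrite lee_fin ler_wpM2r//; lra.
  - by move=> r _; apply: adde_ge0.
rewrite integral_cst//= lebesgue_measure_itv/= lte_fin ifT; last by lra.
rewrite ge0_integralD// iF2 iG2 => H1.
have -> : (rho ^+ 2 * A)%:E = (2 * rho * A)%:E * (rho%:E - (rho / 2)%:E).
  by rewrite -EFinB -EFinM; congr EFin; field.
apply: le_trans H1 _.
rewrite (_ : 4%R = (1 + 1 + (1 + 1))%R :> R); last by ring.
by rewrite !EFinD !ge0_muleDl ?mul1e// -?EFinD lee_fin; lra.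
Qed.

(** The sides of the concentric squares sweep out the large one, so [cauchy_square] is integrated
    over their size. [F] and [G] are the integrals of [|f|], cut off outside the large square, along
    vertical and horizontal lines; by Fubini both have the area integral as their total. *)
Lemma area_mean_value f x0 y0 (rho : R) : (0 < rho)%R ->
  (forall w, square x0 y0 rho w -> cdiff_at f (Complex w.1 w.2)) ->
  (rho ^+ 2 * normc (f (Complex x0 y0)))%:E <=
  4%:E * \int[area]_(w in square x0 y0 rho) (normc (f (Complex w.1 w.2)))%:E.
Proof.
move=> rho0 fd; pose A := normc (f (Complex x0 y0)).
have A0 : (0 <= A)%R by exact: normc_ge0.
pose H := (fun w : T2 => (normc (f (Complex w.1 w.2)))%:E) \_ (square x0 y0 rho).
have mH : measurable_fun setT H.
  apply/(measurable_restrictT _ (measurable_square _ _ _)).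
  by apply/measurable_EFinP; apply: measurable_normc => //; exact: measurable_square.
have H0 w : 0 <= H w by rewrite /H patchE; case: ifP => // _; rewrite lee_fin normc_ge0.
have HE : \int[area]_(w in square x0 y0 rho) (normc (f (Complex w.1 w.2)))%:E = \int[area]_w H w.
  by rewrite integral_mkcond.
pose F := fubini_F mu H; pose G := fubini_G mu H.
have mF : measurable_fun setT F by exact: measurable_fun_fubini_tonelli_F.
have mG : measurable_fun setT G by exact: measurable_fun_fubini_tonelli_G.
have F0 x : 0 <= F x by apply: integral_ge0.
have G0 x : 0 <= G x by apply: integral_ge0.
have intF : \int[mu]_x F x = \int[area]_w H w by rewrite (fubini_tonelli1 H).
have intG : \int[mu]_x G x = \int[area]_w H w by rewrite (fubini_tonelli2 H).
have fdr r x y : (r <= rho)%R -> (`|x - x0| <= r)%R -> (`|y - y0| <= r)%R -> cdiff_at f (Complex x y).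
  by move=> rr xr yr; apply: (fd (x, y)); apply/squareE; rewrite !(le_trans _ rr).
have side (r : R) : (0 < r <= rho)%R -> (4 * r * A)%:E <= G (y0 - r)%R + G (y0 + r)%R + (F (x0 + r)%R + F (x0 - r)%R).
  move=> /andP[r0 rr].
  have := cauchy_square r0 (fun x y => @fdr r x y rr); rewrite -/A -lee_fin => /le_trans; apply.
  have nr : `|r|%R = r by rewrite gtr0_norm.
  have yp : (`|y0 + r - y0| <= r)%R by rewrite addrAC subrr add0r nr.
  have ym : (`|y0 - r - y0| <= r)%R by rewrite addrAC subrr add0r normrN nr.
  have xp : (`|x0 + r - x0| <= r)%R by rewrite addrAC subrr add0r nr.
  have xm : (`|x0 - r - x0| <= r)%R by rewrite addrAC subrr add0r normrN nr.
  have ihl y : (`|y - y0| <= r)%R ->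
      mu.-integrable `[(x0 - r)%R, (x0 + r)%R] (EFin \o (fun x => normc (f (Complex x y)))).
    by move=> yr; apply: (continuous_hline _ (@dist_normc R)) => x xr; apply: fdr rr _ _ => //; rewrite ler_distl.
  have ivl x : (`|x - x0| <= r)%R ->
      mu.-integrable `[(y0 - r)%R, (y0 + r)%R] (EFin \o (fun y => normc (f (Complex x y)))).
    by move=> xr; apply: (continuous_vline _ (@dist_normc R)) => y yr; apply: fdr rr _ _ => //; rewrite ler_distl.
  have split (g1 g2 : R -> R) u v : mu.-integrable `[u, v] (EFin \o g1) ->
      mu.-integrable `[u, v] (EFin \o g2) -> (forall t, 0 <= g1 t)%R -> (forall t, 0 <= g2 t)%R ->
      (\int[mu]_(t in `[u, v]) (g1 t + g2 t)%R)%R%:E =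
      \int[mu]_(t in `[u, v]) (g1 t)%:E + \int[mu]_(t in `[u, v]) (g2 t)%:E.
    move=> i1 i2 g10 g20; rewrite RintegralD// EFinD /Rintegral !fineK//; exact: integrable_fin_num.
  rewrite EFinD (split _ _ _ _ (ihl _ ym) (ihl _ yp)); [|by move=> ?; exact: normc_ge0..].
  rewrite (split _ _ _ _ (ivl _ xp) (ivl _ xm)); [|by move=> ?; exact: normc_ge0..].
  have hG y : (`|y - y0| <= r)%R ->
      \int[mu]_(x in `[(x0 - r)%R, (x0 + r)%R]) (normc (f (Complex x y)))%:E <= G y.
    move=> yr; apply: ge0_le_integral_set => // [x _|x].
      by rewrite lee_fin normc_ge0.
    rewrite /= in_itv/= -ler_distl => xr; split => //.
    rewrite /H patchE mem_set//; apply/squareE; split => /=; exact: le_trans rr.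
  have hF x : (`|x - x0| <= r)%R ->
      \int[mu]_(y in `[(y0 - r)%R, (y0 + r)%R]) (normc (f (Complex x y)))%:E <= F x.
    move=> yr; apply: ge0_le_integral_set => // [y _|y].
      by rewrite lee_fin normc_ge0.
    rewrite /= in_itv/= -ler_distl => xr; split => //.
    rewrite /H patchE mem_set//; apply/squareE; split => /=; exact: le_trans rr.
  by apply: leeD; apply: leeD; auto.
rewrite HE; exact: (four_sides_average rho0 A0 mF mG F0 G0 intF intG side).
Qed.

End AreaMean.

(** * The sub-mean value inequality for powers of the modulus *)

Section SubMean.
Context {R : realType}.
Implicit Types (f : R[i] -> R[i]) (x y r : R).
Local Notation T2 := (measurableTypeR R * measurableTypeR R)%type.
Local Notation area := (@lebesgue_measure R \x @lebesgue_measure R)%E.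

Lemma ler_powR2 x y r : 0 <= r -> 0 <= x -> x <= y -> powR x r <= powR y r.
Proof.
by move=> r0 x0 xy; apply: ge0_ler_powR; rewrite ?nnegrE// (le_trans x0).
Qed.

Lemma powR_inv x r : 0 <= x -> powR x^-1 r = powR x (- r).
Proof. by move=> x0; rewrite -powR_inv1// -powRrM mulN1r. Qed.

Lemma powR_between x r (B : R) : 0 < B -> B^-1 <= x -> x <= B -> powR x r <= powR B `|r|.
Proof.
move=> B0 x1 x2; have x0 : 0 < x by apply: lt_le_trans x1; rewrite invr_gt0.
have [r0|r0] := leP 0 r.
  by rewrite ger0_norm//; apply: ler_powR2 => //; exact: ltW.
rewrite ltr0_norm// -[in leLHS](opprK r) -(powR_inv _ (ltW x0)); apply: ler_powR2.
- by rewrite oppr_ge0 ltW.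
- by rewrite invr_ge0 ltW.
- by rewrite -[B]invrK lef_pV2 ?posrE// invr_gt0.
Qed.

(** Write [t = t^(1-q) * t^q]. Since [t / N] lies between [1/B] and [B], the factor [t^(1-q)] is at
    most [B^|1-q| * N^(1-q)], whatever the sign of [1 - q]. *)
Lemma ler_powR_scale (t N B q : R) : 0 < N -> 0 < B -> N / B <= t -> t <= N * B ->
  t <= powR B `|1 - q| * powR N (1 - q) * powR t q.
Proof.
move=> N0 B0 t1 t2; have t0 : 0 < t by apply: lt_le_trans t1; rewrite divr_gt0.
rewrite -{1}(powRr1 (ltW t0)) -{1}(subrK q 1) powRD; last by apply/implyP => _; rewrite gt_eqF.
rewrite ler_wpM2r ?powR_ge0//.
have tE : t = N * (t / N) by field; rewrite gt_eqF.
rewrite {1}tE powRM; [|exact: ltW|by rewrite divr_ge0// ltW].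
rewrite mulrC ler_wpM2r ?powR_ge0//; apply: powR_between => //.
- by rewrite ler_pdivlMr// mulrC.
- by rewrite ler_pdivrMr// mulrC.
Qed.

(** The weight vanishes on the boundary, which keeps a nontrivial maximum inside. For [m = 0] it is
    [1], and the statement is the existence of a maximum on the closed square. *)
Lemma square_weighted_max (phi : R * R -> R) (x0 y0 rho : R) (m : nat) : 0 < rho ->
  (forall w, square x0 y0 rho w -> forall e : R, 0 < e -> exists2 r : R, 0 < r &
     forall w' : R * R, `|w'.1 - w.1| < r -> `|w'.2 - w.2| < r -> `|phi w' - phi w| < e) ->
  exists2 w1, square x0 y0 rho w1 & forall w, square x0 y0 rho w ->
    phi w * ((rho - `|w.1 - x0|) * (rho - `|w.2 - y0|)) ^+ m <=
    phi w1 * ((rho - `|w1.1 - x0|) * (rho - `|w1.2 - y0|)) ^+ m.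
Proof.
move=> rho0 phic.
pose h (w : (R * R)%type) := phi w * ((rho - `|w.1 - x0|) * (rho - `|w.2 - y0|)) ^+ m.
have [||| w1 w1A w1P] := @compact_EVT_max (R * R)%type R h (square x0 y0 rho : set (R * R)).
- by exists (x0, y0); apply/squareE; rewrite /= !subrr !normr0 ltW.
- by apply: compact_setX; exact: segment_compact.
- apply: continuous_in_subspaceT => w; rewrite inE => wS.
  have cphi : {for w, continuous phi}.
    apply/cvgrPdist_lt => e e0; have [r r0 rP] := phic _ wS e e0.
    apply: (filterS _ (nbhsx_ballx w r r0)) => w' [/= h1 h2].
    by rewrite distrC; apply: rP; rewrite distrC.
  apply: cvgM => //; apply: (@continuous_comp _ _ _ (fun w : (R*R)%type => (rho - `|w.1 - x0|) * (rho - `|w.2 - y0|)) (fun t => t ^+ m)); last exact: exprn_continuous.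
  apply: cvgM; (apply: cvgB; first exact: cvg_cst); apply: cvg_norm; apply: cvgB;
    by [exact: cvg_fst|exact: cvg_snd|exact: cvg_cst].
exists w1; first by rewrite inE in w1A.
by move=> w wS; apply: w1P; rewrite inE.
Qed.

(* For small [q] the mean value property of [|f|] is used at the maximum [w1] of [|f|] times a
   power of the distance to the boundary: around [w1], [|f|] is at most a multiple of [|f w1|],
   so that [|f|] is controlled by [|f w1|^(1-q) |f|^q]. *)
Lemma submean_value (q : R) : 0 < q -> exists2 C : R, 0 < C &
  forall f x0 y0 rho, 0 < rho ->
  (forall w, square x0 y0 rho w -> cdiff_at f (Complex w.1 w.2)) ->
  ((rho ^+ 2 * powR (normc (f (Complex x0 y0))) q)%:E <=
   C%:E * \int[area]_(w in square x0 y0 rho) (powR (normc (f (Complex w.1 w.2))) q)%:E)%E.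
Proof.
(* [m * q >= 2] is what finally turns the weight into a factor [(2 * e / rho)^2] matching the areas
   of the two squares. *)
move=> q0; pose m := (Num.truncn (2 / q)).+1.
have mq : 2 <= m%:R * q by rewrite -ler_pdivrMr// ltW// truncnS_gt.
(* On the small square around [w1] each factor of the weight drops at most by half, so [|f|] is at
   most [4^m] times its value at [w1]. [B] also covers the lower threshold [n w1 / 32] used
   below. *)
pose K : R := 4 ^+ m; have K1 : 1 <= K by rewrite exprn_ege1// ler1n.
pose B := 32 * K; have B0 : 0 < B by rewrite mulr_gt0// (lt_le_trans ltr01).
pose c := powR B `|1 - q|; have c0 : 0 < c by rewrite powR_gt0.
exists (32 * c); first by rewrite mulr_gt0.
move=> f x0 y0 rho rho0 fd.
pose n (w : T2) := normc (f (Complex w.1 w.2)).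
have n0 w : 0 <= n w by exact: normc_ge0.
pose P (w : T2) := (rho - `|w.1 - x0|) * (rho - `|w.2 - y0|).
have [w1 w1S w1max] := @square_weighted_max n x0 y0 rho m rho0 (fun w wS => cdiff_continuous2 (fd _ wS)).
have sq0 : square x0 y0 rho (x0, y0) by apply/squareE; rewrite /= !subrr !normr0 ltW.
have := w1max _ sq0; rewrite /= !subrr !normr0 !subr0 -/(P w1) => n0max.
have [w1x w1y] := (squareE _ _ _ _).1 w1S.
have RHS0 : (0 <= (32 * c)%:E * \int[area]_(w in square x0 y0 rho) (powR (n w) q)%:E)%E.
  apply: mule_ge0; first by rewrite lee_fin ltW// mulr_gt0.
  by apply: integral_ge0 => w _; rewrite lee_fin powR_ge0.
have [nP0|nP0] := leP (n w1 * P w1 ^+ m) 0.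
  have : n (x0, y0) <= 0.
    by rewrite -(pmulr_lle0 _ (exprn_gt0 m (mulr_gt0 rho0 rho0))) (le_trans n0max).
  rewrite /n /= => nle0.
  have -> : normc (f (Complex x0 y0)) = 0 by apply/eqP; rewrite eq_le nle0 normc_ge0.
  by rewrite powR0 ?gt_eqF// mulr0.
have d1 : 0 <= rho - `|w1.1 - x0| by rewrite subr_ge0.
have d2 : 0 <= rho - `|w1.2 - y0| by rewrite subr_ge0.
have Pw1 : 0 <= P w1 by rewrite mulr_ge0.
have N0 : 0 < n w1.
  by rewrite lt_neqAle n0 andbT eq_sym; apply: contraTneq nP0 => ->; rewrite mul0r ltxx.
have P0 : 0 < P w1.
  rewrite lt_neqAle Pw1 andbT eq_sym; apply: contraTneq nP0 => ->.
  by rewrite expr0n /= mulr0 ltxx.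
have d1' : 0 < rho - `|w1.1 - x0|.
  by rewrite lt_neqAle d1 andbT eq_sym; apply: contraTneq P0; rewrite /P => ->; rewrite mul0r ltxx.
have d2' : 0 < rho - `|w1.2 - y0|.
  by rewrite lt_neqAle d2 andbT eq_sym; apply: contraTneq P0; rewrite /P => ->; rewrite mulr0 ltxx.
(* Half the distance of [w1] to the boundary: moving by [e] in each coordinate keeps at least half
   of either distance. *)
pose e := Num.min (rho - `|w1.1 - x0|) (rho - `|w1.2 - y0|) / 2.
have e0 : 0 < e by rewrite divr_gt0// lt_min d1'.
have e1 : 2 * e <= rho - `|w1.1 - x0| by rewrite mulrC divfK// ge_min lexx.
have e2 : 2 * e <= rho - `|w1.2 - y0| by rewrite mulrC divfK// ge_min lexx orbT.
have near w : square w1.1 w1.2 e w ->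
   [/\ square x0 y0 rho w, (rho - `|w1.1 - x0|) / 2 <= rho - `|w.1 - x0| &
     (rho - `|w1.2 - y0|) / 2 <= rho - `|w.2 - y0|].
  move=> /squareE[h1 h2].
  have t1 := ler_distD w1.1 w.1 x0; have t2 := ler_distD w1.2 w.2 y0.
  split; [apply/squareE; split|..]; move: h1 h2 t1 t2 e1 e2 d1 d2 e0; clear; lra.
have nK w : square w1.1 w1.2 e w -> n w <= n w1 * K.
  move=> /near[wS h1 h2]; have := w1max _ wS; rewrite -/(P w) -/(P w1) => H.
  have PP : P w1 / 4 <= P w.
    have -> : P w1 / 4 = ((rho - `|w1.1 - x0|) / 2) * ((rho - `|w1.2 - y0|) / 2).
      by rewrite /P; field.
    by apply: ler_pM => //; rewrite divr_ge0.
  have PP' : (P w1 / 4) ^+ m <= P w ^+ m.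
    by rewrite ler_pXn2r// ?nnegrE ?divr_ge0// (le_trans _ PP)// divr_ge0.
  have := le_trans (ler_wpM2l (n0 w) PP') H.
  rewrite expr_div_n mulrA ler_pdivrMr ?exprn_gt0// mulrAC ler_pM2r// exprn_gt0//.
have fd1 w : square w1.1 w1.2 e w -> cdiff_at f (Complex w.1 w.2).
  by move=> /near[wS _ _]; exact: fd.
have := area_mean_value e0 fd1.
rewrite -/(n w1); set Q := square _ _ _; set Q0 := square x0 y0 rho => H.
(* Values of [|f|] below [lam] contribute at most [4 * lam * 4 * e^2 = e^2 * n w1 / 2] to the mean
   value inequality, and this half is absorbed on the left. *)
pose lam := n w1 / 32; have lam0 : 0 < lam by rewrite divr_gt0.
pose k := c * powR (n w1) (1 - q); have k0 : 0 < k by rewrite mulr_gt0 ?powR_gt0.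
have mQ : measurable Q by exact: measurable_square.
have mq' : measurable_fun Q (fun w => (powR (n w) q)%:E).
  apply/measurable_EFinP; apply: (measurableT_comp (measurable_powR q)).
  by apply: measurable_normc.
have bnd : (\int[area]_(w in Q) (n w)%:E <= \int[area]_(w in Q) (lam%:E + k%:E * (powR (n w) q)%:E))%E.
  apply: ge0_le_integral_nomeas => w wQ; first by rewrite lee_fin.
  rewrite -EFinM -EFinD lee_fin.
  have [nl|nl] := leP (n w) lam.
    by rewrite (le_trans nl)// lerDl mulr_ge0// ?powR_ge0// ltW.
  rewrite -[n w]add0r lerD// ?(ltW lam0)// add0r.
  apply: ler_powR_scale => //.
    apply: le_trans (ltW nl); rewrite /lam ler_wpM2l// lef_pV2 ?posrE//.
    by rewrite ler_peMr.
  by apply: le_trans (nK _ wQ) _; rewrite ler_wpM2l// /B ler_peMl// ?ler1n// (le_trans _ K1).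
have bndE : (\int[area]_(w in Q) (lam%:E + k%:E * (powR (n w) q)%:E) =
    (lam * (4 * e ^+ 2))%:E + k%:E * \int[area]_(w in Q) (powR (n w) q)%:E)%E.
  rewrite ge0_integralD//=; last 3 first.
  - by move=> w _; rewrite lee_fin ltW.
  - by move=> w _; rewrite -EFinM lee_fin mulr_ge0 ?powR_ge0// ltW.
  - by apply: measurable_funeM.
  rewrite ge0_integralZl//=; last 2 first.
  - by move=> w _; rewrite lee_fin powR_ge0.
  - by rewrite lee_fin ltW.
  by rewrite integral_cst//= area_square ?ltW.
have subQ : (\int[area]_(w in Q) (powR (n w) q)%:E <= \int[area]_(w in Q0) (powR (n w) q)%:E)%E.
  apply: ge0_le_integral_set => // w wQ; rewrite ?lee_fin ?powR_ge0//.
  by have [] := near _ wQ.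
rewrite bndE in bnd.
have H2 := le_trans H (lee_wpmul2l (ltac:(by rewrite lee_fin) : (0%R <= 4%:E)%E) bnd).
set I := (\int[area]_(w in Q) _)%E in H2 subQ.
have I0 : (0 <= I)%E by apply: integral_ge0 => w _; rewrite lee_fin powR_ge0.
have c32 : (0 < (32 * c)%:E)%E by rewrite lte_fin mulr_gt0.
apply: le_trans (lee_wpmul2l (ltW c32) subQ).
move: I0 H2 {subQ}; case: I => [I||] //; last by move=> _ _; rewrite gt0_muley// leey.
rewrite (_ : (4%:E * ((lam * (4 * e ^+ 2))%:E + k%:E * I%:E) =
  (4 * (lam * (4 * e ^+ 2) + k * I))%:E)%E)// (_ : ((32 * c)%:E * I%:E = (32 * c * I)%:E)%E)//.
rewrite !lee_fin => I0 H2.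
have H3 : e ^+ 2 * powR (n w1) q <= 8 * c * I.
  have X : e ^+ 2 * n w1 <= 8 * k * I.
    by move: H2; rewrite /lam; set ee := e ^+ 2; clear; lra.
  have pE : powR (n w1) (1 - q) * powR (n w1) q = n w1.
    by rewrite -powRD ?subrK ?powRr1//; apply/implyP => _; rewrite gt_eqF.
  rewrite -(ler_pM2l (powR_gt0 (1 - q) N0)).
  have -> : powR (n w1) (1 - q) * (e ^+ 2 * powR (n w1) q) = e ^+ 2 * n w1.
    by rewrite mulrCA pE.
  by apply: le_trans X _; rewrite /k le_eqVlt; apply/orP; left; apply/eqP; ring.
have erho : 2 * e / rho <= 1.
  by rewrite ler_pdivrMr// mul1r (le_trans e1)// gerBl.
have er0 : 0 < 2 * e / rho by rewrite divr_gt0// mulr_gt0.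
have nn : n (x0, y0) <= n w1 * (2 * e / rho) ^+ m.
  have PP : P w1 <= 2 * e * rho.
    have d1r : rho - `|w1.1 - x0| <= rho by rewrite gerBl.
    have d2r : rho - `|w1.2 - y0| <= rho by rewrite gerBl.
    have -> : 2 * e = Num.min (rho - `|w1.1 - x0|) (rho - `|w1.2 - y0|).
      by rewrite /e mulrC divfK.
    rewrite /P; case: (leP (rho - `|w1.1 - x0|) (rho - `|w1.2 - y0|)) => _.
      by rewrite ler_wpM2l.
    by rewrite mulrC ler_wpM2l.
  have PPm : P w1 ^+ m <= (2 * e * rho) ^+ m.
    by rewrite ler_pXn2r// nnegrE (le_trans Pw1).
  have := le_trans n0max (ler_wpM2l (n0 w1) PPm).
  have -> : 2 * e * rho = (2 * e / rho) * (rho * rho) by field; rewrite gt_eqF.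
  by rewrite (exprMn _ (2 * e / rho)) mulrA ler_pM2r// exprn_gt0// mulr_gt0.
rewrite -/(n (x0, y0)).
have H4 : powR (n (x0, y0)) q <= powR (n w1) q * (2 * e / rho) ^+ 2.
  apply: le_trans (ler_powR2 (ltW q0) (n0 _) nn) _.
  rewrite powRM//; last by rewrite exprn_ge0// ltW.
  rewrite ler_wpM2l ?powR_ge0// -!powR_mulrn ?(ltW er0)// -powRrM.
  by apply: ger_powR => //; rewrite er0.
apply: le_trans (ler_wpM2l (sqr_ge0 rho) H4) _.
have -> : rho ^+ 2 * (powR (n w1) q * (2 * e / rho) ^+ 2) = 4 * (e ^+ 2 * powR (n w1) q).
  by field; rewrite gt_eqF.
by apply: le_trans (ler_wpM2l _ H3) _ => //; move: I0 c0; clear => ? ?; rewrite !mulrA; lra.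
Qed.

End SubMean.

(** * Cones and their area integrals *)

Section CircleGeometry.
Context {R : realType}.
Implicit Types (t s x r : R) (z : R[i]).
Local Notation T2 := (measurableTypeR R * measurableTypeR R)%type.

Lemma lipschitz_derive (f df : R -> R) (K a b : R) :
  (forall x, is_derive x (1 : R) f (df x)) -> (forall x, `|df x| <= K) ->
  `|f b - f a| <= K * `|b - a|.
Proof.
move=> fd fK; wlog ab : a b / a <= b.
  move=> H; have [|/ltW ba] := leP a b; first exact: H.
  by rewrite distrC [X in _ * X]distrC; exact: H.
have fd' x : x \in `]a, b[ -> is_derive x 1 f (df x) by [].
have fc : {within `[a, b], continuous f}.
  apply: continuous_subspaceT => x; apply: differentiable_continuous.
  by apply/derivable1_diffP; have := fd x; case.
have [c _ ->] := MVT_segment ab fd' fc.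
by rewrite normrM ler_wpM2r.
Qed.

Lemma dist_atan_le x y : `|atan y - atan x| <= `|y - x|.
Proof.
rewrite -[leRHS]mul1r; apply: (@lipschitz_derive atan (fun x => (1 + x ^+ 2)^-1)) => s.
have s1 : 1 <= 1 + s ^+ 2 by rewrite lerDl sqr_ge0.
by rewrite ger0_norm ?invr_ge0 ?invf_le1// ?(lt_le_trans ltr01 s1) // (le_trans ler01).
Qed.

Lemma norm_atan_le x : `|atan x| <= `|x|.
Proof. by have := dist_atan_le 0 x; rewrite atan0 !subr0. Qed.

Definition circ t : R[i] := Complex (cos t) (sin t).

Lemma normc_circ t : normc (circ t) = 1.
Proof. by rewrite /= cos2Dsin2 sqrtr1. Qed.

Lemma circD t s : circ (t + s) = circ t * circ s.
Proof. by rewrite /circ cosD sinD; congr Complex; rewrite addrC mulrC. Qed.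

Lemma circ_chord t s : normc (circ t - circ s) <= 2 * `|t - s|.
Proof.
apply: le_trans (ler_normc_ReIm _) _ => /=.
have hc : `|cos t - cos s| <= 1 * `|t - s|.
  apply: (@lipschitz_derive (@cos R) (fun x => - sin x)) => x.
  by rewrite normrN sin_max.
have hs : `|sin t - sin s| <= 1 * `|t - s|.
  by apply: (@lipschitz_derive (@sin R) (@cos R)) => x; rewrite cos_max.
by apply: le_trans (lerD hc hs) _; rewrite mul1r mulr_natl mulr2n.
Qed.

Lemma circ_period t : circ (t + 2 * pi) = circ t.
Proof. by rewrite /circ mulr_natl cosD2pi sinD2pi. Qed.

Lemma mulc_conj_circ t : circ t * conjc (circ t) = 1.
Proof.
apply/eqP; rewrite eq_complex /=; apply/andP; split; apply/eqP.
  by rewrite mulrN opprK -!expr2 cos2Dsin2.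
by rewrite mulrN (mulrC (sin t)) addNr.
Qed.

Lemma Gamma_circ t z : Gamma (circ t) z <->
  normc z < 1 /\ normc (circ t - z) < 1 - normc z ^+ 2.
Proof.
have -> : normc (circ t - z) = normc (1 - z * conjc (circ t)).
  rewrite -(mulc_conj_circ t) -mulrBl normcM normc_conj normc_circ mulr1 //.
by [].
Qed.

(** The cone is wide enough because [1 - |w|^2 = (1 - |w|) (1 + |w|)]: here [1 - |w| >= 0.9 h] and
    [1 + |w| >= 1.45], with product above [1.3 h], while [|circ t - w| <= 1.2 h]. *)
Lemma Gamma_center t (h e : R) z : 0 < h -> h <= 2^-1 ->
  normc (circ t - z) <= h + h / 10 -> normc z <= 1 - h ->
  2^-1 <= normc z -> forall w, normc (w - z) <= h / 10 -> Gamma (circ t) w.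
Proof.
move=> h0 h1 tz zh z2 w wz; apply/Gamma_circ.
have w1 : normc w <= 1 - 9 / 10 * h.
  by have := lerB_normc w z; move: zh wz; clear; lra.
have w2 : 45 / 100 <= normc w.
  by have := lerB_normc z w; rewrite normc_dist; move: z2 wz h1; clear; lra.
split; first by apply: le_lt_trans w1 _; move: h0; clear; lra.
have tw : normc (circ t - w) <= h + h / 5.
  have := ler_normc_dist z (circ t) w; rewrite (normc_dist z w).
  by move: tz wz; clear; lra.
apply: le_lt_trans tw _.
have -> : 1 - normc w ^+ 2 = (1 - normc w) * (1 + normc w) by ring.
have a1 : 9 / 10 * h <= 1 - normc w by move: w1; clear; lra.
have a2 : 145 / 100 <= 1 + normc w by move: w2; clear; lra.
have a3 : 0 <= 9 / 10 * h by move: h0; clear; lra.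
have := ler_pM a3 _ a1 a2.
by move=> /(_ ltac:(by [])); move: h0; clear; lra.
Qed.

(** The constant [1/20] spends [h/10] on the chord from [t] to [phi], with [h = 1 - rho], and
    another [h/10] on the diameter of the square, as [Gamma_center] permits. *)
Lemma Gamma_square t phi (rho : R) : 2^-1 <= rho -> rho < 1 ->
  `|t - phi| <= (1 - rho) / 20 ->
  forall w, square (rho * cos phi) (rho * sin phi) ((1 - rho) / 20) w ->
    Gamma (circ t) (Complex w.1 w.2).
Proof.
move=> r2 r1 tphi w /squareE[w1 w2].
pose z := Complex (rho * cos phi) (rho * sin phi).
have zE : z = rho%:C%C * circ phi by rewrite /z /circ; apply/eqP; rewrite eq_complex /= !mul0r subr0 addr0 !eqxx.
have nz : normc z = rho.
  by rewrite zE normcM normc_circ mulr1 normc_real ger0_norm// (le_trans _ r2).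
apply: (@Gamma_center t (1 - rho) 0 z); rewrite ?nz.
- by move: r1; clear; lra.
- by move: r2; clear; lra.
- have c1 := circ_chord t phi.
  have c2 : normc (circ phi - z) = 1 - rho.
    have -> : circ phi - z = (1 - rho)%:C%C * circ phi.
      by rewrite zE rmorphB /= rmorph1 mulrBl mul1r.
    by rewrite normcM normc_circ mulr1 normc_real ger0_norm// subr_ge0 ltW.
  by have := ler_normc_dist (circ phi) (circ t) z; rewrite c2; move: c1 tphi; clear; lra.
- by move: r1; clear; lra.
- by [].
- by apply: le_trans (ler_normc_ReIm _) _ => /=; move: w1 w2; clear; lra.
Qed.

(** After rotation the vertex is [1] and the real part [x] of the point is at least [1/4], so its
    argument is [atan (y / x)]. The cone condition gives [|y| <= 1 - |z|^2 <= 2 (1 - |z|)], and the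
    quotient is at most [8 (1 - |z|)]. *)
Lemma Gamma_arg t z : Gamma (circ t) z -> 2^-1 <= normc z ->
  exists2 phi, `|phi - t| <= 8 * (1 - normc z) & z = (normc z)%:C%C * circ phi.
Proof.
move=> [z1 Gz] z2; rewrite /= in z1 Gz; set rho := normc z in z1 z2 Gz *.
set zeta := z * conjc (circ t) in Gz.
have nzeta : normc zeta = rho by rewrite normcM normc_conj normc_circ mulr1.
have zE : z = zeta * circ t.
  by rewrite /zeta -mulrA (mulrC (conjc _)) mulc_conj_circ mulr1.
set x := Re zeta; set y := Im zeta.
have zxy : zeta = Complex x y by rewrite /x /y; case: (zeta).
have r0 : 0 < rho by apply: lt_le_trans z2.
have r2 : x ^+ 2 + y ^+ 2 = rho ^+ 2 by rewrite -nzeta normc_sqr.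
have h0 : 0 < 1 - rho ^+ 2 by rewrite subr_gt0 expr_lt1 // ltW.
have G2 : (1 - x) ^+ 2 + y ^+ 2 < (1 - rho ^+ 2) ^+ 2.
  by move: Gz; rewrite normc_lt ?(ltW h0)// zxy /= sub0r sqrrN.
have r41 : rho ^+ 2 < 1 by move: h0; clear; lra.
have r4 : 4^-1 <= rho ^+ 2.
  have -> : (4^-1 : R) = 2^-1 ^+ 2 by rewrite exprVn; congr (_^-1); ring.
  by rewrite !expr2 ler_pM.
(* [1 - 2 x + rho^2 < (1 - rho^2)^2] amounts to [2 x > rho^2 (3 - rho^2)], and the right side is at
   least [1/2]. *)
have xpos : 4^-1 <= x.
  by move: G2 r2 r4 r41; set u := rho ^+ 2; clear; nra.
have x0 : 0 < x by apply: lt_le_trans xpos.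
have yb : `|y| <= 2 * (1 - rho).
  have h : `|y| <= 1 - rho ^+ 2.
    rewrite -(ler_pXn2r (ltn0Sn 1)) ?nnegrE ?(ltW h0)// real_normK ?num_real//.
    by apply: ltW; apply: le_lt_trans G2; rewrite lerDr sqr_ge0.
  apply: le_trans h _; rewrite -subr_ge0 (_ : _ - _ = (1 - rho) ^+ 2) ?sqr_ge0//.
  by ring.
pose psi := atan (y / x).
have psib : `|psi| <= 8 * (1 - rho).
  apply: le_trans (norm_atan_le _) _; rewrite normrM normfV (gtr0_norm x0).
  rewrite ler_pdivrMr//; apply: le_trans yb _.
  have : 0 < 1 - rho by rewrite subr_gt0; exact: z1.
  by move: xpos; clear; nra.
have cpsi : cos psi = x / rho.
  rewrite /psi cos_atan.
  have -> : 1 + (y / x) ^+ 2 = (rho / x) ^+ 2.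
    by rewrite !expr_div_n -r2; field; rewrite gt_eqF.
  by rewrite sqrtr_sqr ger0_norm ?divr_ge0 ?(ltW r0) ?(ltW x0)// invf_div.
have spsi : sin psi = y / rho.
  have : tan psi = y / x by rewrite /psi atanK.
  rewrite /tan => H; have c0 : cos psi != 0 by rewrite cpsi mulf_neq0 ?invr_eq0 ?gt_eqF.
  have := congr1 (fun v => v * cos psi) H; rewrite /= divfK// => ->.
  by rewrite cpsi; field; rewrite !gt_eqF.
exists (t + psi); first by rewrite addrAC subrr add0r.
rewrite circD mulrCA mulrC zE; congr (_ * _).
rewrite zxy /circ cpsi spsi; apply/eqP; rewrite eq_complex /= !mul0r subr0 addr0.
by apply/andP; split; apply/eqP; field; rewrite gt_eqF.
Qed.

Lemma Gamma_sub_square t (w : T2) (l : R) : Gamma (circ t) (Complex w.1 w.2) ->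
  1 - normc (Complex w.1 w.2) <= l -> square (cos t) (sin t) (2 * l) w.
Proof.
move=> /Gamma_circ[w1 w2] wl; set z := Complex w.1 w.2 in w1 w2 wl.
have zl : normc (circ t - z) <= 2 * l.
  apply: ltW; apply: lt_le_trans w2 _.
  have -> : 1 - normc z ^+ 2 = (1 - normc z) * (1 + normc z) by ring.
  have h0 : 0 <= 1 - normc z by rewrite subr_ge0 ltW.
  have h1 := normc_ge0 z.
  apply: (@le_trans _ _ ((1 - normc z) * 2)).
    by rewrite ler_wpM2l//; move: w1; clear; lra.
  by rewrite mulrC ler_wpM2l.
apply/squareE; split.
  by apply: le_trans zl; rewrite distrC; have := ler_Re_normc (circ t - z).
by apply: le_trans zl; rewrite distrC; have := ler_Im_normc (circ t - z).
Qed.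

Lemma one_sub_sqr_powR (z : R[i]) (a : R) : normc z < 1 ->
  powR 2 (- `|a|) * powR (1 - normc z) a <= powR (1 - normc z ^+ 2) a /\
  powR (1 - normc z ^+ 2) a <= powR 2 `|a| * powR (1 - normc z) a.
Proof.
move=> z1; have h0 : 0 < 1 - normc z by rewrite subr_gt0.
have -> : 1 - normc z ^+ 2 = (1 + normc z) * (1 - normc z) by ring.
have n0 := normc_ge0 z.
have a1 : 1 <= 1 + normc z by rewrite lerDl.
have a0 : 0 < 1 + normc z by apply: lt_le_trans a1.
have a2 : 1 + normc z <= 2 by move: z1; clear; lra.
have a3 : 2^-1 <= 1 + normc z by apply: le_trans a1; rewrite invf_le1// ler1n.
rewrite powRM ?(ltW h0) ?(ltW a0)//.
split; rewrite ler_wpM2r ?powR_ge0//; last by apply: powR_between.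
rewrite powRN -(invrK (powR (1 + _) a)) lef_pV2 ?posrE ?invr_gt0 ?powR_gt0//.
by rewrite -powRN -(normrN a); apply: powR_between.
Qed.

End CircleGeometry.

(** * Measurability and periodicity of the cone integrals *)

Section ConeIntegral.
Context {R : realType}.
Implicit Types (f : R[i] -> R[i]) (t s x r q a : R) (z : R[i]).
Local Notation mu := (@lebesgue_measure R).
Local Notation T2 := (measurableTypeR R * measurableTypeR R)%type.
Local Notation area := (@lebesgue_measure R \x @lebesgue_measure R)%E.

Definition cone t : set T2 := [set w | Gamma (circ t) (Complex w.1 w.2)].

Definition density f q a (w : T2) : R :=
  powR (normc (f (Complex w.1 w.2))) q * powR (1 - normc (Complex w.1 w.2) ^+ 2) a.

Definition cone_integral f q a t : \bar R := (\int[area]_(w in cone t) (density f q a w)%:E)%E.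

Lemma tent_norm_powE f q a p :
  tent_norm_pow q a p f = (\int[mu]_(t in `[0%R, (2 * pi)%R]) poweR (cone_integral f q a t) (p / q))%E.
Proof. by []. Qed.

Lemma density_ge0 f q a w : 0 <= density f q a w.
Proof. by rewrite mulr_ge0 ?powR_ge0. Qed.

Lemma cone_integral_ge0 f q a t : (0 <= cone_integral f q a t)%E.
Proof. by apply: integral_ge0 => w _; rewrite lee_fin density_ge0. Qed.

Lemma cone_integral_period f q a t : cone_integral f q a (t + 2 * pi) = cone_integral f q a t.
Proof. by rewrite /cone_integral /cone circ_period. Qed.

Definition disk_pairs : set T2 := [set w | normc (Complex w.1 w.2) < 1].

(** The cone condition, squared, as polynomial inequalities in [w], [cos t] and [sin t]. It is taken
    jointly in [(t, w)], since Tonelli's theorem needs the measurability of the whole family of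
    cones. *)
Let cone_test (x : measurableTypeR R * T2) : bool :=
  (x.2.1 ^+ 2 + x.2.2 ^+ 2 < 1) &&
  ((cos x.1 - x.2.1) ^+ 2 + (sin x.1 - x.2.2) ^+ 2 < (1 - (x.2.1 ^+ 2 + x.2.2 ^+ 2)) ^+ 2).

Lemma normc_lt1 (w : T2) : (normc (Complex w.1 w.2) < 1) = (w.1 ^+ 2 + w.2 ^+ 2 < 1).
Proof. by rewrite normc_lt// expr1n. Qed.

Let cone_testE t w : cone t w <-> cone_test (t, w).
Proof.
rewrite /cone /cone_test /=; split.
  move=> /Gamma_circ[w1 w2]; rewrite -normc_lt1 w1 /=.
  move: w2; rewrite normc_lt; last by rewrite subr_ge0 expr_le1 ?normc_ge0// ltW.
  by rewrite normc_sqr.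
move=> /andP[]; rewrite -normc_lt1 => w1 w2; apply/Gamma_circ; split => //.
rewrite normc_lt; last by rewrite subr_ge0 expr_le1 ?normc_ge0// ltW.
by rewrite normc_sqr.
Qed.

Let measurable_cone_test : measurable_fun setT cone_test.
Proof.
have m1 : measurable_fun setT (fun x : measurableTypeR R * T2 => x.2.1).
  exact: (measurableT_comp (@measurable_fst _ _ _ _) (@measurable_snd _ _ _ _)).
have m2 : measurable_fun setT (fun x : measurableTypeR R * T2 => x.2.2).
  exact: (measurableT_comp (@measurable_snd _ _ _ _) (@measurable_snd _ _ _ _)).
have mc : measurable_fun setT (fun x : measurableTypeR R * T2 => cos x.1).
  apply: (measurableT_comp _ (@measurable_fst _ _ _ _)).
  by apply: continuous_measurable_fun; exact: continuous_cos.
have ms : measurable_fun setT (fun x : measurableTypeR R * T2 => sin x.1).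
  apply: (measurableT_comp _ (@measurable_fst _ _ _ _)).
  by apply: continuous_measurable_fun; exact: continuous_sin.
have mn : measurable_fun setT (fun x : measurableTypeR R * T2 => x.2.1 ^+ 2 + x.2.2 ^+ 2).
  by apply: measurable_funD; apply: measurable_funX.
apply: measurable_and; apply: measurable_fun_ltr => //.
  by apply: measurable_funD; apply: measurable_funX; apply: measurable_funB.
by apply: measurable_funX; apply: measurable_funB.
Qed.

Let cone2 : set (measurableTypeR R * T2) := [set x | cone x.1 x.2].

Let measurable_cone2 : measurable cone2.
Proof.
have -> : cone2 = setT `&` cone_test @^-1` [set true].
  apply/seteqP; split => [[t w]|[t w]] /=.
    by move=> /cone_testE ct; split.
  by move=> [_ ct]; apply/cone_testE.
by apply: measurable_cone_test.
Qed.

Lemma measurable_cone t : measurable (cone t).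
Proof.
have -> : cone t = setT `&` (pair t) @^-1` cone2 by rewrite setTI.
by apply: (@pair1_measurable _ _ (measurableTypeR R) T2 t).
Qed.

Lemma measurable_disk_pairs : measurable disk_pairs.
Proof.
have -> : disk_pairs = setT `&` (fun w : T2 => w.1 ^+ 2 + w.2 ^+ 2 < 1) @^-1` [set true].
  by apply/seteqP; split => w; rewrite /disk_pairs /= normc_lt1; [move=> ->|case].
have m : measurable_fun setT (fun w : T2 => w.1 ^+ 2 + w.2 ^+ 2 < 1).
  apply: measurable_fun_ltr => //.
  by apply: measurable_funD; apply: measurable_funX; [exact: measurable_fst|exact: measurable_snd].
exact: m.
Qed.

Lemma cone_disk t : cone t `<=` disk_pairs.
Proof. by move=> w /Gamma_circ[]. Qed.

Lemma analytic_cdiff f (w : T2) : analytic_on_disk f -> disk_pairs w ->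
  cdiff_at f (Complex w.1 w.2).
Proof. by move=> fa wd; apply/derivable_is_cderive/fa. Qed.

Lemma measurable_density f q a : analytic_on_disk f ->
  measurable_fun disk_pairs (density f q a).
Proof.
move=> fa; apply: measurable_funM.
  apply: (measurableT_comp (measurable_powR q)).
  apply: measurable_normc; first exact: measurable_disk_pairs.
  by move=> w; exact: analytic_cdiff.
apply: (measurableT_comp (measurable_powR a)).
have -> : (fun w : T2 => 1 - normc (Complex w.1 w.2) ^+ 2) = (fun w : T2 => 1 - (w.1 ^+ 2 + w.2 ^+ 2)).
  by apply/funext => w; rewrite normc_sqr.
apply: measurable_funTS; apply: measurable_funB => //.
by apply: measurable_funD; apply: measurable_funX; [exact: measurable_fst|exact: measurable_snd].
Qed.

(** Tonelli is applied twice with one-dimensional Lebesgue measure, after regrouping [(t, (x, y))]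
    as [((t, x), y)]. *)
Lemma measurable_area_section (K : measurableTypeR R * T2 -> \bar R) :
  measurable_fun setT K -> (forall y, 0 <= K y)%E -> measurable_fun setT (fubini_F area K).
Proof.
move=> mK K0.
pose L : T2 * measurableTypeR R -> \bar R := fun y => K (y.1.1, (y.1.2, y.2)).
have mL : measurable_fun setT L.
  apply: (measurableT_comp mK).
  apply: measurable_fun_pair.
    exact: (measurableT_comp (@measurable_fst _ _ _ _) (@measurable_fst _ _ _ _)).
  apply: measurable_fun_pair; last exact: measurable_snd.
  exact: (measurableT_comp (@measurable_snd _ _ _ _) (@measurable_fst _ _ _ _)).
have mF1 : measurable_fun setT (fubini_F mu L).
  by apply: measurable_fun_fubini_tonelli_F => // y; exact: K0.
have F10 y : (0 <= fubini_F mu L y)%E by apply: integral_ge0 => ? _; exact: K0.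
have := @measurable_fun_fubini_tonelli_F _ _ (measurableTypeR R) (measurableTypeR R) R
  (@lebesgue_measure R) (fubini_F mu L) mF1 F10.
apply: eq_measurable_fun => t _; rewrite /fubini_F.
rewrite (fubini_tonelli1 (fun w : T2 => K (t, w)))//.
exact: (measurableT_comp mK (@pair1_measurable _ _ (measurableTypeR R) T2 t)).
Qed.

Lemma measurable_cone_integral f q a : analytic_on_disk f ->
  measurable_fun setT (cone_integral f q a : measurableTypeR R -> \bar R).
Proof.
move=> fa.
pose K : measurableTypeR R * T2 -> \bar R := (fun x : measurableTypeR R * T2 => (density f q a x.2)%:E) \_ cone2.
have mK : measurable_fun setT K.
  apply/(measurable_restrictT _ measurable_cone2); apply/measurable_EFinP.
  apply: (@measurable_comp _ _ _ _ _ _ disk_pairs) => //.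
  - exact: measurable_disk_pairs.
  - by move=> _ [[t w] /= /cone_disk wd <-].
  - exact: measurable_density.
  - by apply: measurable_funTS; exact: measurable_snd.
have K0 (x : measurableTypeR R * T2) : (0 <= K x)%E by rewrite /K patchE; case: ifP => // _; rewrite lee_fin density_ge0.
have -> : (cone_integral f q a : measurableTypeR R -> \bar R) = fubini_F area K.
  apply/funext => t; rewrite /cone_integral /fubini_F [LHS]integral_mkcond.
  apply: eq_integral => w _; rewrite /K !patchE.
  by congr (if _ then _ else _); apply/idP/idP; rewrite !inE.
exact: measurable_area_section.
Qed.

(** Arcs attached to a point of [[0, 2 pi]] may leave that interval. The maximal theorem is
    therefore applied on three consecutive periods, whose integral is finite by this bound. *)
Lemma periodic_integral (g : R -> \bar R) (c : R) : 0 <= c -> measurable_fun [set: R] g ->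
  (forall x, 0 <= g x)%E -> (forall x, g (x + c) = g x) ->
  (\int[mu]_(t in `[(- c)%R, (2 * c)%R]) g t <=
   \int[mu]_(t in `[0%R, c]) g t + \int[mu]_(t in `[0%R, c]) g t + \int[mu]_(t in `[0%R, c]) g t)%E.
Proof.
move=> c0 mg g0 gc.
have mgD (D : interval R) : measurable_fun [set: R] (g \_ [set` D]).
  by apply/(measurable_restrictT _ (measurable_itv _)); exact: measurable_funTS.
have gD0 (D : interval R) x : (0 <= (g \_ [set` D]) x)%E by rewrite patchE; case: ifP.
have gN x : g (x - c) = g x by rewrite -[in RHS](subrK c x) gc.
have shift (d a b : R) : (forall x, g (1 * x + d) = g x) ->
    (\int[mu]_(t in `[(a + d)%R, (b + d)%R]) g t = \int[mu]_(t in `[a, b]) g t)%E.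
  move=> gd; rewrite integral_mkcond [RHS]integral_mkcond.
  rewrite -(ge0_integral_affine d (or_introl erefl) (mgD _) (gD0 _)).
  apply: eq_integral => x _; rewrite !patchE gd; congr (if _ then _ else _).
  by apply/idP/idP; rewrite !inE/= !in_itv/= mul1r !lerD2r.
have g1 : (\int[mu]_(t in `[(- c)%R, 0%R]) g t = \int[mu]_(t in `[0%R, c]) g t)%E.
  have := shift (- c) 0 c; rewrite add0r subrr => -> // x.
  by rewrite mul1r gN.
have g2 : (\int[mu]_(t in `[c, (2 * c)%R]) g t = \int[mu]_(t in `[0%R, c]) g t)%E.
  have -> : 2 * c = c + c by ring.
  have := shift c 0 c; rewrite add0r => -> // x.
  by rewrite mul1r gc.
rewrite -{1}g1 -{2}g2.
rewrite integral_mkcond [X in (_ <= X + _ + _)%E]integral_mkcond [X in (_ <= _ + X + _)%E]integral_mkcond.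
rewrite [X in (_ <= _ + _ + X)%E]integral_mkcond.
have int3 (A B C : R -> \bar R) : measurable_fun setT A -> measurable_fun setT B ->
    measurable_fun setT C -> (forall x, 0 <= A x)%E -> (forall x, 0 <= B x)%E -> (forall x, 0 <= C x)%E ->
    (\int[mu]_x A x + \int[mu]_x B x + \int[mu]_x C x = \int[mu]_x (A x + B x + C x))%E.
  move=> mA mB mC A0 B0 C0; rewrite ge0_integralD//.
  - by rewrite ge0_integralD.
  - by move=> x _; apply: adde_ge0.
  - exact: emeasurable_funD.
rewrite int3 //.
apply: ge0_le_integral_nomeas => x _ //.
rewrite !patchE; case: ifP => xi; last by rewrite !adde_ge0//; case: ifP.
have h1 : (0 <= if x \in `[(- c)%R, 0%R]%classic then g x else 0)%E by case: ifP.
have h2 : (0 <= if x \in `[0%R, c]%classic then g x else 0)%E by case: ifP.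
have h3 : (0 <= if x \in `[c, (2 * c)%R]%classic then g x else 0)%E by case: ifP.
move: xi; rewrite inE/= in_itv/= => /andP[x1 x2].
have [x3|x3] := leP x 0.
  rewrite [X in (_ <= X + _ + _)%E]ifT; last by rewrite inE/= in_itv/= x1.
  by rewrite -addeA leeDl// adde_ge0.
have [x4|x4] := leP x c.
  rewrite [X in (_ <= _ + X + _)%E]ifT; last by rewrite inE/= in_itv/= x4 ltW.
  by rewrite addeAC leeDr// adde_ge0.
rewrite [X in (_ <= _ + _ + X)%E]ifT; last by rewrite inE/= in_itv/= x2 ltW.
by rewrite leeDr// adde_ge0.
Qed.

End ConeIntegral.

(** * The maximal function *)

Section MaximalArcs.
Context {R : realType}.
Local Notation mu := (@lebesgue_measure R).
Implicit Types (t x h phi m : R).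

Lemma dyadic_sum_le (x : R) (n : nat) : 0 <= x ->
  \sum_(0 <= k < n) (2 : R) ^+ k.+1 * ((2 : R) ^+ k <= x)%R%:R <= 4 * x.
Proof.
(* The companion bound drives the induction: a new term appears only if [2^n <= x], and then old and
   new terms together are at most [4 * 2^n]. *)
move=> x0; suff [] : \sum_(0 <= k < n) (2 : R) ^+ k.+1 * ((2 : R) ^+ k <= x)%R%:R <= 4 * x /\
  \sum_(0 <= k < n) (2 : R) ^+ k.+1 * ((2 : R) ^+ k <= x)%R%:R <= 2 * 2 ^+ n :> R by [].
elim: n => [|n [IH1 IH2]].
  by rewrite big_geq// !mulr_ge0// exprn_ge0.
rewrite big_nat_recr//=; set S := \sum_(0 <= k < n) _ in IH1 IH2 *.
have n0 : (0 : R) < 2 ^+ n by rewrite exprn_gt0.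
case: (leP (2 ^+ n) x) => nx; rewrite ?mulr1 ?mulr0 ?addr0 !exprS; split=> //;
  move: IH1 IH2 n0 nx; set u := 2 ^+ n; clear; lra.
Qed.

(** The ball of radius [9 * h] about [t] contains the arc, since [8 h + h/20 < 9 h]. The mean of the
    indicator over it is at least [(h/10) / (18 h) = 1/180]. *)
Lemma HL_maximal_arc (E : set R) t h phi : measurable E -> 0 < h ->
  `|phi - t| <= 8 * h -> (forall x, `|x - phi| <= h / 20 -> E x) ->
  ((200^-1)%:E < HL_maximal (\1_E : R -> R) t)%E.
Proof.
move=> mE h0 pt HE.
have r0 : 0 < 9 * h by rewrite mulr_gt0.
apply: (@lt_le_trans _ _ (iavg (\1_E : R -> R) (ball t (9 * h)))); last first.
  by apply: ereal_sup_ubound; exists (9 * h) => //=; rewrite in_itv/= r0.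
rewrite /iavg lebesgue_measure_ball ?ltW// inver ifF; last first.
  by apply/negbTE; rewrite mulrn_eq0/= gt_eqF.
have H : ((h / 10)%:E <= \int[mu]_(y in ball t (9 * h)) `|(\1_E y : R)%:E|)%E.
  have -> : (h / 10)%:E = (\int[mu]_(y in `[(phi - h / 20)%R, (phi + h / 20)%R]) cst 1%:E y)%E.
    have L : mu `[(phi - h / 20)%R, (phi + h / 20)%R] = (h / 10)%:E.
      rewrite lebesgue_measure_itv/= lte_fin ifT; last by lra.
      by rewrite -EFinB; congr EFin; field.
    by rewrite integral_cst// mul1e; exact/esym.
  apply: ge0_le_integral_set => // x.
  rewrite /= in_itv/= -ler_distl => xphi; split.
    rewrite /ball/= distrC -(subrKA phi).
    by apply: le_lt_trans (ler_normD _ _) _; move: xphi pt h0; clear; lra.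
  by rewrite indicE mem_set ?normr1//; exact: HE.
apply: lt_le_trans (lee_wpmul2l _ H); last by rewrite lee_fin invr_ge0 mulrn_wge0// ltW.
rewrite -EFinM lte_fin.
have -> : ((9 * h) *+ 2)^-1 * (h / 10) = 180^-1 by field; rewrite gt_eqF.
by rewrite ltf_pV2 ?posrE; lra.
Qed.

Lemma dyadic_floor (m : R) : 1 <= m -> exists k, (2 : R) ^+ k <= m < (2 : R) ^+ k.+1.
Proof.
move=> m1; have ex : exists n, m < (2 : R) ^+ n by exact: exp2_gt.
case: (ex_minnP ex) => -[|k] mk kmin; first by rewrite expr0 ltNge m1 in mk.
exists k; rewrite mk andbT leNgt; apply/negP => /kmin.
by rewrite ltnn.
Qed.

(* [W] is a dyadic sum of indicators of the sets where the maximal function of the indicator of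
   [g >= 2^k] exceeds [1/200]; the weak (1,1) inequality bounds its integral by that of [g]. *)
Lemma arc_maximal (g : R -> \bar R) (a0 b0 : R) :
  measurable_fun [set: R] g -> (forall t, 0 <= g t)%E ->
  (\int[mu]_(t in `[a0, b0]) g t < +oo)%E ->
  exists W : R -> \bar R, [/\ measurable_fun [set: R] W, (forall t, 0 <= W t)%E,
    (\int[mu]_t W t < +oo)%E &
    forall t h phi m, 0 < h -> `|phi - t| <= 8 * h ->
      (forall x, `|x - phi| <= h / 20 -> a0 <= x <= b0 /\ (m%:E <= g x)%E) ->
      1 <= m -> (m%:E <= W t)%E].
Proof.
move=> mg g0 gi.
pose E (k : nat) : set R := `[a0, b0]%classic `&` [set t | ((2 ^+ k)%:E <= g t)%E].
have mE k : measurable (E k).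
  by apply: emeasurable_fun_c_infty => //; exact: measurable_funTS.
pose B (k : nat) : set R := [set t | ((200^-1)%:E < HL_maximal (\1_(E k) : R -> R) t)%E].
have mB k : measurable (B k).
  rewrite -[B k]setTI; apply: emeasurable_fun_o_infty => //.
  apply: measurable_HL_maximal; exact: (locally_integrable_indic openT (mE k)).
(* [600 = 3 * 200], where [3] is the constant of the weak (1,1) inequality and [1/200] the level. *)
have muB k : (mu (B k) <= 600%:E * mu (E k))%E.
  have c0 : 0 < (200^-1 : R) by rewrite invr_gt0.
  have := maximal_inequality (locally_integrable_indic openT (mE k)) c0.
  have -> : (\int[mu]_(y in setT) `|(\1_(E k) y : R)%:E| = mu (E k))%E.
    transitivity (\int[mu]_(y in setT) (\1_(E k) y : R)%:E)%E.
      by apply: eq_integral => x _; rewrite gee0_abs// lee_fin.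
    rewrite integral_indic; [by rewrite setIT|by []|exact: mE].
  by rewrite (_ : 3 / 200^-1 = 600 :> R)// invrK -natrM.
pose W t : \bar R := (\sum_(0 <= k <oo) (2 ^+ k.+1 * \1_(B k) t)%:E)%E.
have m1 (A : nat -> set R) (k : nat) : measurable (A k) -> measurable_fun [set: R] (fun t => (2 ^+ k.+1 * \1_(A k) t : R)%:E).
  by move=> mA; apply/measurable_EFinP; apply: measurable_funM => //; exact: measurable_indic.
have p1 (A : nat -> set R) (k : nat) t : (0 <= (2 ^+ k.+1 * \1_(A k) t : R)%:E)%E.
  by rewrite lee_fin mulr_ge0 ?exprn_ge0.
have intA (A : nat -> set R) (k : nat) : measurable (A k) ->
    (\int[mu]_t (2 ^+ k.+1 * \1_(A k) t)%:E = (2 ^+ k.+1)%:E * mu (A k))%E.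
  move=> mA; under eq_integral do rewrite EFinM.
  rewrite ge0_integralZl//; last by apply/measurable_EFinP; exact: measurable_indic.
  by rewrite integral_indic// setIT.
exists W; split.
- by apply: ge0_emeasurable_sum => [k x _ _|k _]; [exact: p1|exact: m1].
- by move=> t; apply: nneseries_ge0 => k _ _; exact: p1.
- rewrite integral_nneseries//; last by move=> n; exact: m1.
  apply: (@le_lt_trans _ _ (\sum_(0 <= k <oo) 600%:E * \int[mu]_t (2 ^+ k.+1 * \1_(E k) t)%:E)%E).
    apply: lee_nneseries => [k _ _|k _]; first by apply: integral_ge0 => x _; exact: p1.
    rewrite !intA// muleCA; apply: lee_wpmul2l; last exact: muB.
    by rewrite lee_fin exprn_ge0.
  rewrite nneseriesZl; last by move=> k _; apply: integral_ge0 => x _; exact: p1.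
  rewrite -integral_nneseries//; last by move=> n; exact: m1.
  apply: lte_mul_pinfty; [by rewrite lee_fin ler0n|by []|].
  (* Pointwise, the powers [2^(k+1)] over the levels [2^k <= g t] sum to at most [4 * g t]. *)
  apply: (@le_lt_trans _ _ (\int[mu]_(t in `[a0, b0]) (4%:E * g t))%E); last first.
    rewrite ge0_integralZl//; last exact: measurable_funTS.
    by apply: lte_mul_pinfty.
  rewrite [leRHS]integral_mkcond; apply: ge0_le_integral_nomeas => t _.
    by apply: nneseries_ge0 => k _ _; exact: p1.
  rewrite patchE; case: ifPn => tab; last first.
    rewrite eseries0// => k _ _; rewrite indicE memNset ?mulr0// => -[tab' _].
    by move/negP: tab; apply; rewrite inE.
  have := g0 t; case gt : (g t) => [x||] // x0; last by rewrite gt0_muley ?leey// lte_fin.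
  rewrite lee_fin in x0; apply: lime_le; first by apply: is_cvg_nneseries => k _ _; exact: p1.
  apply: nearW => n; rewrite sumEFin -EFinM lee_fin.
  rewrite (_ : \sum_(0 <= k < n) _ = \sum_(0 <= k < n) (2 : R) ^+ k.+1 * ((2 : R) ^+ k <= x)%R%:R); last first.
    apply: eq_bigr => k _; rewrite indicE; congr (_ * (nat_of_bool _)%:R).
    apply/idP/idP; first by rewrite inE => -[_]; rewrite /= gt lee_fin.
    by move=> kx; rewrite inE; split; [rewrite inE in tab|rewrite /= gt lee_fin].
  exact: dyadic_sum_le.
move=> t h phi m h0 pt arc m1'.
(* With [2^k <= m < 2^(k+1)] the arc lies in [E k], hence [t] in [B k], and the [k]-th term of [W t]
   alone exceeds [m]. *)
have [k /andP[km mk]] := dyadic_floor m1'.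
have tB : B k t.
  apply: (HL_maximal_arc (mE k) h0 pt) => x /arc[xab mgx]; split => //=.
  by apply: le_trans mgx; rewrite lee_fin.
apply: (@le_trans _ _ (2 ^+ k.+1 * \1_(B k) t)%:E).
  by rewrite lee_fin indicE mem_set// mulr1 ltW.
apply: le_trans (nneseries_lim_ge k.+1 _); last by move=> i _ _; exact: p1.
rewrite big_nat_recr//= leeDr//; apply: sume_ge0 => i _; exact: p1.
Qed.

End MaximalArcs.

(** * The integrable majorant of a function in a tent space *)

Section Majorant.
Context {R : realType}.
Implicit Types (f : R[i] -> R[i]) (t x p q a : R).
Local Notation mu := (@lebesgue_measure R).
Local Notation T2 := (measurableTypeR R * measurableTypeR R)%type.
Local Notation area := (@lebesgue_measure R \x @lebesgue_measure R)%E.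

Lemma powR_between_ge x r (B : R) : 0 < B -> B^-1 <= x -> x <= B -> powR B (- `|r|) <= powR x r.
Proof.
move=> B0 x1 x2; have x0 : 0 < x by apply: lt_le_trans x1; rewrite invr_gt0.
rewrite powRN -(invrK (powR x r)) lef_pV2 ?posrE ?invr_gt0 ?powR_gt0//.
by rewrite -powRN -(normrN r); apply: powR_between.
Qed.

Lemma ler_poweR (x y : \bar R) r : 0 <= r -> (0 <= x)%E -> (x <= y)%E ->
  (poweR x r <= poweR y r)%E.
Proof.
move=> r0 x0 xy; apply: gt0_ler_poweR => //; rewrite in_itv/= leey ?x0//.
by rewrite (le_trans x0).
Qed.

Lemma polarE (rho phi : R) : rho%:C%C * circ phi = Complex (rho * cos phi) (rho * sin phi).
Proof. by apply/eqP; rewrite /circ eq_complex /= !mul0r subr0 addr0 !eqxx. Qed.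

(** The square of half-side [h/20] about the point, [h = 1 - rho], lies in the cone, and there
    [1 - |w|] is comparable to [h]. The sub-mean value inequality on it gives the exponent [a + 2],
    the [2] being the area; [400 = 20^2]. *)
Lemma cone_lower q a : 0 < q -> exists2 C, 0 < C & forall f, analytic_on_disk f ->
  forall t phi rho, 2^-1 <= rho -> rho < 1 -> `|t - phi| <= (1 - rho) / 20 ->
  ((powR (normc (f (rho%:C%C * circ phi))) q * powR (1 - rho) (a + 2))%:E <=
    C%:E * cone_integral f q a t)%E.
Proof.
move=> q0; have [C0 C00 sub] := @submean_value R q q0.
pose D : R := powR 2 `|a| * powR 2 `|a|.
have D0 : 0 < D by rewrite mulr_gt0 ?powR_gt0.
have c400 : (0 : R) < 400 by rewrite ltr0n.
exists (400 * C0 * D); first by rewrite !mulr_gt0.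
move=> f fa t phi rho r2 r1 tphi; rewrite polarE.
set h := 1 - rho in tphi *; have h0 : 0 < h by rewrite subr_gt0.
set x0 := rho * cos phi; set y0 := rho * sin phi.
set A := normc (f (Complex x0 y0)).
pose Q := square x0 y0 (h / 20).
have Qc w : Q w -> cone t w by move=> wQ; exact: Gamma_square wQ.
have nz : normc (Complex x0 y0) = rho.
  by rewrite -polarE normcM normc_circ mulr1 normc_real ger0_norm// (le_trans _ r2).
have Qd w : Q w -> h / 2 <= 1 - normc (Complex w.1 w.2) <= 2 * h.
  move=> /squareE[w1 w2].
  have H : normc (Complex w.1 w.2 - Complex x0 y0) <= h / 10.
    by apply: le_trans (ler_normc_ReIm _) _ => /=; move: w1 w2; clear; lra.
  have H1 := lerB_normc (Complex w.1 w.2) (Complex x0 y0).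
  have H2 := lerB_normc (Complex x0 y0) (Complex w.1 w.2).
  rewrite normc_dist in H2; rewrite nz in H1 H2.
  by move: H H1 H2 h0; rewrite /h; clear; lra.
have fQ w : Q w -> cdiff_at f (Complex w.1 w.2).
  by move=> /Qc/cone_disk; exact: analytic_cdiff.
have dens w : Q w -> powR (normc (f (Complex w.1 w.2))) q <= D * powR h (- a) * density f q a w.
  move=> wQ; have /andP[d1 d2] := Qd _ wQ.
  have w1 : normc (Complex w.1 w.2) < 1 by exact: (cone_disk (Qc _ wQ)).
  set k := 1 - normc (Complex w.1 w.2) in d1 d2.
  have k0 : 0 < k by rewrite subr_gt0.
  have H1 := (one_sub_sqr_powR a w1).1; rewrite -/k in H1.
  have H2 : powR 2 (- `|a|) * powR h a <= powR k a.
    have -> : k = h * (k / h) by field; rewrite gt_eqF.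
    rewrite powRM; [|exact: ltW|by apply: divr_ge0; exact: ltW].
    rewrite mulrC ler_wpM2l ?powR_ge0//.
    apply: powR_between_ge => //.
    - by rewrite ler_pdivlMr// mulrC.
    - by rewrite ler_pdivrMr.
  have H3 : D^-1 * powR h a <= powR (1 - normc (Complex w.1 w.2) ^+ 2) a.
    apply: le_trans H1; apply: le_trans (ler_wpM2l (powR_ge0 _ _) H2).
    by rewrite mulrA /D invfM -!powRN.
  rewrite /density mulrCA -[leLHS]mulr1; apply: ler_wpM2l; first exact: powR_ge0.
  apply: le_trans (ler_wpM2l _ H3); last by rewrite mulr_ge0 ?powR_ge0// ltW.
  rewrite powRN; have ha0 : powR h a != 0 by rewrite gt_eqF ?powR_gt0.
  rewrite le_eqVlt; apply/orP; left; apply/eqP.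
  by field; rewrite ha0 gt_eqF.
have h20 : 0 < h / 20 by rewrite divr_gt0.
have H := sub f x0 y0 (h / 20) h20 fQ; rewrite -/A -/Q in H.
have E : ((powR A q * powR h (a + 2))%:E = (400 * powR h a)%:E * ((h / 20) ^+ 2 * powR A q)%:E)%E.
  rewrite -EFinM powRD; last by apply/implyP => _; rewrite gt_eqF.
  by rewrite (powR_mulrn 2 (ltW h0)); congr EFin; field.
rewrite E; apply: le_trans (lee_wpmul2l _ H) _; first by rewrite lee_fin; apply: mulr_ge0; [exact: ltW|exact: powR_ge0].
have I1 : (\int[area]_(w in Q) (powR (normc (f (Complex w.1 w.2))) q)%:E <=
   (D * powR h (- a))%:E * cone_integral f q a t)%E.
  rewrite /cone_integral -ge0_integralZl//; last 4 first.
  - exact: measurable_cone.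
  - apply/measurable_EFinP; apply: measurable_funS (measurable_density q a fa).
      exact: measurable_disk_pairs.
    exact: cone_disk.
  - by move=> w _; rewrite lee_fin density_ge0.
  - by rewrite lee_fin mulr_ge0 ?powR_ge0// ltW.
  apply: ge0_le_integral_set => w.
  - by rewrite lee_fin powR_ge0.
  - by move=> wQ; split; [exact: Qc|rewrite -EFinM lee_fin; exact: dens].
  - by move=> _; rewrite -EFinM lee_fin !mulr_ge0 ?powR_ge0// ltW.
have C0e : (0 <= C0%:E)%E by rewrite lee_fin ltW.
apply: le_trans (lee_wpmul2l _ (lee_wpmul2l C0e I1)) _.
  by rewrite lee_fin; apply: mulr_ge0; [exact: ltW|exact: powR_ge0].
rewrite !muleA -!EFinM.
rewrite (_ : 400 * powR h a * C0 * (D * powR h (- a)) = 400 * C0 * D)//.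
by rewrite powRN; field; rewrite gt_eqF ?powR_gt0.
Qed.

(** [phi] is the argument of the point. [cone_lower] bounds the value of [f] there not only from the
    vertex [t] but from every vertex [x] close to [phi], and the power [p/q] is taken pointwise,
    before any averaging. *)
Lemma arc_bound p q a : 0 < p -> 0 < q -> exists2 C, 0 < C & forall f, analytic_on_disk f ->
  forall t (w : T2), cone t w -> 7 / 10 <= normc (Complex w.1 w.2) ->
  exists2 phi, `|phi - t| <= 8 * (1 - normc (Complex w.1 w.2)) &
    forall x, `|x - phi| <= (1 - normc (Complex w.1 w.2)) / 20 ->
    ((powR (normc (f (Complex w.1 w.2))) p *
      powR (1 - normc (Complex w.1 w.2)) ((a + 2) / q * p))%:E <=
     C%:E * poweR (cone_integral f q a x) (p / q))%E.
Proof.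
move=> p0 q0; have [C C0 low] := @cone_lower q a q0.
have pq0 : 0 < p / q by rewrite divr_gt0.
exists (powR C (p / q)); first by rewrite powR_gt0.
move=> f fa t w wc w7; set z := Complex w.1 w.2 in wc w7 *.
have z1 : normc z < 1 by exact: (cone_disk wc).
have w2 : 2^-1 <= normc z by move: w7; clear; lra.
have [phi phit zE] := Gamma_arg wc w2.
exists phi => // x xphi.
have := low f fa x phi (normc z) w2 z1 xphi; rewrite -zE.
set h := 1 - normc z; set A := normc (f z) => H.
have h0 : 0 < h by rewrite subr_gt0.
have A0 : 0 <= A by exact: normc_ge0.
have L0 : (0 <= (powR A q * powR h (a + 2))%:E)%E by rewrite lee_fin mulr_ge0 ?powR_ge0.
have F0 := cone_integral_ge0 f q a x.
have := ler_poweR (ltW pq0) L0 H.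
rewrite poweRM ?lee_fin ?(ltW C0)// !poweR_EFin.
rewrite powRM ?powR_ge0// -!powRrM.
have -> : q * (p / q) = p by field; rewrite gt_eqF.
by have -> : (a + 2) * (p / q) = (a + 2) / q * p by field; rewrite gt_eqF.
Qed.

Lemma cone_majorant p q a f : 0 < p -> 0 < q -> -2 < a -> analytic_on_disk f ->
  (tent_norm_pow q a p f < +oo)%E ->
  exists (W : R -> \bar R) (K : R), [/\ measurable_fun [set: R] W, (forall t, 1 <= W t)%E,
    (\int[mu]_(t in `[0%R, (2 * pi)%R]) W t < +oo)%E, 0 < K &
    forall t (w : T2), 0 <= t <= 2 * pi -> cone t w ->
    let h := 1 - normc (Complex w.1 w.2) in let A := normc (f (Complex w.1 w.2)) in
    ((powR A p * powR h ((a + 2) / q * p))%:E <= W t)%E /\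
    powR A p * powR h ((a + 2) / q * p + 1) <= K].
Proof.
move=> p0 q0 a2 fa; rewrite tent_norm_powE => fint.
have [C C0 arc] := @arc_bound p q a p0 q0.
pose g0 t := poweR (cone_integral f q a t) (p / q).
pose g t := (C%:E * g0 t)%E.
have mg0 : measurable_fun [set: R] g0.
  exact: (measurableT_comp (measurable_poweR _) (measurable_cone_integral q a fa)).
have g00 t : (0 <= g0 t)%E by exact: poweR_ge0.
have mg : measurable_fun [set: R] g by apply: measurable_funeM.
have ggt0 t : (0 <= g t)%E by rewrite mule_ge0// lee_fin ltW.
have pi2 : 2 <= pi :> R by exact: pi_ge2.
(* Arcs stay within [8 h + h/20] of [t] with [h <= 3/10], so one additional period on either side is
   enough. *)
have gint : (\int[mu]_(t in `[(- (2 * pi))%R, (2 * (2 * pi))%R]) g t < +oo)%E.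
  rewrite ge0_integralZl//; last 2 first.
  - exact: measurable_funTS.
  - by rewrite lee_fin ltW.
  apply: lte_mul_pinfty; [by rewrite lee_fin ltW|by []|].
  apply: le_lt_trans (periodic_integral _ mg0 g00 _) _.
  - by move: pi2; clear; lra.
  - by move=> x; rewrite /g0 cone_integral_period.
  by apply: lte_add_pinfty; [apply: lte_add_pinfty|].
have [W1 [mW1 W10 W1int W1P]] := arc_maximal mg ggt0 gint.
(* Away from the circle [|f|] is bounded by compactness. The radius [7/10] is chosen so that the
   square around that disk still lies in the unit disk: [2 * 49/100 < 1]. *)
have small (w : T2) : square 0 0 (7 / 10) w -> disk_pairs w.
  move=> /squareE[]; rewrite !subr0 /disk_pairs /= normc_lt1 => w1 w2.
  have sq (u : R) : `|u| <= 7 / 10 -> u ^+ 2 <= 49 / 100.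
    move=> u7; rewrite -real_normK ?num_real//.
    have -> : 49 / 100 = (7 / 10) ^+ 2 :> R by field.
    by rewrite ler_pXn2r// nnegrE divr_ge0.
  by move: (sq _ w1) (sq _ w2); clear; lra.
have [||w1 _ w1P] := @square_weighted_max R (fun w => normc (f (Complex w.1 w.2))) 0 0 (7 / 10) 0.
- by rewrite divr_gt0.
- by move=> w /small wd; apply: cdiff_continuous2; exact: analytic_cdiff.
set N := normc (f (Complex w1.1 w1.2)) in w1P.
have N0 : 0 <= N by exact: normc_ge0.
pose B := powR N p; have B0 : 0 <= B by exact: powR_ge0.
set G := (\int[mu]_(t in _) g t)%E in gint.
have G0 : (0 <= G)%E by apply: integral_ge0.
have Gfin : G = (fine G)%:E by rewrite fineK// ge0_fin_numE.
have e0 : 0 <= (a + 2) / q * p.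
  by rewrite !mulr_ge0 ?invr_ge0 ?(ltW q0) ?(ltW p0)//; move: a2; clear; lra.
exists (fun t => (1 + B)%:E + W1 t)%E, (1 + B + 10 * fine G); split.
- exact: emeasurable_funD.
- move=> t; apply: (@le_trans _ _ (1 + B)%:E); first by rewrite lee_fin lerDl.
  by rewrite leeDl.
- rewrite ge0_integralD//; last 2 first.
  + by move=> t _; rewrite lee_fin addr_ge0.
  + exact: measurable_funTS.
  rewrite integral_cst// lte_add_pinfty//.
    rewrite -[X in (_ * X)%E]/(mu `[0%R, (2 * pi)%R]%classic).
    by rewrite lebesgue_measure_itv/=; case: ifP => _; rewrite ?mule0// -EFinB -EFinM ltry.
  apply: le_lt_trans W1int; apply: ge0_le_integral_set => // t _.
- rewrite -addrA ltr_pwDl// addr_ge0// mulr_ge0// fine_ge0//.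
move=> t w t02 wc h A.
have wlt1 : normc (Complex w.1 w.2) < 1 by exact: (cone_disk wc).
have h0 : 0 < h by rewrite subr_gt0.
have h1 : h <= 1 by rewrite gerBl normc_ge0.
have powh1 e : 0 <= e -> powR h e <= 1.
  move=> ege0; rewrite -(powRr0 h); apply: ger_powR => //; by rewrite h0.
have [w7|w7] := leP (7 / 10) (normc (Complex w.1 w.2)); last first.
  have wS : square 0 0 (7 / 10) w.
    apply/squareE; rewrite !subr0; split.
      by apply: le_trans (ltW w7); have := ler_Re_normc (Complex w.1 w.2).
    by apply: le_trans (ltW w7); have := ler_Im_normc (Complex w.1 w.2).
  have AN : powR A p <= B.
    by apply: ler_powR2; [exact: ltW|exact: normc_ge0|have := w1P w wS; rewrite !expr0 !mulr1].
  have MB e : 0 <= e -> powR A p * powR h e <= 1 + B.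
    move=> ege0; apply: (@le_trans _ _ B); last by rewrite lerDr.
    by rewrite -[leRHS]mulr1; apply: ler_pM; rewrite ?powR_ge0// powh1.
  split; last by apply: le_trans (MB _ _) _; rewrite ?addr_ge0// lerDl mulr_ge0// fine_ge0.
  by apply: (@le_trans _ _ (1 + B)%:E); [rewrite lee_fin MB|rewrite leeDl].
have [phi phit arcP] := arc f fa t w wc w7; rewrite -/h -/A in phit arcP.
have h3 : h <= 3 / 10 by move: w7; rewrite /h; clear; lra.
have inI x : `|x - phi| <= h / 20 -> - (2 * pi) <= x <= 2 * (2 * pi).
  by move: phit; rewrite !ler_norml => /andP[? ?] /andP[? ?]; move: t02 pi2 h3 h0; lra.
set M := powR A p * powR h ((a + 2) / q * p).
have M0 : 0 <= M by rewrite mulr_ge0 ?powR_ge0.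
split.
  (* [W1] dominates only values at least [1]; smaller ones are left to the constant [1 + B]. *)
  have [M1|M1] := leP 1 M.
    apply: (@le_trans _ _ (W1 t)); last by rewrite leeDr// lee_fin addr_ge0.
    apply: (W1P t h phi M) => // x xphi; split; first exact: inI.
    exact: arcP.
  apply: (@le_trans _ _ (1 + B)%:E); last by rewrite leeDl.
  by rewrite lee_fin (le_trans (ltW M1))// lerDl.
(* The function [g] is at least [M] on an arc of length [h/10]. Its total integral thus bounds
   [M * h], which is where the additional exponent [1] and the term [10 * fine G] of [K] come
   from. *)
have H : ((M * (h / 10))%:E <= G)%E.
  have -> : ((M * (h / 10))%:E = \int[mu]_(x in `[(phi - h / 20)%R, (phi + h / 20)%R]) cst M%:E x)%E.
    have L : mu `[(phi - h / 20)%R, (phi + h / 20)%R] = (h / 10)%:E.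
      rewrite lebesgue_measure_itv/= lte_fin ifT; last by move: h0; clear; lra.
      by rewrite -EFinB; congr EFin; field.
    by rewrite integral_cst// EFinM; congr (_ * _)%E; exact/esym.
  apply: ge0_le_integral_set => // x; rewrite /= in_itv/= -ler_distl => xphi.
  by split; [rewrite in_itv/=; exact: inI|exact: arcP].
rewrite powRD; last by apply/implyP => _; rewrite gt_eqF.
rewrite powRr1 ?(ltW h0)// mulrA -/M.
rewrite Gfin lee_fin in H; move: H B0; clear; lra.
Qed.

End Majorant.

(** * Dyadic shells and the sufficient conditions *)

Section Shells.
Context {R : realType}.
Implicit Types (f : R[i] -> R[i]) (t x p q u v a : R).
Local Notation T2 := (measurableTypeR R * measurableTypeR R)%type.
Local Notation area := (@lebesgue_measure R \x @lebesgue_measure R)%E.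

Lemma shell_exists (b h : R) : 0 < b -> b <= 2^-1 -> 0 < h -> h <= 1 ->
  exists k, b ^+ k.+1 < h <= b ^+ k.
Proof.
move=> b0 b2 h0 h1.
have ex : exists n, b ^+ n < h.
  have [n hn] := exp2_gt h^-1; exists n.
  apply: (@le_lt_trans _ _ ((2^-1) ^+ n)).
    by apply: lerXn2r => //; rewrite nnegrE ltW.
  by rewrite exprVn -[h]invrK ltf_pV2 ?posrE ?exprn_gt0// invr_gt0.
case: (ex_minnP ex) => -[|k] hk kmin; first by rewrite expr0 ltNge h1 in hk.
by exists k; rewrite hk leNgt; apply/negP => /kmin; rewrite ltnn.
Qed.

Lemma nneseries_le_real (s : nat -> R) (C : R) : (forall n, 0 <= s n) ->
  (forall n, \sum_(0 <= k < n) s k <= C) -> (\sum_(0 <= k <oo) (s k)%:E <= C%:E)%E.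
Proof.
move=> s0 sC; apply: lime_le; first by apply: is_cvg_nneseries => k _ _; rewrite lee_fin.
by apply: nearW => n; rewrite sumEFin lee_fin.
Qed.

(** The part of the cone with [h <= b^k] lies in a square of area [16 * b^(2k)], and on the shell
    [h^a = h^(a+2) * h^-2] with [h^-2 <= b^-2 * b^(-2k)]; the powers of [b^k] cancel. The ratio [b]
    is left free: it is [1/2] for the sufficiency and [1/lam] for the lacunary series. *)
Lemma cone_integral_shells f u a t (b : R) (c : nat -> R) : 0 < b -> b <= 2^-1 ->
  (forall k, 0 <= c k) ->
  (forall k (w : T2), cone t w -> let h := 1 - normc (Complex w.1 w.2) in
     b ^+ k.+1 < h -> h <= b ^+ k ->
     powR (normc (f (Complex w.1 w.2))) u * powR h (a + 2) <= c k) ->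
  (cone_integral f u a t <=
    \sum_(0 <= k <oo) (16 * b ^- 2 * powR 2 `|a| * c k)%:E)%E.
Proof.
move=> b0 b2 c0 fc.
have c16 : (0 : R) < 16 by rewrite ltr0n.
pose Q k := square (cos t) (sin t) (2 * b ^+ k).
have mQ k : measurable (Q k) by exact: measurable_square.
pose d k := powR 2 `|a| * (b ^- 2 * b ^- (2 * k)) * c k.
have bk k : 0 < b ^+ k by rewrite exprn_gt0.
have d0 k : 0 <= d k.
  by rewrite /d !mulr_ge0 ?powR_ge0 ?invr_ge0 ?exprn_ge0 ?(ltW b0).
have areaQ k : area (Q k) = (16 * b ^+ (2 * k))%:E.
  rewrite area_square; last by rewrite mulr_ge0// ltW.
  by congr EFin; rewrite mulnC exprM; ring.
apply: (@le_trans _ _ (\int[area]_w (\sum_(0 <= k <oo) (d k * \1_(Q k) w)%:E))%E); last first.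
  rewrite integral_nneseries//; last 2 first.
  - move=> k; apply/measurable_EFinP; apply: measurable_funM => //; exact: measurable_indic.
  - by move=> k w _; rewrite lee_fin mulr_ge0.
  apply: lee_nneseries => [k _ _|k _]; first by apply: integral_ge0 => w _; rewrite lee_fin mulr_ge0.
  under eq_integral do rewrite EFinM.
  rewrite ge0_integralZl//; last 2 first.
  - by apply/measurable_EFinP; exact: measurable_indic.
  - by rewrite lee_fin.
  rewrite integral_indic; [|by []|exact: mQ].
  rewrite setIT -[X in (_ * X <= _)%E]/(area (Q k)) areaQ -EFinM lee_fin /d.
  have bkn : b ^+ (2 * k) != 0 by rewrite gt_eqF.
  rewrite le_eqVlt; apply/orP; left; apply/eqP.
  by field; rewrite bkn gt_eqF.
rewrite /cone_integral; apply: ge0_le_integral_set => //.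
- by move=> w _; rewrite lee_fin density_ge0.
- move=> w wc; split => //.
  have w1 : normc (Complex w.1 w.2) < 1 by exact: (cone_disk wc).
  set h := 1 - normc (Complex w.1 w.2).
  have h0 : 0 < h by rewrite subr_gt0.
  have h1 : h <= 1 by rewrite gerBl normc_ge0.
  have [k /andP[hk1 hk2]] := shell_exists b0 b2 h0 h1.
  have wQ : Q k w by exact: Gamma_sub_square.
  have fck := fc k w wc hk1 hk2; rewrite -/h in fck.
  apply: (@le_trans _ _ (d k * \1_(Q k) w)%:E); last first.
    apply: le_trans (nneseries_lim_ge k.+1 _); last first.
      by move=> i _ _; rewrite lee_fin mulr_ge0.
    rewrite big_nat_recr//= leeDr//; apply: sume_ge0 => i _.
    by rewrite lee_fin mulr_ge0.
  rewrite lee_fin indicE mem_set// mulr1 /density /d.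
  have H1 := (one_sub_sqr_powR a w1).2; rewrite -/h in H1.
  apply: le_trans (ler_wpM2l (powR_ge0 _ _) H1) _.
  rewrite mulrCA -mulrA; apply: ler_wpM2l; first exact: powR_ge0.
  have E : powR h (a + 2) = powR h a * h ^+ 2.
    by rewrite powRD; [rewrite (powR_mulrn 2 (ltW h0))|apply/implyP => _; rewrite gt_eqF].
  have hb : h ^- 2 <= b ^- 2 * b ^- (2 * k).
    rewrite -invfM -exprD lef_pV2 ?posrE ?exprn_gt0//.
    have -> : (2 + 2 * k = k.+1 * 2)%N by rewrite (mulnC 2%N k) -mulSn.
    rewrite exprM; apply: lerXn2r; rewrite ?nnegrE ?(ltW (bk _)) ?(ltW h0)//.
    exact: ltW.
  have -> : powR (normc (f (Complex w.1 w.2))) u * powR h a =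
     h ^- 2 * (powR (normc (f (Complex w.1 w.2))) u * powR h (a + 2)).
    by rewrite E; field; rewrite gt_eqF.
  by apply: ler_pM => //; rewrite ?mulr_ge0 ?powR_ge0// invr_ge0 exprn_ge0// ltW.
- by move=> w _; apply: nneseries_ge0 => k _ _; rewrite lee_fin mulr_ge0.
Qed.

Lemma geometric_sum_gt1 (y : R) n : 1 < y -> \sum_(0 <= k < n) y ^+ k <= y ^+ n / (y - 1).
Proof.
move=> y1; have y0 : 0 < y - 1 by rewrite subr_gt0.
rewrite ler_pdivlMr//; elim: n => [|n IH].
  by rewrite big_geq// mul0r.
rewrite big_nat_recr//= mulrDl exprS; move: IH; set S := (\sum_(_ <= _ < _) _) * _.
by set e := y ^+ n; lra.
Qed.

Lemma geometric_sum_lt1 (x : R) n : 0 <= x -> x < 1 -> \sum_(0 <= k < n) x ^+ k <= (1 - x)^-1.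
Proof.
move=> x0 x1; have y0 : 0 < 1 - x by rewrite subr_gt0.
rewrite -div1r ler_pdivlMr//.
have -> : (\sum_(0 <= k < n) x ^+ k) * (1 - x) = 1 - x ^+ n.
  elim: n => [|n IH]; first by rewrite big_geq// mul0r expr0 subrr.
  by rewrite big_nat_recr//= mulrDl IH exprS; ring.
by rewrite gerBl exprn_ge0.
Qed.

(** The growing bound is summed up to the crossover index [m] and the decaying one beyond it. *)
Lemma two_sided_sum (s : nat -> R) (A B x y : R) m n : (forall k, 0 <= s k) ->
  0 <= A -> 0 <= B -> 0 <= x -> x < 1 -> 1 < y ->
  (forall k, s k <= A * x ^+ k) -> (forall k, s k <= B * y ^+ k) ->
  \sum_(0 <= k < n) s k <= B * y ^+ m / (y - 1) + A * x ^+ m / (1 - x).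
Proof.
move=> s0 A0 B0 x0 x1 y1 sA sB.
(* Extending the range to [m + n] makes the cut at [m] possible also when [n < m]. *)
apply: (@le_trans _ _ (\sum_(0 <= k < m + n) s k)).
  rewrite (@big_cat_nat _ _ _ n 0 (m + n))//= ?leq_addl// lerDl.
  by apply: sumr_ge0.
rewrite (@big_cat_nat _ _ _ m 0 (m + n))//= ?leq_addr//; apply: lerD.
  rewrite -mulrA; apply: le_trans (ler_wpM2l B0 (geometric_sum_gt1 m y1)).
  by rewrite mulr_sumr; apply: ler_sum => k _.
have -> : \sum_(m <= i < m + n) s i = \sum_(0 <= i < n) s (i + m)%N.
  by rewrite -{1}(add0n m) big_addn addKn.
apply: (@le_trans _ _ (A * x ^+ m * \sum_(0 <= k < n) x ^+ k)).
  rewrite mulr_sumr; apply: ler_sum => k _.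
  by apply: le_trans (sA _) _; rewrite exprD; rewrite (mulrC (x ^+ k)) mulrA.
apply: ler_wpM2l; first by rewrite mulr_ge0// exprn_ge0.
exact: geometric_sum_lt1.
Qed.

End Shells.

(** * Bounds for the target cone integral in the three cases *)

Section Sufficiency.
Context {R : realType}.
Implicit Types (f : R[i] -> R[i]) (t x p q u v : R).
Local Notation T2 := (measurableTypeR R * measurableTypeR R)%type.

Lemma powR_gt1 (b r : R) : 1 < b -> 0 < r -> 1 < powR b r.
Proof.
move=> b1 r0; have := @gt0_ltr_powR R r r0 1 b; rewrite powR1 !nnegrE ler01; apply=> //.
by rewrite ltW// (lt_trans _ b1).
Qed.

Lemma powRN_lt1 (b r : R) : 1 < b -> 0 < r -> powR b (- r) < 1.
Proof. by move=> b1 r0; rewrite powRN invf_lt1 ?powR_gt1// powR_gt0// (lt_trans _ b1). Qed.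

Lemma powR_exprn (b r : R) n : 0 <= b -> powR b r ^+ n = powR (b ^+ n) r.
Proof.
move=> b0; rewrite -(powR_mulrn n (powR_ge0 b r)) -powRrM mulrC powRrM.
by rewrite (powR_mulrn n b0).
Qed.

Lemma powR_half_shell (h e : R) k : 0 < h -> 2^-1 ^+ k.+1 < h -> h <= 2^-1 ^+ k ->
  (0 <= e -> powR h e <= powR 2 (- e) ^+ k) /\
  (e <= 0 -> powR h e <= powR 2 (- e) * powR 2 (- e) ^+ k).
Proof.
move=> h0 h1 h2.
have E n (r : R) : powR (2^-1 ^+ n) r = powR 2 (- r) ^+ n.
  by rewrite -powR_exprn ?invr_ge0// (@powR_inv R 2).
split=> e0; first by rewrite -E; apply: ler_powR2 => //; exact: ltW.
have inv y : 0 <= y -> powR y e = powR y^-1 (- e) by move=> y0; rewrite powR_inv// opprK.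
have c2 : (0 : R) < 2^-1 by rewrite invr_gt0.
rewrite -exprS -E (inv h) ?(inv (2^-1 ^+ k.+1)) ?exprn_ge0 ?(ltW h0) ?(ltW c2)//.
apply: ler_powR2; first by rewrite oppr_ge0.
  by rewrite invr_ge0 ltW.
by rewrite lef_pV2 ?posrE ?exprn_gt0 ?invr_gt0// ltW.
Qed.

Lemma ler_powR_root (A B p u : R) : 0 < p -> 0 <= u -> 0 <= A -> powR A p <= B ->
  powR A u <= powR B (u / p).
Proof.
move=> p0 u0 A0 AB.
have -> : powR A u = powR (powR A p) (u / p).
  by rewrite -powRrM; congr powR; field; rewrite gt_eqF.
by apply: ler_powR2 => //; rewrite ?divr_ge0 ?powR_ge0// ltW.
Qed.

(** Solving the hypothesis for [A] gives [A^u <= M^(u/p) * h^(-e u)]. It is applied with [e = s] and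
    [M = W], and with [e = s + 1/p] and [M = K]. *)
Lemma ler_powR_weight (A h p u e sg b M : R) : 0 < p -> 0 < u -> 0 < h -> 0 <= A -> b = sg * u ->
  powR A p * powR h (e * p) <= M ->
  powR A u * powR h b <= powR M (u / p) * powR h (u * (sg - e)).
Proof.
move=> p0 u0 h0 A0 bE AM.
have := @ler_powR_root (A * powR h e) M p u p0 (ltW u0) (mulr_ge0 A0 (powR_ge0 _ _)).
rewrite powRM ?powR_ge0// -powRrM => /(_ AM).
rewrite powRM ?powR_ge0// -powRrM => H.
have -> : powR h b = powR h (e * u) * powR h (u * (sg - e)).
  rewrite -powRD; last by apply/implyP => _; rewrite gt_eqF.
  by congr powR; rewrite bE; ring.
by rewrite mulrA; apply: ler_wpM2r; rewrite ?powR_ge0.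
Qed.

(* With [s = (alpha+2)/q], [sigma = (beta+2)/u]: the bounds [|f| <= W^{1/p} h^{-s}] and
   [|f| <= K^{1/p} h^{-s-1/p}] compete on the dyadic shells [h ~ 2^-k]; the crossover is at
   [2^k ~ W], where both geometric sums are of size [W^{u/v}]. *)
Lemma cone_integral_le_lt p q u v alpha beta (K : R) : 0 < p -> 0 < q -> 0 < u -> 0 < v ->
  0 < K -> p < v -> p^-1 - v^-1 + (alpha + 2) / q - (beta + 2) / u <= 0 ->
  exists2 C, 0 < C & forall f t (W : R), 1 <= W ->
  (forall w : T2, cone t w ->
    let h := 1 - normc (Complex w.1 w.2) in let A := normc (f (Complex w.1 w.2)) in
    powR A p * powR h ((alpha + 2) / q * p) <= W /\
    powR A p * powR h ((alpha + 2) / q * p + 1) <= K) ->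
  (cone_integral f u beta t <= (C * powR W (u / v))%:E)%E.
Proof.
move=> p0 q0 u0 v0 K0 pv crit.
set s := (alpha + 2) / q in crit *; set sg := (beta + 2) / u in crit.
pose gam := p^-1 - v^-1.
have gam0 : 0 < gam by rewrite subr_gt0 ltf_pV2.
have sgs : gam <= sg - s by rewrite /gam; move: crit; clear; lra.
(* On the [k]-th shell the bound by [W] decays like [h^(u gam)], with [gam > 0] because [p < v], and
   the bound by [K] grows like [h^(-u/v)]. *)
pose x := powR 2 (- (u * gam)); pose y := powR 2 (u / v).
have x0 : 0 < x by rewrite powR_gt0.
have x1 : x < 1 by apply: powRN_lt1; rewrite ?ltr1n// mulr_gt0.
have y1 : 1 < y by apply: powR_gt1; rewrite ?ltr1n// divr_gt0.
have y0 : 0 < y by rewrite powR_gt0.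
(* The additional factor [y] pays for replacing [h] by the inner radius [2^-(k+1)] of the shell
   under a negative power. *)
pose B := powR K (u / p) * y.
have B0 : 0 < B by rewrite mulr_gt0 ?powR_gt0.
have xi : 0 < 1 - x by rewrite subr_gt0.
have yi : 0 < y - 1 by rewrite subr_gt0.
pose D : R := 16 * (2^-1) ^- 2 * powR 2 `|beta|.
have c16 : (0 : R) < 16 by rewrite ltr0n.
have D0 : 0 < D by rewrite !mulr_gt0 ?powR_gt0// invr_gt0 exprn_gt0.
exists (D * (B * y / (y - 1) + (1 - x)^-1)).
  by apply: mulr_gt0 => //; apply: addr_gt0; rewrite ?invr_gt0// divr_gt0// mulr_gt0.
move=> f t W W1 fW; have W0 : 0 < W by apply: lt_le_trans W1.
pose A := powR W (u / p); have A0 : 0 < A by rewrite powR_gt0.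
pose c (k : nat) := Num.min (A * x ^+ k) (B * y ^+ k).
have c0 k : 0 <= c k by rewrite le_min; apply/andP; split; apply: mulr_ge0; rewrite ?exprn_ge0// ltW.
have h2 : (0 : R) < 2^-1 by rewrite invr_gt0.
apply: le_trans (@cone_integral_shells R f u beta t 2^-1 c h2 (lexx _) c0 _) _.
  move=> k w wc h hk1 hk2.
  have h0 : 0 < h by rewrite subr_gt0; exact: (cone_disk wc).
  have h1 : h <= 1 by rewrite gerBl normc_ge0.
  have [] := fW w wc; rewrite -/h; set a := normc (f _) => aW aK.
  have a0 : 0 <= a by exact: normc_ge0.
  have sgE : beta + 2 = sg * u by rewrite /sg divfK// gt_eqF.
  have split e M := @ler_powR_weight a h p u e sg (beta + 2) M p0 u0 h0 a0 sgE.
  rewrite le_min; apply/andP; split.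
    apply: le_trans (split s W aW) _.
    apply: ler_wpM2l; first exact: powR_ge0.
    apply: le_trans ((powR_half_shell (u * gam) h0 hk1 hk2).1 _); last by rewrite mulr_ge0// ltW.
    by apply: ger_powR; [rewrite h0|rewrite ler_pM2l].
  have aK' : powR a p * powR h ((s + p^-1) * p) <= K.
    by rewrite mulrDl mulVf// gt_eqF.
  apply: le_trans (split _ K aK') _.
  rewrite /B -mulrA; apply: ler_wpM2l; first exact: powR_ge0.
  have := (powR_half_shell (- (u / v)) h0 hk1 hk2).2; rewrite opprK oppr_le0.
  move=> /(_ (divr_ge0 (ltW u0) (ltW v0))); apply: le_trans.
  apply: ger_powR; first by rewrite h0.
  have -> : - (u / v) = u * (gam - p^-1) by rewrite /gam; ring.
  by rewrite ler_pM2l//; move: sgs; clear; lra.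
(* At [2^m ~ W] both sums have size [W^(u/v)]: the growing one is of the order of [y^m], the
   decaying one of [W^(u/p) * W^(-u gam)], and [u/p - u gam = u/v]. *)
have [m /andP[m1 m2]] := dyadic_floor W1.
have Wuv : 0 <= powR W (u / v) by exact: powR_ge0.
apply: nneseries_le_real => [n|n]; first by rewrite mulr_ge0// ltW.
rewrite -mulr_sumr -/D -[leRHS]mulrA; apply: ler_wpM2l; first exact: ltW.
apply: le_trans (@two_sided_sum R c A B x y m.+1 n c0 (ltW A0) (ltW B0) (ltW x0) x1 y1 _ _) _.
- by move=> k; rewrite ge_min lexx.
- by move=> k; rewrite ge_min lexx orbT.
have ym : y ^+ m <= powR W (u / v).
  rewrite /y powR_exprn//.
  by apply: ler_powR2 => //; rewrite ?divr_ge0 ?exprn_ge0// ltW.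
have xm : A * x ^+ m.+1 <= powR W (u / v).
  have -> : x ^+ m.+1 = powR (2 ^+ m.+1) (- (u * gam)).
    by rewrite /x powR_exprn.
  have -> : powR W (u / v) = A * powR W (- (u * gam)).
    rewrite /A -powRD; last by apply/implyP => _; rewrite gt_eqF.
    by congr powR; rewrite /gam; ring.
  apply: ler_wpM2l; first exact: ltW.
  rewrite -!(@powR_inv R) ?exprn_ge0 ?(ltW W0)//.
  apply: ler_powR2; rewrite ?invr_ge0 ?exprn_ge0//; first by rewrite mulr_ge0// ltW.
  by rewrite lef_pV2 ?posrE ?exprn_gt0// ltW.
rewrite mulrDl; apply: lerD.
  rewrite exprS mulrA -!(mulrA (B * y)) (mulrC (y ^+ m)); apply: ler_wpM2l; first by rewrite mulr_ge0// ltW.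
  by apply: ler_wpM2l => //; rewrite invr_ge0 ltW.
by rewrite mulrC; apply: ler_wpM2l => //; rewrite invr_ge0 ltW.
Qed.

(** With [sigma > s] the bound by [W] alone decays geometrically over the shells. The estimate holds
    for any function satisfying the bound on one cone, so it also evaluates the explicit function of
    the first counterexample. *)
Lemma cone_integral_le_gap p q u alpha beta : 0 < p -> 0 < q -> 0 < u ->
  (alpha + 2) / q - (beta + 2) / u < 0 ->
  exists2 C, 0 < C & forall f t (W : R), 0 < W ->
  (forall w : T2, cone t w ->
    let h := 1 - normc (Complex w.1 w.2) in let A := normc (f (Complex w.1 w.2)) in
    powR A p * powR h ((alpha + 2) / q * p) <= W) ->
  (cone_integral f u beta t <= (C * powR W (u / p))%:E)%E.
Proof.
move=> p0 q0 u0 crit.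
set s := (alpha + 2) / q in crit *; set sg := (beta + 2) / u in crit.
have gam0 : 0 < sg - s by rewrite subr_gt0 -subr_lt0.
pose x := powR 2 (- (u * (sg - s))).
have x0 : 0 < x by rewrite powR_gt0.
have x1 : x < 1 by apply: powRN_lt1; rewrite ?ltr1n// mulr_gt0.
have xi : 0 < 1 - x by rewrite subr_gt0.
pose D : R := 16 * (2^-1) ^- 2 * powR 2 `|beta|.
have c16 : (0 : R) < 16 by rewrite ltr0n.
have D0 : 0 < D by rewrite !mulr_gt0 ?powR_gt0// invr_gt0 exprn_gt0.
exists (D * (1 - x)^-1); first by rewrite mulr_gt0// invr_gt0.
move=> f t W W0 fW.
pose A := powR W (u / p); have A0 : 0 < A by rewrite powR_gt0.
pose c (k : nat) := A * x ^+ k.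
have c0 k : 0 <= c k by apply: mulr_ge0; rewrite ?exprn_ge0// ltW.
have h2 : (0 : R) < 2^-1 by rewrite invr_gt0.
apply: le_trans (@cone_integral_shells R f u beta t 2^-1 c h2 (lexx _) c0 _) _.
  move=> k w wc h hk1 hk2.
  have h0 : 0 < h by rewrite subr_gt0; exact: (cone_disk wc).
  have := fW w wc; rewrite /= -/h; set a := normc (f _) => aW.
  have a0 : 0 <= a by exact: normc_ge0.
  have sgE : beta + 2 = sg * u by rewrite /sg divfK// gt_eqF.
  apply: le_trans (ler_powR_weight p0 u0 h0 a0 sgE aW) _.
  apply: ler_wpM2l; first exact: powR_ge0.
  by apply: (powR_half_shell (u * (sg - s)) h0 hk1 hk2).1; rewrite mulr_ge0// ltW.
apply: nneseries_le_real => [n|n]; first by rewrite mulr_ge0// ltW.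
rewrite -mulr_sumr -/D -[leRHS]mulrA; apply: ler_wpM2l; first exact: ltW.
rewrite -mulr_sumr -/A mulrC; apply: ler_wpM2r; first exact: ltW.
by apply: geometric_sum_lt1 => //; exact: ltW.
Qed.

(** For [sigma = s] the pointwise bound gives no decay. Instead [|f|^u = |f|^(u-q) * |f|^q]: only
    the first factor is estimated by [W], with the weight [h^(beta - alpha)] that it needs since
    [beta - alpha = s (u - q)], and the second one rebuilds the integral for [(q, alpha)]. *)
Lemma cone_integral_le_eq p q u alpha beta : 0 < p -> 0 < q -> 0 < u ->
  (alpha + 2) / q = (beta + 2) / u -> q <= u ->
  exists2 C, 0 < C & forall f t (W : R), analytic_on_disk f -> 0 < W ->
  (forall w : T2, cone t w ->
    let h := 1 - normc (Complex w.1 w.2) in let A := normc (f (Complex w.1 w.2)) in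
    powR A p * powR h ((alpha + 2) / q * p) <= W) ->
  (cone_integral f u beta t <= (C * powR W ((u - q) / p))%:E * cone_integral f q alpha t)%E.
Proof.
move=> p0 q0 u0 crit qu.
set s := (alpha + 2) / q in crit *.
have uq : 0 <= u - q by rewrite subr_ge0.
have ba : beta - alpha = s * (u - q).
  have -> : beta - alpha = (beta + 2) / u * u - (alpha + 2) / q * q by field; rewrite !gt_eqF.
  by rewrite -crit -/s; ring.
exists (powR 2 `|beta - alpha|); first by rewrite powR_gt0.
move=> f t W fa W0 fW.
rewrite /cone_integral -ge0_integralZl//; last 4 first.
- exact: measurable_cone.
- apply/measurable_EFinP; apply: measurable_funS (measurable_density q alpha fa).
    exact: measurable_disk_pairs.
  exact: cone_disk.
- by move=> w _; rewrite lee_fin density_ge0.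
- by rewrite lee_fin mulr_ge0 ?powR_ge0.
apply: ge0_le_integral_nomeas => w wc; first by rewrite lee_fin density_ge0.
have w1 : normc (Complex w.1 w.2) < 1 by exact: (cone_disk wc).
have := fW w wc; rewrite /density /=; set a := normc (f _); set r := normc _ in w1 *.
set h := 1 - r => aW.
have h0 : 0 < h by rewrite subr_gt0.
have a0 : 0 <= a by exact: normc_ge0.
have d0 : 0 < 1 - r ^+ 2 by rewrite subr_gt0 expr_lt1// normc_ge0.
rewrite -EFinM lee_fin.
have H1 := (one_sub_sqr_powR (beta - alpha) w1).2; rewrite -/r -/h in H1.
have := @ler_powR_root (a * powR h s) W p (u - q) p0 uq (mulr_ge0 a0 (powR_ge0 _ _)).
rewrite powRM ?powR_ge0// -powRrM => /(_ aW).
rewrite powRM ?powR_ge0// -powRrM -ba => H.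
have Eb : powR (1 - r ^+ 2) beta = powR (1 - r ^+ 2) (beta - alpha) * powR (1 - r ^+ 2) alpha.
  by rewrite -powRD ?subrK//; apply/implyP => _; rewrite gt_eqF.
have Ea : powR a u = powR a (u - q) * powR a q.
  by rewrite -powRD subrK// gt_eqF.
rewrite Eb Ea.
have -> : powR a (u - q) * powR a q * (powR (1 - r ^+ 2) (beta - alpha) * powR (1 - r ^+ 2) alpha) =
  powR a (u - q) * powR (1 - r ^+ 2) (beta - alpha) * (powR a q * powR (1 - r ^+ 2) alpha) by ring.
apply: ler_wpM2r; first by rewrite mulr_ge0 ?powR_ge0.
apply: le_trans (ler_wpM2l (powR_ge0 _ _) H1) _.
by rewrite mulrCA; apply: ler_wpM2l => //; exact: powR_ge0.
Qed.

End Sufficiency.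

Section SufficiencyTheorem.
Context {R : realType}.
Implicit Types (f : R[i] -> R[i]) (t x p q u v : R).
Local Notation mu := (@lebesgue_measure R).

(** The common end of the three cases. [W] may be infinite at some points, where the domination is
    trivial, so the estimate is asked for only at finite values [w]. *)
Lemma AT_dominated p q u v alpha beta f (W : R -> \bar R) (C : R) : 0 < C ->
  0 < p -> 0 < q -> 0 < u -> 0 < v ->
  measurable_fun [set: R] W -> (forall t, 1 <= W t)%E ->
  (\int[mu]_(t in `[0%R, (2 * pi)%R]) W t < +oo)%E ->
  AT q alpha p f ->
  (forall t (w : R), 0 <= t <= 2 * pi -> W t = w%:E -> 1 <= w ->
    (poweR (cone_integral f u beta t) (v / u) <=
     C%:E * (w%:E + poweR (cone_integral f q alpha t) (p / q)))%E) ->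
  AT u beta v f.
Proof.
move=> C0 p0 q0 u0 v0 mW W1 Wfin [fa]; rewrite tent_norm_powE => fint H.
split=> //; rewrite tent_norm_powE.
have mI : measurable (`[0%R, (2 * pi)%R] : set (measurableTypeR R)) by exact: measurable_itv.
pose g0 t := poweR (cone_integral f q alpha t) (p / q).
have mg0 : measurable_fun `[0%R, (2 * pi)%R] g0.
  apply: (measurableT_comp (measurable_poweR (p / q))).
  by apply: measurable_funTS; exact: measurable_cone_integral.
have mW' : measurable_fun `[0%R, (2 * pi)%R] W by exact: measurable_funTS.
apply: (@le_lt_trans _ _ (\int[mu]_(t in `[0%R, (2 * pi)%R]) (C%:E * (W t + g0 t)))%E).
  apply: ge0_le_integral_nomeas => t; first by rewrite poweR_ge0.
  rewrite /= in_itv/= => tI.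
  case E : (W t) => [w| |].
  - by apply: H => //; rewrite -lee_fin -E.
  - rewrite addye; last by rewrite gt_eqF// (lt_le_trans _ (poweR_ge0 _ _))// ltNy0.
    by rewrite mulry gtr0_sg// mul1e leey.
  - by have := W1 t; rewrite E.
have W0 t : (0 <= W t)%E by apply: le_trans (W1 t).
rewrite ge0_integralZl//; last 3 first.
- exact: emeasurable_funD.
- by move=> t _; rewrite adde_ge0// poweR_ge0.
- by rewrite lee_fin ltW.
rewrite ge0_integralD//; last by move=> t _; exact: poweR_ge0.
by rewrite lte_mul_pinfty// ?lee_fin ?(ltW C0)// lte_add_pinfty.
Qed.

Theorem AT_sub p q u v alpha beta :
  0 < p -> 0 < q -> 0 < u -> 0 < v -> -2 < alpha -> -2 < beta ->
  (p < v /\ p^-1 - v^-1 + (alpha + 2) / q - (beta + 2) / u <= 0) \/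
  (v <= p /\
   ((alpha + 2) / q - (beta + 2) / u < 0 \/
    ((alpha + 2) / q - (beta + 2) / u = 0 /\ q <= u))) ->
  @AT R q alpha p `<=` AT u beta v.
Proof.
move=> p0 q0 u0 v0 a2 b2 cond f [fa fint].
have [W [K [mW W1 Wint K0 WK]]] := cone_majorant p0 q0 a2 fa fint.
have vu0 : 0 < v / u by rewrite divr_gt0.
have fATf : AT q alpha p f by [].
have g0ge t : (0 <= poweR (cone_integral f q alpha t) (p / q))%E by exact: poweR_ge0.
case: cond => [[pv crit]|[vp [crit|[crit qu]]]].
- have [C C0 HC] := cone_integral_le_lt p0 q0 u0 v0 K0 pv crit.
  apply: (AT_dominated (powR_gt0 (v / u) C0) p0 q0 u0 v0 mW W1 Wint fATf) => t w tI Wt w1.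
  have w0 : 0 < w by apply: lt_le_trans w1.
  apply: (@le_trans _ _ ((powR C (v / u) * w)%:E)).
    have -> : powR C (v / u) * w = powR (C * powR w (u / v)) (v / u).
      rewrite powRM ?powR_ge0 ?(ltW C0)// -powRrM.
      have -> : u / v * (v / u) = 1 by field; rewrite !gt_eqF.
      by rewrite powRr1// ltW.
    rewrite -poweR_EFin; apply: ler_poweR; [exact: ltW|exact: cone_integral_ge0|].
    by apply: HC => // z zc; have [] := WK t z tI zc; rewrite Wt lee_fin; split.
  rewrite EFinM lee_pmul2l ?lte_fin ?powR_gt0//.
  by rewrite leeDl.
- have [C C0 HC] := cone_integral_le_gap p0 q0 u0 crit.
  apply: (AT_dominated (powR_gt0 (v / u) C0) p0 q0 u0 v0 mW W1 Wint fATf) => t w tI Wt w1.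
  have w0 : 0 < w by apply: lt_le_trans w1.
  apply: (@le_trans _ _ ((powR C (v / u) * w)%:E)).
    apply: (@le_trans _ _ (powR (C * powR w (u / p)) (v / u))%:E).
      rewrite -poweR_EFin; apply: ler_poweR; [exact: ltW|exact: cone_integral_ge0|].
      by apply: HC => // z zc; have [] := WK t z tI zc; rewrite Wt lee_fin.
    rewrite lee_fin powRM ?powR_ge0 ?(ltW C0)// -powRrM.
    apply: ler_wpM2l; first exact: powR_ge0.
    rewrite -[leRHS]powRr1 ?(ltW w0)//; apply: ler_powR => //.
    (* The power of [w] is [v / p <= 1], and [w >= 1]. *)
    have -> : u / p * (v / u) = v / p by field; rewrite !gt_eqF.
    by rewrite ler_pdivrMr// mul1r.
  rewrite EFinM lee_pmul2l ?lte_fin ?powR_gt0//.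
  by rewrite leeDl.
- have crit' : (alpha + 2) / q = (beta + 2) / u by apply/eqP; rewrite -subr_eq0 crit.
  have [C C0 HC] := cone_integral_le_eq p0 q0 u0 crit' qu.
  apply: (AT_dominated (powR_gt0 (v / u) C0) p0 q0 u0 v0 mW W1 Wint fATf) => t w tI Wt w1.
  have w0 : 0 < w by apply: lt_le_trans w1.
  have {}Hw : (cone_integral f u beta t <= (C * powR w ((u - q) / p))%:E * cone_integral f q alpha t)%E.
    by apply: HC => // z zc; have [] := WK t z tI zc; rewrite Wt lee_fin.
  have Phi0 := cone_integral_ge0 f q alpha t.
  case E : (cone_integral f q alpha t) => [F| |] in Phi0 Hw *.
  + rewrite poweR_EFin -EFinD -EFinM; rewrite lee_fin in Phi0.
    (* Both [w] and [F^(p/q)] are at most [X], so the product to be estimated is at most a power of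
       [X] with exponent [((u - q)/p + q/p) * v/u = v/p <= 1]. *)
    set X := w + powR F (p / q).
    have wX : w <= X by rewrite lerDl powR_ge0.
    have FX : powR F (p / q) <= X by rewrite lerDr ltW.
    have X1 : 1 <= X by exact: le_trans wX.
    have X0 : 0 < X by exact: lt_le_trans X1.
    apply: (@le_trans _ _ (powR (C * powR w ((u - q) / p) * F) (v / u))%:E).
      rewrite -poweR_EFin; apply: ler_poweR; [exact: ltW|exact: cone_integral_ge0|].
      by rewrite EFinM.
    rewrite lee_fin powRM ?mulr_ge0 ?powR_ge0 ?(ltW C0)// powRM ?powR_ge0 ?(ltW C0)//.
    rewrite -powRrM -mulrA; apply: ler_wpM2l; first exact: powR_ge0.
    have -> : powR F (v / u) = powR (powR F (p / q)) (q / p * (v / u)).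
      by rewrite -powRrM; congr powR; field; rewrite !gt_eqF.
    apply: (@le_trans _ _ (powR X ((u - q) / p * (v / u)) * powR X (q / p * (v / u)))).
      apply: ler_pM; rewrite ?powR_ge0//; apply: ler_powR2 => //; rewrite ?powR_ge0//.
      - by rewrite mulr_ge0// ?(ltW vu0)// divr_ge0 ?subr_ge0// ltW.
      - by rewrite ltW.
      - by rewrite mulr_ge0// ?(ltW vu0)// divr_ge0 ?ltW.
    rewrite -powRD; last by apply/implyP => _; rewrite gt_eqF.
    rewrite -[leRHS]powRr1 ?(ltW X0)//; apply: ler_powR => //.
    have -> : (u - q) / p * (v / u) + q / p * (v / u) = v / p by field; rewrite !gt_eqF.
    by rewrite ler_pdivrMr// mul1r.
  + rewrite poweRyr ?gt_eqF ?divr_gt0// addey//.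
    by rewrite mulry gtr0_sg ?powR_gt0// mul1e leey.
  + by [].
Qed.

End SufficiencyTheorem.

(** * Complex series and powers *)

Section ComplexSeries.
Context {R : realType}.
Implicit Types (c d : nat -> R[i]) (z h : R[i]).

Definition csum c : R[i] :=
  Complex (limn (series (fun k => Re (c k)))) (limn (series (fun k => Im (c k)))).

Lemma bounded_series_cvg (s : nat -> R) (B : R) :
  (forall n, \sum_(0 <= k < n) `|s k| <= B) -> cvgn (series s).
Proof.
move=> sB; apply: normed_cvg; apply: nondecreasing_is_cvgn.
  by apply: nondecreasing_series => n _ _; exact: normr_ge0.
by exists B => _ [n _ <-]; exact: sB.
Qed.

Lemma Re_sum (I : Type) (r : seq I) (F : I -> R[i]) : Re (\sum_(i <- r) F i) = \sum_(i <- r) Re (F i).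
Proof. exact: raddf_sum. Qed.

Lemma Im_sum (I : Type) (r : seq I) (F : I -> R[i]) : Im (\sum_(i <- r) F i) = \sum_(i <- r) Im (F i).
Proof. exact: raddf_sum. Qed.

Lemma ler_normc_sum c m n : normc (\sum_(m <= k < n) c k) <= \sum_(m <= k < n) normc (c k).
Proof.
apply: (big_ind2 (fun (x : R[i]) (y : R) => normc x <= y)) => //; first by rewrite normc0.
by move=> x1 x2 y1 y2 H1 H2; apply: le_trans (ler_normcD _ _) _; exact: lerD.
Qed.

Lemma csum_cvg c B : (forall n, \sum_(0 <= k < n) normc (c k) <= B) ->
  forall e : R, 0 < e -> \forall n \near \oo, normc (\sum_(0 <= k < n) c k - csum c) < e.
Proof.
move=> cB e e0; have e2 : 0 < e / 2 by rewrite divr_gt0.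
have cRe : cvgn (series (fun k => Re (c k))).
  apply: (@bounded_series_cvg _ B) => n; apply: le_trans (cB n).
  by apply: ler_sum => k _; exact: ler_Re_normc.
have cIm : cvgn (series (fun k => Im (c k))).
  apply: (@bounded_series_cvg _ B) => n; apply: le_trans (cB n).
  by apply: ler_sum => k _; exact: ler_Im_normc.
move/cvgrPdist_lt: cRe => /(_ _ e2) cRe; move/cvgrPdist_lt: cIm => /(_ _ e2) cIm.
near=> n; apply: le_lt_trans (ler_normc_ReIm _) _.
rewrite [ltRHS](splitr e); apply: ltrD.
  have : `|limn (series (fun k => Re (c k))) - series (fun k => Re (c k)) n| < e / 2 by near: n.
  by rewrite distrC raddfB/= Re_sum.
have : `|limn (series (fun k => Im (c k))) - series (fun k => Im (c k)) n| < e / 2 by near: n.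
by rewrite distrC raddfB/= Im_sum.
Unshelve. all: by end_near. Qed.

Lemma csum_tail c B (m : nat) (T : R) : (forall n, \sum_(0 <= k < n) normc (c k) <= B) ->
  (forall n, \sum_(m <= k < n) normc (c k) <= T) ->
  normc (csum c - \sum_(0 <= k < m) c k) <= T.
Proof.
move=> cB cT; apply/ler_addgt0Pr => e e0.
have [N _ HN] := csum_cvg cB e0.
have /= H := HN (N + m)%N (leq_addr _ _); rewrite normc_dist in H.
set S := \sum_(0 <= k < N + m) c k in H *; set S0 := \sum_(0 <= k < m) c k.
have -> : csum c - S0 = (S - S0) + (csum c - S) by ring.
apply: le_trans (ler_normcD _ _) _; apply: lerD; last exact: ltW.
have -> : S - S0 = \sum_(m <= k < N + m) c k.
  by rewrite /S (@big_cat_nat _ _ _ m 0 (N + m))//= ?leq_addl// addrAC subrr add0r.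
exact: le_trans (ler_normc_sum _ _ _) (cT _).
Qed.

(** Termwise differentiation through second-order remainders: their constants [M k] have bounded
    partial sums, so the increment of the sum differs from its linear part by at most
    [B * normc h ^+ 2]. *)
Lemma csum_cderive (g : nat -> R[i] -> R[i]) d z (r : R) (M : nat -> R) (B : R) : 0 < r ->
  (forall k, 0 <= M k) ->
  (forall k h, normc h < r -> normc (g k (z + h) - g k z - h * d k) <= M k * normc h ^+ 2) ->
  (forall n, \sum_(0 <= k < n) M k <= B) ->
  (forall n, \sum_(0 <= k < n) normc (d k) <= B) ->
  (forall h, normc h < r -> forall n, \sum_(0 <= k < n) normc (g k (z + h)) <= B) ->
  is_cderive (fun w => csum (fun k => g k w)) z (csum d).
Proof.
move=> r0 M0 gM MB dB gB e e0.
have B0 : 0 <= B by have := MB 0%N; rewrite big_geq.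
have B1 : 0 < B + 1 by rewrite ltr_wpDl.
have gB0 n : \sum_(0 <= k < n) normc (g k z) <= B.
  by have := gB 0; rewrite normc0 addr0; exact.
exists (Num.min r (e / (B + 1))); first by rewrite lt_min r0 divr_gt0.
move=> h; rewrite lt_min => /andP[hr he].
have h0 := normc_ge0 h.
apply: (@le_trans _ _ (B * normc h ^+ 2)); last first.
  rewrite expr2 mulrA; apply: ler_wpM2r => //.
  move: he; rewrite ltr_pdivlMr// => he; apply: ltW; apply: le_lt_trans he.
  by rewrite mulrC; apply: ler_wpM2l => //; rewrite lerDl.
apply/ler_addgt0Pr => x x0.
(* Three infinite sums are replaced by partial sums up to [y] each, the one of the derivatives being
   multiplied by [h]; the total error is [x]. *)
pose y := x / (2 + normc h); have hh : 0 < 2 + normc h by rewrite ltr_wpDr.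
have y0 : 0 < y by rewrite divr_gt0.
have [N1 _ H1] := csum_cvg (gB h hr) y0.
have [N2 _ H2] := csum_cvg gB0 y0.
have [N3 _ H3] := csum_cvg dB y0.
pose n := (N1 + N2 + N3)%N.
have {}H1 := H1 n _; have {}H2 := H2 n _; have {}H3 := H3 n _.
move: H1 => /(_ (leq_trans (leq_addr _ _) (leq_addr _ _))).
move: H2 => /(_ (leq_trans (leq_addl _ _) (leq_addr _ _))).
move: H3 => /(_ (leq_addl _ _)).
set F1 := csum (fun k => g k (z + h)); set F0 := csum (fun k => g k z); set F' := csum d.
set S1 := \sum_(0 <= k < n) g k (z + h); set S0 := \sum_(0 <= k < n) g k z.
set S' := \sum_(0 <= k < n) d k => H3 H2; rewrite normc_dist => H1.
have HS : normc (S1 - S0 - h * S') <= B * normc h ^+ 2.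
  rewrite /S1 /S0 /S' mulr_sumr -!sumrB.
  apply: le_trans (ler_normc_sum _ _ _) _.
  apply: le_trans (ler_sum _ (fun k _ => gM k h hr)) _.
  by rewrite -mulr_suml; apply: ler_wpM2r => //; rewrite exprn_ge0.
have -> : F1 - F0 - h * F' = (F1 - S1) + ((S0 - F0) + (h * (S' - F') + (S1 - S0 - h * S'))) by ring.
have xE : x = y + (y + normc h * y) by rewrite /y; field; rewrite gt_eqF.
have T1 := ler_normcD (F1 - S1) ((S0 - F0) + (h * (S' - F') + (S1 - S0 - h * S'))).
have T2 := ler_normcD (S0 - F0) (h * (S' - F') + (S1 - S0 - h * S')).
have T3 := ler_normcD (h * (S' - F')) (S1 - S0 - h * S').
have T4 : normc (h * (S' - F')) <= normc h * y by rewrite normcM; apply: ler_wpM2l => //; exact: ltW.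
by move: T1 T2 T3 T4 HS H1 H2 xE; clear; lra.
Qed.

End ComplexSeries.

(** * Exponential, logarithm and powers on the right half-plane *)

Section ComplexPower.
Context {R : realType}.
Implicit Types (z w h : R[i]) (x y c : R).

Lemma is_derive_first_order (F : R -> R) x d : is_derive x (1 : R) F d ->
  forall e : R, 0 < e -> exists2 r : R, 0 < r &
    forall s, `|s| < r -> `|F (x + s) - F x - s * d| <= e * `|s|.
Proof.
move=> [dF dE] e e0; have /eqaddoP/(_ _ e0)/nbhs_ballP[r /= r0 H] := derivable_nbhs dF.
exists r => // s sr; have /H : ball (0 : R) r s by rewrite /ball /= sub0r normrN.
rewrite dE /= -![(_ + _ : _ -> _) _]/(_ + _) -![(- _ : _ -> _) _]/(- _) /=.
have -> : s%:A + x = x + s by rewrite [s%:A]mulr1 addrC.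
by rewrite opprD addrA.
Qed.

Definition cexp z : R[i] := (expR (Re z))%:C%C * circ (Im z).
(** The principal logarithm on the right half-plane only, where the argument is the arctangent of
    the slope. It will be taken at [1 + z] with [|z| < 1]. *)
Definition clog w : R[i] := Complex (ln (normc w)) (atan (Im w / Re w)).
Definition cpow w c : R[i] := cexp (c%:C%C * clog w).

Lemma cexpD z w : cexp (z + w) = cexp z * cexp w.
Proof.
rewrite /cexp !raddfD/= expRD circD.
by apply/eqP; rewrite eq_complex /=; apply/andP; split; apply/eqP; ring.
Qed.

Lemma normc_cpow w c : w != 0 -> normc (cpow w c) = powR (normc w) c.
Proof.
move=> w0; have n0 : 0 < normc w by rewrite normc_gt0.
rewrite /cpow /cexp normcM normc_circ mulr1 normc_real ger0_norm ?expR_ge0//.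
by rewrite /powR gt_eqF//= mul0r subr0.
Qed.

Lemma cexp_clog w : 0 < Re w -> cexp (clog w) = w.
Proof.
case: w => x y /= x0; have n0 : 0 < normc (Complex x y).
  by rewrite normc_gt0; apply/eqP => -[] H _; move: x0; rewrite H ltxx.
rewrite /cexp /clog /circ /= lnK ?posrE//.
have nE : Num.sqrt (x ^+ 2 + y ^+ 2) = x * Num.sqrt (1 + (y / x) ^+ 2).
  have -> : x ^+ 2 + y ^+ 2 = x ^+ 2 * (1 + (y / x) ^+ 2) by field; rewrite gt_eqF.
  by rewrite sqrtrM ?sqr_ge0// sqrtr_sqr gtr0_norm.
set s := Num.sqrt (1 + _) in nE.
have s0 : 0 < s by rewrite sqrtr_gt0 ltr_pwDl// sqr_ge0.
have c : cos (atan (y / x)) = s^-1 by exact: cos_atan.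
have si : sin (atan (y / x)) = (y / x) * s^-1.
  by rewrite -{2}(atanK (y / x)) /tan c mulrVK// unitfE invr_eq0 gt_eqF.
rewrite c si nE; apply/eqP; rewrite eq_complex /=.
by apply/andP; split; apply/eqP; field; rewrite ?gt_eqF.
Qed.

Lemma continuous_clog w : 0 < Re w -> forall e : R, 0 < e -> exists2 r : R, 0 < r &
  forall h, normc h < r -> normc (clog (w + h) - clog w) < e.
Proof.
move=> x0 e e0; have n0 : 0 < normc w.
  by rewrite normc_gt0; apply/eqP => H; move: x0; rewrite H /= ltxx.
have e2 : 0 < e / 2 by rewrite divr_gt0.
have /cvgrPdist_lt /(_ _ e2) /nbhs_ballP[r1 r10 H1] := continuous_ln n0; rewrite /= in r10.
set x := Re w in x0 *; set y := Im w.
pose K := 2 * (x + `|y|) / x ^+ 2.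
have K0 : 0 < K by rewrite divr_gt0 ?exprn_gt0// mulr_gt0// ltr_pwDl.
exists (Num.min r1 (Num.min (x / 2) (e / 2 / K))).
  by rewrite !lt_min r10 divr_gt0//= divr_gt0.
move=> h; rewrite !lt_min => /and3P[hr1 hx hK].
apply: le_lt_trans (ler_normc_ReIm _) _; rewrite [ltRHS](splitr e); apply: ltrD.
  rewrite /clog [X in `|X|]/= distrC; apply: H1; rewrite /ball.
  apply: le_lt_trans hr1; rewrite ler_norml.
  have := lerB_normc (w + h) w; have := lerB_normc w (w + h).
  by rewrite opprD addNKr normc_opp addrAC subrr add0r; clear; lra.
apply: (@le_lt_trans _ _ (K * normc h)); last by rewrite mulrC -ltr_pdivlMr.
have Hh := ler_Re_normc h; have Ih := ler_Im_normc h.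
rewrite /clog [X in `|X|]/= !raddfD -/x -/y.
set j := Re h in Hh *; set k := Im h in Ih *; set n := normc h in hx Hh Ih *.
rename Hh into Hj; rename Ih into Hk.
have xj : x / 2 < x + j by move: Hj; rewrite ler_norml; move: hx; clear; lra.
have xj0 : 0 < x + j by apply: lt_trans xj; rewrite divr_gt0.
apply: le_trans (dist_atan_le _ _) _.
have -> : (y + k) / (x + j) - y / x = (k * x - y * j) / (x * (x + j)).
  by field; rewrite !gt_eqF.
rewrite normrM normfV (gtr0_norm (mulr_gt0 x0 xj0)) ler_pdivrMr ?mulr_gt0//.
have num : `|k * x - y * j| <= (x + `|y|) * n.
  apply: le_trans (ler_normB _ _) _; rewrite !normrM (gtr0_norm x0) mulrDl mulrC.
  by apply: lerD; apply: ler_wpM2l => //; exact: ltW.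
apply: le_trans num _.
have n0' : 0 <= n by exact: normc_ge0.
have xy0 : 0 <= x + `|y| by rewrite addr_ge0// ltW.
have -> : K * n * (x * (x + j)) = (x + `|y|) * n * (2 * (x + j) / x).
  by rewrite /K; field; rewrite gt_eqF.
rewrite -[leLHS]mulr1; apply: ler_wpM2l; first exact: mulr_ge0.
by rewrite ler_pdivlMr// mul1r; move: xj; clear; lra.
Qed.

Lemma cexp_first_order (e : R) : 0 < e -> exists2 r : R, 0 < r &
  forall h, normc h < r -> normc (cexp h - 1 - h) <= e * normc h.
Proof.
move=> e0; pose e' := Num.min 1 (e / 10).
have e'0 : 0 < e' by rewrite lt_min ltr01 divr_gt0.
have e'1 : e' <= 1 by rewrite ge_min lexx.
have e'e : e' <= e / 10 by rewrite ge_min lexx orbT.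
have ReE z : Re (cexp z - 1 - z) = (expR (Re z) - 1 - Re z) + expR (Re z) * (cos (Im z) - 1).
  by case: z => a b; rewrite /cexp /circ /=; ring.
have ImE z : Im (cexp z - 1 - z) = (expR (Re z) - 1) * sin (Im z) + (sin (Im z) - Im z).
  by case: z => a b; rewrite /cexp /circ /=; ring.
have [r1 r10 H1] := is_derive_first_order (is_derive_expR 0) e'0.
have [r2 r20 H2] := is_derive_first_order (is_derive_cos 0) e'0.
have [r3 r30 H3] := is_derive_first_order (is_derive_sin 0) e'0.
exists (Num.min (Num.min r1 1) (Num.min (Num.min r2 r3) (e / 8))).
  by rewrite !lt_min r10 r20 r30 ltr01 divr_gt0.
move=> h; rewrite !lt_min => /and3P[/andP[hr1 h1] /andP[hr2 hr3] h8].
have Hx := ler_Re_normc h; have Hy := ler_Im_normc h.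
set x := Re h in Hx *; set y := Im h in Hy *; set n := normc h in hr1 h1 hr2 hr3 h8 Hx Hy *.
have := H1 x (le_lt_trans Hx hr1); rewrite add0r expR0 mulr1 => {}H1.
have := H2 y (le_lt_trans Hy hr2); rewrite add0r cos0 sin0 oppr0 mulr0 subr0 => {}H2.
have := H3 y (le_lt_trans Hy hr3); rewrite add0r cos0 sin0 mulr1 subr0 => {}H3.
have n0 : 0 <= n by exact: normc_ge0.
have en : e' * n <= e / 10 * n by apply: ler_wpM2r.
have en1 : e' * n <= n by rewrite -[leRHS]mul1r; apply: ler_wpM2r.
have ex : e' * `|x| <= e' * n by apply: ler_wpM2l => //; exact: ltW.
have ey : e' * `|y| <= e' * n by apply: ler_wpM2l => //; exact: ltW.
have E1 : `|expR x - 1| <= 2 * n.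
  have -> : expR x - 1 = (expR x - 1 - x) + x by ring.
  by apply: le_trans (ler_normD _ _) _; move: H1 ex en1 Hx; clear; lra.
have E2 : `|expR x| <= 3.
  have -> : expR x = (expR x - 1) + 1 by ring.
  by apply: le_trans (ler_normD _ _) _; rewrite normr1; move: E1 h1; clear; lra.
have E3 : `|sin y| <= 2 * n.
  have -> : sin y = (sin y - y) + y by ring.
  by apply: le_trans (ler_normD _ _) _; move: H3 ey en1 Hy; clear; lra.
apply: le_trans (ler_normc_ReIm _) _.
rewrite ReE -/x -/y ImE -/x -/y.
have T1 := ler_normD (expR x - 1 - x) (expR x * (cos y - 1)).
have T2 := ler_normD ((expR x - 1) * sin y) (sin y - y).
have T3 : `|expR x * (cos y - 1)| <= 3 * (e' * n).
  by rewrite normrM; apply: ler_pM => //; exact: le_trans ey.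
have T4 : `|(expR x - 1) * sin y| <= e / 2 * n.
  rewrite normrM; apply: (@le_trans _ _ (2 * n * (2 * n))); first exact: ler_pM.
  by rewrite mulrA; apply: ler_wpM2r => //; move: h8; clear; lra.
by move: T1 T2 T3 T4 H1 H3 ex ey en; clear; lra.
Qed.

(** The derivative of an inverse function: [l = clog (w + h) - clog w] satisfies
    [h / w = cexp l - 1]. Continuity makes [l] small, the expansion of [cexp] at [0] gives [l] up to
    [e' * normc l], and [e' <= 1/2] yields [normc l <= 2 * normc (h / w)]. *)
Lemma clog_first_order w : 0 < Re w -> forall e : R, 0 < e -> exists2 r : R, 0 < r &
  forall h, normc h < r -> normc (clog (w + h) - clog w - h / w) <= e * normc h.
Proof.
move=> w0 e e0.
have n0 : 0 < normc w.
  by rewrite normc_gt0; apply/eqP => H; move: w0; rewrite H /= ltxx.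
have wn0 : w != 0 by rewrite -normc_gt0.
pose e' := Num.min 2^-1 (e * normc w / 2).
have e'0 : 0 < e' by rewrite lt_min invr_gt0 ltr0n divr_gt0// mulr_gt0.
have e'1 : e' <= 2^-1 by rewrite ge_min lexx.
have e'e : e' <= e * normc w / 2 by rewrite ge_min lexx orbT.
have [r1 r10 H1] := cexp_first_order e'0.
have [r2 r20 H2] := continuous_clog w0 r10.
exists (Num.min r2 (Re w)); first by rewrite lt_min r20.
move=> h; rewrite lt_min => /andP[/H2 hr2 hw].
have whr : 0 < Re (w + h).
  rewrite raddfD/=; have := ler_Re_normc h; rewrite ler_norml.
  by move: hw; clear; lra.
set l := clog (w + h) - clog w in hr2 *.
have hE : h / w = cexp l - 1.
  have : cexp (clog (w + h)) = w + h by exact: cexp_clog.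
  have -> : clog (w + h) = clog w + l by rewrite /l; ring.
  rewrite cexpD (cexp_clog w0) => H.
  have -> : h = w * cexp l - w by rewrite H; ring.
  by field.
have := H1 _ hr2; rewrite -hE => H.
have l2 : normc l <= 2 * normc (h / w).
  have := lerB_normc l (h / w); rewrite normc_dist.
  have : e' * normc l <= 2^-1 * normc l by apply: ler_wpM2r => //; exact: normc_ge0.
  by move: H; clear; lra.
rewrite normc_dist; apply: le_trans H _.
apply: le_trans (ler_wpM2l (ltW e'0) l2) _.
rewrite normcM normcV.
have -> : e' * (2 * (normc h * (normc w)^-1)) = e' * 2 / normc w * normc h by ring.
apply: ler_wpM2r; first exact: normc_ge0.
by rewrite ler_pdivrMr//; move: e'e; clear; lra.
Qed.

(** The chain rule made explicit: with [l] the increment of [clog], the power is multiplied by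
    [cexp (C * l)]. The tolerances [e1] for the exponential and [e2] for the logarithm each cost
    half of [e]. *)
Lemma cpow_cderive w c : 0 < Re w -> is_cderive (fun z => cpow z c) w (cpow w c * c%:C%C / w).
Proof.
move=> w0 e e0; set L := cpow w c; set C := c%:C%C.
have nL0 : 0 < normc L + 1 by rewrite ltr_wpDl ?normc_ge0.
have nC0 : 0 < normc C + 1 by rewrite ltr_wpDl ?normc_ge0.
pose K := normc w^-1 + 1; have K0 : 0 < K by rewrite ltr_wpDl ?normc_ge0.
pose e1 := e / (2 * (normc L + 1) * ((normc C + 1) * K)).
have e10 : 0 < e1 by rewrite divr_gt0// mulr_gt0 ?mulr_gt0.
pose e2 := Num.min 1 (e / (2 * (normc L + 1) * (normc C + 1))).
have e20 : 0 < e2 by rewrite lt_min ltr01 divr_gt0// mulr_gt0 ?mulr_gt0.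
have e21 : e2 <= 1 by rewrite ge_min lexx.
have e2e : e2 <= e / (2 * (normc L + 1) * (normc C + 1)) by rewrite ge_min lexx orbT.
have [r1 r10 H1] := cexp_first_order e10.
have [r2 r20 H2] := clog_first_order w0 e20.
have CK : 0 < (normc C + 1) * K by rewrite mulr_gt0.
exists (Num.min r2 (r1 / ((normc C + 1) * K))); first by rewrite lt_min r20 divr_gt0.
move=> h; rewrite lt_min ltr_pdivlMr// => /andP[/H2 {}H2 hr].
set l := clog (w + h) - clog w in H2.
have n0 := normc_ge0 h.
have l1 : normc l <= K * normc h.
  rewrite -(subrK (h / w) l); apply: le_trans (ler_normcD _ _) _.
  rewrite normcM mulrDl mul1r addrC (mulrC (normc h)) lerD2l.
  by apply: le_trans H2 _; rewrite -[leRHS]mul1r; apply: ler_wpM2r.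
have Cl : normc (C * l) <= (normc C + 1) * K * normc h.
  rewrite normcM -mulrA; apply: ler_pM => //; rewrite ?normc_ge0//.
  by rewrite lerDl.
have lr : normc (C * l) < r1 by apply: le_lt_trans Cl _; rewrite mulrC.
have {}H1 := H1 _ lr.
have -> : cpow (w + h) c = L * cexp (C * l).
  by rewrite /L /cpow -cexpD -mulrDr; congr (cexp (_ * _)); rewrite /l; ring.
have -> : L * cexp (C * l) - L - h * (L * C / w) =
    L * ((cexp (C * l) - 1 - C * l) + C * (l - h / w)) by ring.
rewrite normcM.
apply: (@le_trans _ _ ((normc L + 1) * (e1 * ((normc C + 1) * K * normc h) + (normc C + 1) * (e2 * normc h)))).
  apply: ler_pM; rewrite ?normc_ge0 ?lerDl//.
  apply: le_trans (ler_normcD _ _) _; apply: lerD.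
    by apply: le_trans H1 _; apply: ler_wpM2l => //; exact: ltW.
  by rewrite normcM; apply: ler_pM; rewrite ?normc_ge0 ?lerDl.
have -> : e1 * ((normc C + 1) * K * normc h) = e / (2 * (normc L + 1)) * normc h.
  by rewrite /e1; field; rewrite !gt_eqF.
have E2 : (normc C + 1) * (e2 * normc h) <= e / (2 * (normc L + 1)) * normc h.
  rewrite mulrA; apply: ler_wpM2r => //; rewrite mulrC -ler_pdivlMr//.
  by apply: le_trans e2e _; rewrite invfM mulrA.
have -> : e * normc h = (normc L + 1) * (e / (2 * (normc L + 1)) * normc h + e / (2 * (normc L + 1)) * normc h).
  by field; rewrite gt_eqF.
by apply: ler_wpM2l; [exact: ltW|rewrite lerD2l].
Qed.

End ComplexPower.

(** * The two counterexamples *)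

Section PowerIntegrals.
Context {R : realType}.
Implicit Types (t x c r : R).
Local Notation mu := (@lebesgue_measure R).

Lemma nneseries_const_pinfty (s : nat -> R) c : 0 < c -> (forall k, c <= s k) ->
  (\sum_(0 <= k <oo) (s k)%:E = +oo)%E.
Proof.
move=> c0 cs; apply/eqyP => A A0.
have s0 k : 0 <= s k by apply: le_trans (cs k); exact: ltW.
have [N HN] := exp2_gt (A / c).
have [n nA] : exists n : nat, A / c <= n%:R.
  by exists (2 ^ N)%N; rewrite natrX; exact: ltW.
apply: le_trans (nneseries_lim_ge n _); last by move=> k _ _; rewrite lee_fin.
rewrite sumEFin lee_fin; apply: (@le_trans _ _ (\sum_(0 <= k < n) c)).
  by rewrite sumr_const_nat subn0 -mulr_natr mulrC -ler_pdivrMr.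
by apply: ler_sum => k _.
Qed.

(** On the shell [|t - x0| ~ 4 * 2^-k] the function is of size [2^(k r)] and the interval of length
    [8 * 2^-k], so the shells form a geometric series of ratio [2^(r-1)]. The radius [4] suits
    [|t - pi| <= pi]. *)
Lemma integral_dist_powR_lt (D : set (measurableTypeR R)) (g : R -> \bar R) x0 c r : measurable D ->
  0 < c -> 0 <= r -> r < 1 -> (forall t, D t -> `|t - x0| <= 4) ->
  (forall t, D t -> 0 <= g t)%E ->
  (forall t, D t -> t != x0 -> (g t <= (c * powR `|t - x0| (- r))%:E)%E) ->
  (\int[mu]_(t in D) g t < +oo)%E.
Proof.
move=> mD c0 r0 r1 D4 g0 gc.
pose J k := `[x0 - 4 * 2^-1 ^+ k, x0 + 4 * 2^-1 ^+ k]%classic : set R.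
pose a k := c * powR 4 (- r) * powR 2 r ^+ k.+1.
have c2 : (0 : R) < 2^-1 by rewrite invr_gt0.
have a0 k : 0 < a k by rewrite mulr_gt0 ?mulr_gt0 ?exprn_gt0 ?powR_gt0// ltr0n.
have JE k t : J k t <-> `|t - x0| <= 4 * 2^-1 ^+ k.
  rewrite /J /= in_itv/= ler_norml; split.
    by move=> /andP[]; clear; lra.
  by move=> /andP[H1 H2]; apply/andP; move: H1 H2; clear; split; lra.
have muJ k : mu (J k) = (8 * 2^-1 ^+ k)%:E.
  rewrite lebesgue_measure_itv/= lte_fin.
  have h : 0 < 4 * 2^-1 ^+ k :> R by rewrite mulr_gt0 ?exprn_gt0 ?ltr0n.
  rewrite ltrBlDr -addrA ltrDl addr_gt0//; congr EFin.
  by ring.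
have mJ k : measurable (J k : set (measurableTypeR R)) by exact: measurable_itv.
apply: (@le_lt_trans _ _ (\int[mu]_(t in D) (\sum_(0 <= k <oo) (a k * \1_(J k) t)%:E))%E).
  apply: ge0_le_integral_nomeas => // t Dt.
  (* At [x0] nothing is assumed on the size of [g]; all intervals contain [x0], so the majorant is
     [+oo] there. *)
  have [->|tx] := eqVneq t x0.
    rewrite (@nneseries_const_pinfty _ (a 0%N)) ?leey// => k.
    rewrite indicE mem_set; last by apply/JE; rewrite subrr normr0 mulr_ge0// exprn_ge0// ltW.
    rewrite mulr1; apply: ler_wpM2l; first by rewrite mulr_ge0 ?powR_ge0// ltW.
    apply: ler_weXn2l => //.
    by have := @ler_powR2 R 1 2 r r0 ler01; rewrite powR1; apply; rewrite ler1n.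
  have d0 : 0 < `|t - x0| by rewrite normr_gt0 subr_eq0.
  have y0 : 0 < `|t - x0| / 4 by rewrite divr_gt0.
  have y1 : `|t - x0| / 4 <= 1 by rewrite ler_pdivrMr// mul1r; exact: D4.
  have [k /andP[k1 k2]] := shell_exists c2 (lexx _) y0 y1.
  apply: le_trans (gc t Dt tx) _.
  apply: le_trans (nneseries_lim_ge k.+1 _); last first.
    by move=> i _ _; rewrite lee_fin mulr_ge0// ltW.
  rewrite big_nat_recr//=; apply: (@le_trans _ _ (a k * \1_(J k) t)%:E); last first.
    rewrite leeDr//; apply: sume_ge0 => i _.
    by rewrite lee_fin mulr_ge0// ltW.
  rewrite indicE mem_set; last by apply/JE; rewrite mulrC -ler_pdivrMr.
  rewrite mulr1 lee_fin /a -mulrA; apply: ler_wpM2l; first exact: ltW.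
  have {1}-> : `|t - x0| = 4 * (`|t - x0| / 4) by field.
  rewrite powRM ?(ltW y0)//; apply: ler_wpM2l; first exact: powR_ge0.
  have -> : powR 2 r ^+ k.+1 = powR (2^-1 ^+ k.+1) (- r).
    by rewrite -powR_exprn ?(ltW c2)// (@powR_inv R 2)// opprK.
  rewrite !powRN lef_pV2 ?posrE ?powR_gt0 ?exprn_gt0//.
  by apply: ler_powR2; [by []|apply/exprn_ge0; exact: ltW|exact: ltW].
rewrite integral_nneseries//; last 2 first.
- move=> k; apply/measurable_EFinP; apply: measurable_funM => //.
- by move=> k t _; rewrite lee_fin mulr_ge0// ltW.
pose y := powR 2 (r - 1).
have y1 : y < 1 by rewrite /y -opprB; apply: powRN_lt1; rewrite ?ltr1n// subr_gt0.
have y0 : 0 <= y by exact: powR_ge0.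
apply: (@le_lt_trans _ _ (c * powR 4 (- r) * powR 2 r * 8 / (1 - y))%:E); last by rewrite ltry.
have K0 : 0 <= c * powR 4 (- r) * powR 2 r * 8 by rewrite !mulr_ge0 ?powR_ge0// ltW.
apply: (@le_trans _ _ (\sum_(0 <= k <oo) (c * powR 4 (- r) * powR 2 r * 8 * y ^+ k)%:E)%E).
  apply: lee_nneseries => [k _ _|k _].
    by apply: integral_ge0 => t _; rewrite lee_fin mulr_ge0// ltW.
  under eq_integral do rewrite EFinM.
  rewrite ge0_integralZl//; last 2 first.
  - by apply/measurable_EFinP; exact: measurable_indic.
  - by rewrite lee_fin ltW.
  rewrite integral_indic; [|by []|exact: mJ].
  apply: (@le_trans _ _ ((a k)%:E * mu (J k))%E).
    apply: lee_wpmul2l; first by rewrite lee_fin ltW.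
    by apply: le_measure; rewrite ?inE//; exact: measurableI.
  rewrite muJ -EFinM lee_fin /a /y powRD; last by apply/implyP => _; rewrite gt_eqF.
  rewrite -(@powR_inv R 2)// powRr1 ?(ltW c2)// exprMn exprS le_eqVlt; apply/orP; left; apply/eqP; ring.
apply: nneseries_le_real => [k|n]; first by rewrite mulr_ge0// exprn_ge0.
by rewrite -mulr_sumr; apply: ler_wpM2l => //; exact: geometric_sum_lt1.
Qed.

(** The step functions [G n] stay below [1 / (x0 - t)] to the left of [x0], and each of their [n]
    terms has integral [1/2]. *)
Lemma integral_dist_inv_pinfty (a b : R) (g : R -> \bar R) x0 c :
  a <= x0 - 2^-1 -> x0 <= b -> 0 < c -> (forall t, a <= t <= b -> (0 <= g t)%E) ->
  (forall t, 0 < x0 - t -> x0 - t < 2^-1 -> ((c / (x0 - t))%:E <= g t)%E) ->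
  (\int[mu]_(t in `[a, b]) g t = +oo)%E.
Proof.
move=> ax xb c0 g0 gc; apply/eqyP => A A0.
pose J k := `]x0 - 2^-1 ^+ k.+1, x0[%classic : set R.
have c2 : (0 : R) < 2^-1 by rewrite invr_gt0.
have ck k : (0 : R) < 2^-1 ^+ k by rewrite exprn_gt0.
have mJ k : measurable (J k : set (measurableTypeR R)) by exact: measurable_itv.
have muJ k : mu (J k) = (2^-1 ^+ k.+1)%:E.
  rewrite lebesgue_measure_itv/= lte_fin ltrBlDr ltrDl ck -EFinB; congr EFin; ring.
have JE k t : J k t <-> 0 < x0 - t /\ x0 - t < 2^-1 ^+ k.+1.
  rewrite /J /= in_itv/=; split; first by move=> /andP[]; clear; lra.
  by move=> [H1 H2]; apply/andP; move: H1 H2; clear; split; lra.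
pose G (n : nat) t : R := \sum_(0 <= k < n) 2 ^+ k * \1_(J k) t.
have G0 n t : 0 <= G n t by apply: sumr_ge0 => k _; rewrite mulr_ge0// exprn_ge0.
have G2 n t : G n t <= 2 ^+ n.
  elim: n => [|n IH]; first by rewrite /G big_geq// expr0.
  rewrite /G big_nat_recr//= -/(G n t) exprS mulr2n mulrDl mul1r; apply: lerD => //.
  by rewrite -[leRHS]mulr1 ler_wpM2l ?exprn_ge0// indicE lern1 leq_b1.
(* If [t] lies in the last interval [J n], then the trivial bound [2^(n+1)] is below [1 / (x0 - t)];
   otherwise the last term vanishes. *)
have Gd n t : 0 < x0 - t -> G n t <= (x0 - t)^-1.
  move=> d0; elim: n => [|n IH]; first by rewrite /G big_geq// invr_ge0 ltW.
  have [Jt|Jt] := pselect (J n t).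
    apply: le_trans (G2 n.+1 t) _; have [_ H] := (JE n t).1 Jt.
    by rewrite -[leLHS]invrK lef_pV2 ?posrE ?invr_gt0 ?exprn_gt0// -exprVn ltW.
  by rewrite /G big_nat_recr//= indicE memNset// mulr0 addr0.
have Gz n t : ~ (0 < x0 - t /\ x0 - t < 2^-1) -> G n t = 0.
  move=> H; rewrite /G big1// => k _; rewrite indicE memNset ?mulr0// => /JE[H1 H2].
  apply: H; split => //; apply: lt_le_trans H2 _.
  by rewrite exprS -[leRHS]mulr1; apply: ler_wpM2l; [exact: ltW|apply: exprn_ile1; lra].
have [n nA] : exists n : nat, A / (c / 2) <= n%:R.
  have [N HN] := exp2_gt (A / (c / 2)).
  by exists (2 ^ N)%N; rewrite natrX; exact: ltW.
apply: (@le_trans _ _ (\int[mu]_(t in `[a, b]) (c * G n t)%:E)%E); last first.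
  apply: ge0_le_integral_nomeas => t; rewrite /= in_itv/= => tI.
    by rewrite lee_fin mulr_ge0// ltW.
  have [[H1 H2]|H] := pselect (0 < x0 - t /\ x0 - t < 2^-1).
    apply: le_trans (gc t H1 H2); rewrite lee_fin; apply: ler_wpM2l; [exact: ltW|exact: Gd].
  by rewrite Gz// mulr0; exact: g0.
have mI k : measurable_fun (`[a, b] : set (measurableTypeR R)) (\1_(J k) : R -> R).
  by exact: measurable_indic.
have E t : (c * G n t)%:E = (\sum_(0 <= k < n) (c * 2 ^+ k)%:E * (\1_(J k) t)%:E)%E.
  rewrite /G mulr_sumr -sumEFin; apply: eq_bigr => k _.
  by rewrite -EFinM mulrA.
under eq_integral do rewrite E.
have ck0 k : (0 <= (c * 2 ^+ k)%:E)%E by rewrite lee_fin mulr_ge0 ?exprn_ge0// ltW.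
rewrite ge0_integral_sum//; last 2 first.
- by move=> k; apply: emeasurable_funM => //; apply/measurable_EFinP.
- by move=> k t _; rewrite mule_ge0// lee_fin.
have I k : (\int[mu]_(t in `[a, b]) ((c * 2 ^+ k)%:E * (\1_(J k) t)%:E) = (c / 2)%:E)%E.
  rewrite ge0_integralZl//; last by apply/measurable_EFinP.
  rewrite integral_indic; [|by []|exact: mJ].
  have -> : J k `&` `[a, b] = J k.
    apply/setIidPl => t /JE[H1 H2]; rewrite /= in_itv/=; apply/andP; split; last first.
      by move: H1 xb; clear; lra.
    have : (2^-1 : R) ^+ k.+1 <= 2^-1.
      by rewrite exprS -[leRHS]mulr1; apply: ler_wpM2l; [exact: ltW|apply: exprn_ile1; lra].
    by move: H2 ax; clear; lra.
  rewrite -[X in (_ * X)%E]/(mu (J k)) muJ -EFinM; congr EFin.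
  by rewrite exprS exprVn; field; rewrite expf_neq0.
under eq_bigr do rewrite I.
have c20 : 0 < c / 2 by rewrite divr_gt0.
rewrite sumEFin lee_fin sumr_const_nat subn0 -[leRHS]mulr_natr [leRHS]mulrC.
by rewrite -ler_pdivrMr.
Qed.

End PowerIntegrals.

(** * A function with a singularity at one point of the circle *)

Section Peak.
Context {R : realType}.
Implicit Types (f : R[i] -> R[i]) (t x p q u v : R).

Lemma normc_circD1_sqr t : normc (1 + circ t) ^+ 2 = 2 + 2 * cos t.
Proof.
rewrite normc_sqr /= add0r; have := cos2Dsin2 t.
have -> : (1 + cos t) ^+ 2 + sin t ^+ 2 = 1 + 2 * cos t + (cos t ^+ 2 + sin t ^+ 2) by ring.
by move=> ->; ring.
Qed.

(** With [x = (t - pi) / 4] the modulus is [2 |sin (2 x)| = 4 |sin x| cos x]. Now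
    [|sin x| >= |x| cos x], since the arctangent contracts, and [cos^2 x >= 1/2] on [|x| <= pi/4];
    quartering the angle is what brings it into that range. *)
Lemma normc_circD1_ge t : 0 <= t <= 2 * pi -> `|t - pi| / 2 <= normc (1 + circ t).
Proof.
move=> /andP[t0 t1]; set y := t - pi; have [x xE] : exists x, x = y / 4 by exists (y / 4).
have p0 : (0 : R) < pi by exact: pi_gt0.
have y1 : - pi <= y <= pi by apply/andP; rewrite /y; move: t0 t1; clear; split; lra.
have xlt : - (pi / 2) < x < pi / 2.
  by apply/andP; move: y1 p0 => /andP[]; rewrite xE; clear; split; lra.
have c0 : 0 < cos x by exact: cos_gt0_pihalf.
have c2 : 2^-1 <= cos x ^+ 2.
  have : 0 <= cos (x *+ 2).
    apply: cos_ge0_pihalf; have -> : x *+ 2 = y / 2 by rewrite xE; field.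
    by apply/andP; move: y1 => /andP[]; clear; split; lra.
  by rewrite cos_mulr2n; clear; lra.
have xs : `|x| * cos x <= `|sin x|.
  have := norm_atan_le (tan x); rewrite tanK; last by rewrite in_itv.
  have -> : `|tan x| = `|sin x| / cos x by rewrite /tan normrM normfV (gtr0_norm c0).
  by rewrite ler_pdivlMr.
have xs2 : `|x| <= `|sin (x *+ 2)|.
  rewrite sin_mulr2n normrMn normrM (gtr0_norm c0).
  have H1 : `|x| * cos x * cos x <= `|sin x| * cos x by apply: ler_wpM2r => //; exact: ltW.
  have H2 : `|x| * 2^-1 <= `|x| * cos x ^+ 2 by apply: ler_wpM2l.
  by rewrite mulr2n; move: H1 H2; rewrite expr2 mulrA; clear; lra.
have n0 := normc_ge0 (1 + circ t).
rewrite -(ler_pXn2r (ltn0Sn 1)) ?nnegrE ?divr_ge0// normc_circD1_sqr.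
have ct : cos t = - cos ((x *+ 2) *+ 2).
  have -> : (x *+ 2) *+ 2 = t - pi by rewrite xE /y; field.
  by rewrite cosB cospi sinpi; ring.
have -> : 2 + 2 * cos t = 4 * sin (x *+ 2) ^+ 2.
  by rewrite ct cos_mulr2n sin2cos2; ring.
have -> : (`|y| / 2) ^+ 2 = 4 * `|x| ^+ 2.
  by rewrite xE normrM (gtr0_norm (_ : 0 < 4^-1 :> R)) ?invr_gt0 ?ltr0n//; field.
apply: ler_wpM2l => //; rewrite -[leRHS]real_normK ?num_real//.
by apply: lerXn2r; rewrite ?nnegrE.
Qed.

(** The singularity sits at [-1 = circ pi], the midpoint of the parameter interval [[0, 2 pi]], and
    [1 + z] has positive real part on the disk, as [clog] requires. *)
Definition peak (S : R) : R[i] -> R[i] := fun z => cpow (1 + z) (- S).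

Lemma Re_add1_gt0 (z : R[i]) : normc z < 1 -> 0 < Re (1 + z).
Proof.
move=> z1; rewrite raddfD/=; have := ler_Re_normc z; rewrite ler_norml.
by move: z1; clear; lra.
Qed.

Lemma peak_analytic S : analytic_on_disk (peak S).
Proof.
move=> z z1; apply/derivable_is_cderive.
exists (cpow (1 + z) (- S) * (- S)%:C%C / (1 + z)) => e e0.
have [r r0 H] := cpow_cderive (- S) (Re_add1_gt0 z1) e0.
by exists r => // h /H; rewrite /peak addrA.
Qed.

Lemma normc_peak S (z : R[i]) : normc z < 1 -> normc (peak S z) = powR (normc (1 + z)) (- S).
Proof.
move=> /Re_add1_gt0 H; apply: normc_cpow; apply/eqP => E.
by move: H; rewrite E /= ltxx.
Qed.

(* [1 + z] is bounded below both by [1 - |z|] and, in the cone at [xi], by [|1 + xi| / 3];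
   splitting [S = a + b] between the two bounds with [a < s], [b < 1/p] gives finiteness,
   while the full exponent [S = 1/v + sigma] makes the target integrand [1 / |t - pi|]. *)
Lemma AT_peak p q u v alpha beta : 0 < p -> 0 < q -> 0 < u -> 0 < v -> -2 < alpha -> -2 < beta ->
  v^-1 + (beta + 2) / u < p^-1 + (alpha + 2) / q ->
  exists2 f, AT q alpha p f & ~ AT u beta v f.
Proof.
move=> p0 q0 u0 v0 a2 b2.
set s := (alpha + 2) / q; set sg := (beta + 2) / u => crit.
have s0 : 0 < s by rewrite divr_gt0// -ltrBlDr sub0r.
have sg0 : 0 < sg by rewrite divr_gt0// -ltrBlDr sub0r.
have ip0 : 0 < p^-1 by rewrite invr_gt0.
have iv0 : 0 < v^-1 by rewrite invr_gt0.
pose S := v^-1 + sg; have S0 : 0 < S by rewrite addr_gt0.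
have ps0 : 0 < p^-1 + s by rewrite addr_gt0.
exists (peak S).
  split; first exact: peak_analytic.
  (* [S] is split in the proportion of [s] to [1/p]; since [S < s + 1/p], both parts are strictly
     below their bounds. *)
  pose a := S * s / (p^-1 + s); pose b := S * p^-1 / (p^-1 + s).
  have a0 : 0 < a by rewrite divr_gt0// mulr_gt0.
  have b0 : 0 < b by rewrite divr_gt0// mulr_gt0.
  have as_ : a < s.
    by rewrite /a ltr_pdivrMr// mulrC ltr_pM2l.
  have bp : b * p < 1.
    have E (x y z : R) : z != 0 -> x * z^-1 / y * z = x / y by move=> z0; rewrite mulrAC divfK.
    rewrite /b E ?gt_eqF//.
    by rewrite ltr_pdivrMr// mul1r.
  have abS : - S = (- a) + (- b).
    have E (x y z : R) : z + y != 0 -> - x = - (x * y / (z + y)) - (x * z / (z + y)).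
      by move=> zy; field.
    by rewrite {1}(E S s p^-1)// gt_eqF.
  (* The estimate by one pointwise bound is used with first parameters [1] and [a - 2], chosen so
     that its exponent [s] becomes [a]; its target is the pair [(q, alpha)]. *)
  have gap : (a - 2 + 2) / 1 - (alpha + 2) / q < 0.
    by rewrite subrK divr1 -/s subr_lt0.
  have [C C0 HC] := cone_integral_le_gap q0 ltr01 q0 gap.
  rewrite tent_norm_powE.
  apply: (@integral_dist_powR_lt R _ _ pi (powR C (p / q) * powR 6 (b * p)) (b * p)) => //.
  - by rewrite mulr_gt0 ?powR_gt0// ltr0n.
  - by rewrite mulr_ge0// ltW.
  - move=> t; rewrite /= in_itv/= => /andP[t0 t1].
    have := @pihalf_lt2 R; rewrite ler_norml => H; apply/andP; move: H t0 t1; clear; split; lra.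
  - by move=> t _; exact: poweR_ge0.
  move=> t; rewrite /= in_itv/= => tI tpi.
  have d0 : 0 < `|t - pi| by rewrite normr_gt0 subr_eq0.
  (* In the cone [|1 + circ t| <= |1 + z| + 2 (1 - |z|) <= 3 |1 + z|], while
     [|1 + circ t| >= |t - pi| / 2]. *)
  pose D := `|t - pi| / 6; have D0 : 0 < D by rewrite divr_gt0.
  have D1 := normc_circD1_ge tI.
  pose W := powR D (- (b * q)); have W0 : 0 < W by rewrite powR_gt0.
  have coneW : (cone_integral (peak S) q alpha t <= (C * powR W (q / q))%:E)%E.
    apply: HC => // w wc; cbv zeta; set h := 1 - normc (Complex w.1 w.2).
    rewrite subrK divr1.
    have w1 : normc (Complex w.1 w.2) < 1 by exact: (cone_disk wc).
    have h0 : 0 < h by rewrite subr_gt0.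
    rewrite normc_peak//; set z := Complex w.1 w.2 in h w1 h0 *.
    set m := normc (1 + z).
    have mh : h <= m.
      have := lerB_normc 1 (- z); rewrite normc_opp opprK normc1.
      by [].
    have mD : D <= m.
      have /Gamma_circ[_] := wc; rewrite -/z => H1.
      have -> : D = (`|t - pi| / 2) / 3 by rewrite /D; field.
      rewrite ler_pdivrMr//; apply: le_trans D1 _.
      have -> : 1 + circ t = (1 + z) + (circ t - z) by ring.
      apply: le_trans (ler_normcD _ _) _; rewrite -/m.
      have : 1 - normc z ^+ 2 <= 2 * h.
        have -> : 1 - normc z ^+ 2 = h * (1 + normc z) by rewrite /h; ring.
        rewrite [leRHS]mulrC; apply: ler_wpM2l; first exact: ltW.
        by rewrite -[leRHS]/(1 + 1) lerD2l ltW.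
      by move: H1 mh; clear; lra.
    have m0 : 0 < m by apply: lt_le_trans mh.
    rewrite -powRrM abS mulrDl powRD; last by apply/implyP => _; rewrite gt_eqF.
    rewrite mulrAC -[leRHS]mul1r; apply: ler_pM; rewrite ?mulr_ge0 ?powR_ge0//.
      rewrite mulNr powRN mulrC ler_pdivrMr ?powR_gt0// mul1r.
      by apply: ler_powR2 => //; [rewrite mulr_ge0// ltW|exact: ltW].
    rewrite /W mulNr !powRN lef_pV2 ?posrE ?powR_gt0//.
    by apply: ler_powR2 => //; [rewrite mulr_ge0// ltW|exact: ltW].
  apply: (@le_trans _ _ (poweR (C * powR W (q / q))%:E (p / q))).
    apply: ler_poweR => //; [by rewrite divr_ge0 ?ltW|exact: cone_integral_ge0].
  rewrite poweR_EFin lee_fin divff ?gt_eqF// powRr1 ?(ltW W0)//.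
  rewrite powRM ?(ltW C0) ?(ltW W0)// -[leRHS]mulrA; apply: ler_wpM2l; first exact: powR_ge0.
  have -> : powR W (p / q) = powR D (- (b * p)).
    by rewrite /W -powRrM; congr powR; field; rewrite gt_eqF.
  by rewrite /D powRM// ?invr_ge0// mulrC (@powR_inv R 6)// opprK lexx.
move=> [_]; rewrite tent_norm_powE.
have [C C0 HC] := @cone_lower R u beta u0.
pose c := powR (C^-1 * powR 3 (- (S * u))) (v / u).
have c0 : 0 < c by rewrite powR_gt0// mulr_gt0 ?invr_gt0 ?powR_gt0 ?ltr0n.
rewrite (@integral_dist_inv_pinfty R _ _ _ pi c) ?ltxx//.
- by have := @pi_ge2 R; clear; lra.
- by have := @pi_ge2 R; clear; lra.
- by move=> t _; exact: poweR_ge0.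
move=> t d0 d1; set d := pi - t in d0 d1 *.
have rho2 : 2^-1 <= 1 - d by move: d1; clear; lra.
have rho1 : 1 - d < 1 by move: d0; clear; lra.
have := HC (peak S) (@peak_analytic S) t t (1 - d) rho2 rho1.
have -> : 1 - (1 - d) = d by ring.
rewrite subrr normr0 divr_ge0 ?(ltW d0)// => /(_ isT).
(* The test point lies on the radius of [t] as far from the circle as [t] is from [pi]; then
   [|1 + z| <= 3 * d] and [|f|^u * d^(beta + 2)] is at least a multiple of [d^(-u/v)]. *)
set z := (1 - d)%:C%C * circ t.
have nz : normc z = 1 - d.
  by rewrite normcM normc_circ mulr1 normc_real ger0_norm// (le_trans _ rho2)// invr_ge0.
rewrite normc_peak ?nz//; set m := normc (1 + z) => H.
have m3 : m <= 3 * d.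
  have -> : m = normc ((circ t - circ pi) - d%:C%C * circ t).
    congr normc; rewrite /z; have -> : circ pi = -1 :> R[i] by apply/eqP; rewrite /circ cospi sinpi eq_complex /= oppr0 !eqxx.
    by rewrite rmorphB rmorph1; ring.
  apply: le_trans (ler_normcB _ _) _.
  rewrite normcM normc_circ mulr1 normc_real (gtr0_norm d0).
  have := circ_chord t pi; rewrite distrC -/d (gtr0_norm d0); clear; lra.
have m0 : 0 < m.
  by rewrite /m; apply: lt_le_trans (ler_Re_normc _); rewrite normr_gt0 gt_eqF// Re_add1_gt0// nz.
have H2 : ((C^-1 * powR 3 (- (S * u)) * powR d (- (u / v)))%:E <= cone_integral (peak S) u beta t)%E.
  rewrite -mulrA EFinM muleC lee_pdivrMr//; rewrite muleC; apply: le_trans H; rewrite lee_fin.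
  have -> : powR 3 (- (S * u)) * powR d (- (u / v)) = powR (3 * d) (- (S * u)) * powR d (beta + 2).
    rewrite powRM ?(ltW d0)// -mulrA -powRD; last by apply/implyP => _; rewrite gt_eqF.
    by congr (_ * powR _ _); rewrite /S /sg; field; rewrite !gt_eqF.
  apply: ler_wpM2r; first exact: powR_ge0.
  rewrite -powRrM mulNr !powRN lef_pV2 ?posrE ?powR_gt0// ?mulr_gt0//.
  by apply: ler_powR2 => //; [rewrite mulr_ge0// ltW|exact: ltW].
apply: le_trans (ler_poweR _ _ H2); last 2 first.
- by rewrite divr_ge0// ltW.
- by rewrite lee_fin !mulr_ge0 ?powR_ge0// invr_ge0 ltW.
rewrite poweR_EFin lee_fin powRM ?powR_ge0 ?mulr_ge0 ?powR_ge0 ?invr_ge0 ?(ltW C0)// -/c.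
rewrite -powRrM; have -> : - (u / v) * (v / u) = -1 by field; rewrite !gt_eqF.
by rewrite powR_inv1 ?(ltW d0).
Qed.

End Peak.

(** * The lacunary series *)

Section Lacunary.
Context {R : realType}.
Implicit Types (f : R[i] -> R[i]) (t x p q u v : R).
Local Notation T2 := (measurableTypeR R * measurableTypeR R)%type.
Local Notation area := (@lebesgue_measure R \x @lebesgue_measure R)%E.

(** [x^n <= exp(-n (1 - x))], and [exp(-y) = exp(-y/N)^N <= (N/y)^N]: decay in [n (1 - x)] of any
    prescribed order [N]. *)
Lemma expr_decay (x : R) (n N : nat) : 0 <= x -> x < 1 -> (0 < n)%N -> (0 < N)%N ->
  x ^+ n <= (N%:R / (n%:R * (1 - x))) ^+ N.
Proof.
move=> x0 x1 n0 N0.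
have nR : (0 : R) < n%:R by rewrite ltr0n.
have NR : (0 : R) < N%:R by rewrite ltr0n.
pose y := n%:R * (1 - x); have y0 : 0 < y by rewrite mulr_gt0// subr_gt0.
apply: (@le_trans _ _ (expR (- (1 - x)) ^+ n)).
  apply: lerXn2r; rewrite ?nnegrE ?expR_ge0//.
  by have := expR_ge1Dx (- (1 - x)); rewrite opprB addrCA subrr addr0.
have -> : expR (- (1 - x)) ^+ n = expR (- (y / N%:R)) ^+ N.
  by rewrite -!expRM_natl; congr expR; rewrite /y; field; rewrite gt_eqF.
apply: lerXn2r; rewrite ?nnegrE ?expR_ge0//; first by rewrite divr_ge0// ltW.
rewrite expRN -[leRHS]invrK lef_pV2 ?posrE ?expR_gt0// ?invr_gt0 ?divr_gt0// invf_div.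
by apply: le_trans (expR_ge1Dx _); rewrite lerDr.
Qed.

Lemma expr_lower (h : R) n : 0 <= h -> h <= 1 -> 1 - n%:R * h <= (1 - h) ^+ n.
Proof.
move=> h0 h1; elim: n => [|n IH]; first by rewrite mul0r subr0 expr0.
have h1' : 0 <= 1 - h by rewrite subr_ge0.
rewrite exprS; apply: le_trans (ler_wpM2l h1' IH).
have : 0 <= n%:R * h ^+ 2 by rewrite mulr_ge0// exprn_ge0.
by rewrite -natr1 expr2; set k := n%:R => H; move: H; clear; nra.
Qed.

Lemma normc_nat n : normc (n%:R : R[i]) = n%:R.
Proof. by rewrite -(rmorph_nat (real_complex R)) normc_real ger0_norm. Qed.

(** Induction on the remainder, [E_(n+1) = (z + h) E_n + h^2 n z^(n-1)]. The factor [rho^2] on the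
    left stands for the exponent [n - 2] on the right, which would be negative for small [n]. *)
Lemma monomial_second_order (z h : R[i]) (rho : R) n : normc z <= rho -> normc (z + h) <= rho ->
  rho ^+ 2 * normc ((z + h) ^+ n - z ^+ n - h * (n%:R * z ^+ n.-1)) <=
  n%:R ^+ 2 * rho ^+ n * normc h ^+ 2.
Proof.
move=> zr zhr; have r0 : 0 <= rho by apply: le_trans zr; exact: normc_ge0.
elim: n => [|n IH].
  by rewrite !expr0 subrr mul0r mulr0 subr0 normc0 mulr0 !mulr_ge0 ?exprn_ge0 ?normc_ge0.
set E := (z + h) ^+ n - z ^+ n - _ in IH.
have -> : (z + h) ^+ n.+1 - z ^+ n.+1 - h * (n.+1%:R * z ^+ n.+1.-1) =
    (z + h) * E + h ^+ 2 * (n%:R * z ^+ n.-1).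
  rewrite /E /= -natr1; case: n {IH E} => [|n]; first by rewrite !expr0 !expr1; ring.
  by rewrite /= !exprS; ring.
apply: (@le_trans _ _ (rho ^+ 2 * (rho * normc E + normc h ^+ 2 * (n%:R * rho ^+ n.-1)))).
  apply: ler_wpM2l; first exact: exprn_ge0.
  apply: le_trans (ler_normcD _ _) _; apply: lerD.
    by rewrite normcM; apply: ler_wpM2r => //; exact: normc_ge0.
  rewrite normcM normcX; apply: ler_wpM2l; first by rewrite exprn_ge0// normc_ge0.
  rewrite normcM normcX normc_nat.
  apply: ler_wpM2l => //; apply: lerXn2r; rewrite ?nnegrE ?normc_ge0//.
have H1 : rho ^+ 2 * (rho * normc E) <= rho * (n%:R ^+ 2 * rho ^+ n * normc h ^+ 2).
  by rewrite mulrCA; apply: ler_wpM2l.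
rewrite mulrDr; apply: le_trans (lerD H1 (lexx _)) _.
set H := normc h ^+ 2; have H0 : 0 <= H by rewrite exprn_ge0// normc_ge0.
have -> : rho ^+ 2 * (H * (n%:R * rho ^+ n.-1)) = n%:R * rho ^+ n.+1 * H.
  by case: n {IH E H1} => [|n]; [rewrite !mul0r mulr0 mulr0|rewrite /= !exprS; ring].
have -> : rho * (n%:R ^+ 2 * rho ^+ n * H) = n%:R ^+ 2 * (rho ^+ n.+1 * H).
  by rewrite (exprS rho); ring.
rewrite -!(mulrA _ (rho ^+ n.+1)); have P0 : 0 <= rho ^+ n.+1 * H by rewrite mulr_ge0// exprn_ge0.
rewrite -mulrDl; apply: ler_wpM2r => //.
by rewrite -natr1; have := ler0n R n; set k := n%:R; clear; nra.
Qed.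

(** Around the point of the radius at distance [h k] from the circle, a square of area
    [h k ^+ 2 / 100] lies in the cone. Since [h k.+1 <= h k / 4] the squares are disjoint, and on
    the [k]-th one the density is at least [2^-|a| * c k / (2 * h k)^2]. *)
Lemma cone_integral_ge_shells f u a t (h c : nat -> R) :
  (forall k, 0 < h k) -> (forall k, h k <= 2^-1) -> (forall k, h k.+1 <= h k / 4) ->
  (forall k, 0 <= c k) ->
  (forall k (w : T2), cone t w -> let d := 1 - normc (Complex w.1 w.2) in
     h k / 2 < d -> d < 2 * h k ->
     c k <= powR (normc (f (Complex w.1 w.2))) u * powR d (a + 2)) ->
  forall n, ((powR 2 (- `|a|) / 400 * \sum_(0 <= k < n) c k)%:E <= cone_integral f u a t)%E.
Proof.
move=> h0 h2 h4 c0 fc n.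
have c400 : (0 : R) < 400 by rewrite ltr0n.
pose Q k := square ((1 - h k) * cos t) ((1 - h k) * sin t) (h k / 20).
have mQ k : measurable (Q k) by exact: measurable_square.
pose d k := powR 2 (- `|a|) * (c k / (4 * h k ^+ 2)).
have d0 k : 0 <= d k.
  by rewrite mulr_ge0 ?powR_ge0// divr_ge0// mulr_ge0// exprn_ge0// ltW.
have h20 k : 0 < h k / 20 by rewrite divr_gt0.
have areaQ k : area (Q k) = ((h k / 10) ^+ 2)%:E.
  by rewrite area_square ?(ltW (h20 k))//; congr EFin; field.
have Qc k w : Q k w -> cone t w.
  have hk : 1 - (1 - h k) = h k by ring.
  move=> wQ; apply: (@Gamma_square R t t (1 - h k)).
  - by have := h2 k; clear; lra.
  - by have := h0 k; clear; lra.
  - by rewrite subrr normr0 hk ltW.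
  - by rewrite hk.
have Qd k w : Q k w -> h k / 2 < 1 - normc (Complex w.1 w.2) /\ 1 - normc (Complex w.1 w.2) < 2 * h k.
  move=> /squareE[w1 w2].
  pose z0 := Complex ((1 - h k) * cos t) ((1 - h k) * sin t).
  have nz : normc z0 = 1 - h k.
    rewrite /z0 -polarE normcM normc_circ mulr1 normc_real ger0_norm//.
    by have := h2 k; clear; lra.
  have H : normc (Complex w.1 w.2 - z0) <= h k / 10.
    by apply: le_trans (ler_normc_ReIm _) _ => /=; move: w1 w2; clear; lra.
  have H1 := lerB_normc (Complex w.1 w.2) z0.
  have H2 := lerB_normc z0 (Complex w.1 w.2).
  rewrite normc_dist in H2; rewrite nz in H1 H2.
  by have := h0 k; move: H H1 H2; clear; split; lra.
have mono i j : (i < j)%N -> h j <= h i / 4.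
  elim: j => // j IH; rewrite ltnS leq_eqVlt => /predU1P[->|/IH H]; first exact: h4.
  by apply: le_trans (h4 j) _; have := h0 i; have := h0 j; move: H; clear; lra.
have disj w i j : (i < j)%N -> Q i w -> Q j w -> False.
  by move=> /mono H /Qd[H1 _] /Qd[_ H2]; move: H H1 H2; clear; lra.
have dens k w : Q k w -> d k <= density f u a w.
  move=> wQ; have [D1 D2] := Qd _ _ wQ; have wc := Qc _ _ wQ.
  have w1 : normc (Complex w.1 w.2) < 1 by exact: (cone_disk wc).
  set D := 1 - normc (Complex w.1 w.2) in D1 D2.
  have D0 : 0 < D by rewrite subr_gt0.
  have H1 := (one_sub_sqr_powR a w1).1; rewrite -/D in H1.
  have H2 := fc k w wc D1 D2; rewrite -/D in H2.
  rewrite /density; apply: le_trans (ler_wpM2l (powR_ge0 _ _) H1).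
  rewrite [leRHS]mulrCA /d; apply: ler_wpM2l; first exact: powR_ge0.
  rewrite ler_pdivrMr; last by rewrite mulr_gt0// exprn_gt0.
  apply: le_trans H2 _; rewrite powRD; last by apply/implyP => _; rewrite gt_eqF.
  rewrite (powR_mulrn 2 (ltW D0)) mulrA; apply: ler_wpM2l; first by rewrite mulr_ge0// powR_ge0.
  have -> : 4 * h k ^+ 2 = (2 * h k) ^+ 2 by ring.
  by apply: lerXn2r; rewrite ?nnegrE ?mulr_ge0 ?ltW.
have sumd w m (B : R) : 0 <= B -> (forall k, Q k w -> d k <= B) ->
    \sum_(0 <= k < m) d k * \1_(Q k) w <= B.
  move=> B0 dB; elim: m => [|m IH]; first by rewrite big_geq.
  rewrite big_nat_recr//=; have [Qm|Qm] := pselect (Q m w).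
    rewrite [X in X + _]big1_seq ?add0r; last first.
      move=> i /=; rewrite mem_index_iota => /andP[_ im].
      by rewrite indicE memNset ?mulr0// => /(disj _ _ _ im); apply.
    by rewrite indicE mem_set// mulr1; exact: dB.
  by rewrite indicE memNset// mulr0 addr0.
have -> : ((powR 2 (- `|a|) / 400 * \sum_(0 <= k < n) c k)%:E =
    \int[area]_(w in cone t) (\sum_(0 <= k < n) ((d k)%:E * (\1_(Q k) w)%:E)))%E.
  have mc : measurable (cone t) by exact: measurable_cone.
  have mi k : measurable_fun (cone t : set T2) (fun w => (\1_(Q k) w : R)%:E).
    by apply/measurable_EFinP; exact: measurable_indic.
  rewrite ge0_integral_sum//; last 2 first.
  - by move=> k; apply: emeasurable_funM.
  - by move=> k w _; rewrite mule_ge0// lee_fin.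
  rewrite mulr_sumr -sumEFin; apply: eq_bigr => k _.
  rewrite ge0_integralZl//; last by rewrite lee_fin.
  rewrite integral_indic; [|by []|exact: mQ].
  have -> : Q k `&` cone t = Q k by apply/setIidPl => w; exact: Qc.
  rewrite -[X in (_ = _ * X)%E]/(area (Q k)) areaQ -EFinM; congr EFin.
  by rewrite /d; field; rewrite gt_eqF.
apply: ge0_le_integral_nomeas => w wc.
  by apply: sume_ge0 => k _; rewrite mule_ge0// lee_fin.
have -> : (\sum_(0 <= k < n) ((d k)%:E * (\1_(Q k) w)%:E) = (\sum_(0 <= k < n) d k * \1_(Q k) w)%:E)%E.
  by rewrite -sumEFin; apply: eq_bigr => k _; rewrite EFinM.
rewrite lee_fin; apply: sumd; first exact: density_ge0.
by move=> k; exact: dens.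
Qed.

End Lacunary.

Section LacunaryExample.
Context {R : realType}.
Implicit Types (f : R[i] -> R[i]) (t x p q u v : R).

(* [f = sum_k lam^{k sigma} w_k z^{lam^k}] with [lam] so large that on the annulus
   [1 - |z| ~ lam^-k] the [k]-th term dominates all the others. *)
Lemma lacunary (sigma K : R) (w : nat -> R) : 0 < sigma -> 0 < K ->
  (forall k, 0 < w k) -> (forall k, w k.+1 <= w k) -> (forall k, w k <= K * w k.+1) ->
  exists (lam : nat) f, let a k := powR lam%:R sigma ^+ k * w k in
  [/\ (4 <= lam)%N, analytic_on_disk f,
    forall k z, normc z < 1 -> 1 <= lam%:R ^+ k.+1 * (1 - normc z) -> normc (f z) <= 2 * a k.+1 &
    forall k z, normc z < 1 -> 8^-1 <= lam%:R ^+ k * (1 - normc z) ->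
      lam%:R ^+ k * (1 - normc z) <= 2^-1 -> a k / 4 <= normc (f z)].
Proof.
move=> sg0 K0 w0 wdec wK.
(* [N >= sigma + 3] is the order of decay needed: against coefficients of size [n^sigma] and a
   factor [n^2] from the second-order remainders it still leaves [1/n]. *)
have [N' /ltW] := exp2_gt sigma; rewrite -natrX; set N'' := (2 ^ N')%N => sgN.
pose N := N''.+3; pose P : R := (8 * N%:R) ^+ N.
have P0 : 0 < P by rewrite exprn_gt0// mulr_gt0// ltr0n.
have c16 : (0 : R) < 16 by rewrite ltr0n.
have Q0 := powR_ge0 (16 * K) sigma^-1.
(* The three summands ensure [lam >= 4], a tail with [P / lam <= 1/16], and [lam^sigma >= 16 * K];
   the last one makes [a] grow at least by [16] at each step. *)
have [m] := exp2_gt (4 + 16 * P + powR (16 * K) sigma^-1).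
rewrite -natrX; set lam := (2 ^ m)%N; set la : R := lam%:R => lam_big.
have P16 : 0 < 16 * P by rewrite mulr_gt0.
have la4 : 4 < la by move: lam_big P16 Q0; clear; lra.
have laP : 16 * P <= la by move: lam_big Q0; clear; lra.
have laK : powR (16 * K) sigma^-1 <= la by move: lam_big P16; clear; lra.
have la0 : 0 < la by move: la4; clear; lra.
have la1 : 1 <= la by move: la4; clear; lra.
pose L := powR la sigma; have L0 : 0 < L by rewrite powR_gt0.
have LK : 16 * K <= L.
  have := ler_powR2 (ltW sg0) Q0 laK; rewrite -powRrM mulVf ?gt_eqF// powRr1//.
  by rewrite mulr_ge0// ltW.
have LN : L <= la ^+ N'' by rewrite -(powR_mulrn N'' (ltW la0)); exact: ler_powR.
pose a k := L ^+ k * w k.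
have a0 k : 0 < a k by rewrite mulr_gt0// exprn_gt0.
have a16 k : 16 * a k <= a k.+1.
  rewrite /a exprS [leRHS]mulrAC [leRHS]mulrC mulrCA; apply: ler_wpM2l.
    by rewrite exprn_ge0// ltW.
  apply: (@le_trans _ _ (16 * (K * w k.+1))); first by apply: ler_wpM2l => //; exact: ltW.
  by rewrite mulrA; apply: ler_wpM2r => //; exact: ltW.
have alow k : \sum_(0 <= i < k) a i <= a k / 8.
  elim: k => [|k IH]; first by rewrite big_geq// divr_ge0// ltW.
  by rewrite big_nat_recr//=; have := a16 k; have := a0 k; move: IH; clear; lra.
have wle k l : w (l + k)%N <= w k.
  by elim: l => // l IH; rewrite addSn; exact: le_trans (wdec _) IH.
have ale k l : a (l + k)%N <= L ^+ l * a k.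
  rewrite /a exprD -mulrA; apply: ler_wpM2l; first by rewrite exprn_ge0// ltW.
  by apply: ler_wpM2l => //; rewrite exprn_ge0// ltW.
have aE k : a k = L ^+ k * w k by [].
clearbody a.
pose n_ k := (lam ^ k)%N.
have nE k : (n_ k)%:R = la ^+ k by rewrite /n_ natrX.
have n0 k : (0 < n_ k)%N by rewrite -(ltr0n R) nE exprn_gt0.
pose b := la^-1; have b0 : 0 < b by rewrite invr_gt0.
have b4 : b <= 4^-1 by rewrite lef_pV2 ?posrE// ltW.
have b1 : b < 1 by move: b4; clear; lra.
have LNb : L * la ^+ 2 / la ^+ N <= b.
  rewrite ler_pdivrMr ?exprn_gt0// /N !exprS expr0 mulr1.
  have -> : b * (la * (la * (la * la ^+ N''))) = la ^+ N'' * (la * la) by rewrite /b; field; rewrite gt_eqF.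
  by apply: ler_wpM2r => //; rewrite mulr_ge0// ltW.
have Lb : L / la ^+ N <= b.
  apply: le_trans LNb; apply: ler_wpM2r; first by rewrite invr_ge0 exprn_ge0// ltW.
  rewrite -[leLHS]mulr1; apply: ler_wpM2l; first exact: ltW.
  exact: exprn_ege1.
have decay (x e : R) i : 0 <= x -> x < 1 -> 0 < e -> e <= la ^+ i * (1 - x) ->
    x ^+ n_ i <= (N%:R / e) ^+ N.
  move=> x0 x1 e0 ei; apply: le_trans (@expr_decay R x (n_ i) N x0 x1 (n0 i) isT) _.
  apply: lerXn2r; rewrite ?nnegrE ?divr_ge0 ?mulr_ge0 ?subr_ge0 ?ler0n ?(ltW e0) ?(ltW x1)//.
  apply: ler_wpM2l; first exact: ler0n.
  by rewrite nE lef_pV2 ?posrE ?mulr_gt0 ?exprn_gt0// subr_gt0.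
(* For [i = k + j + 1] the coefficient has grown at most by [L^(j+1)] and the power has decayed to
   [P * lam^(-N (j+1))], so the term is at most [a k * P * b^(j+1)]. *)
have tail (x : R) k n : 0 <= x -> x < 1 -> 8^-1 <= la ^+ k * (1 - x) ->
    \sum_(k.+1 <= i < n) a i * x ^+ n_ i <= a k / 8.
  move=> x0 x1 kx; rewrite -{1}(add0n k.+1) big_addn.
  apply: (@le_trans _ _ (a k * P * b * \sum_(0 <= j < n - k.+1) b ^+ j)).
    rewrite mulr_sumr; apply: ler_sum => j _.
    have -> : (j + k.+1 = j.+1 + k)%N by rewrite addnS.
    have dj : x ^+ n_ (j.+1 + k) <= (N%:R / (la ^+ j.+1 / 8)) ^+ N.
      apply: decay => //; first by rewrite divr_gt0// exprn_gt0.
      by rewrite exprD -mulrA; apply: ler_wpM2l => //; rewrite exprn_ge0// ltW.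
    apply: le_trans (ler_pM _ _ (ale k j.+1) dj) _; rewrite ?exprn_ge0 ?(ltW (a0 _))//.
    have -> : (N%:R / (la ^+ j.+1 / 8)) ^+ N = P * (la ^+ N)^-1 ^+ j.+1.
      rewrite /P exprVn -!exprM (mulnC N) exprM -[in RHS]exprVn -exprMn.
      by congr (_ ^+ _); field; rewrite expf_neq0// gt_eqF.
    have -> : L ^+ j.+1 * a k * (P * (la ^+ N)^-1 ^+ j.+1) = a k * P * (L / la ^+ N) ^+ j.+1.
      by rewrite exprMn; ring.
    rewrite -[leRHS]mulrA -exprS; apply: ler_wpM2l; first exact: ltW (mulr_gt0 (a0 k) P0).
    apply: lerXn2r => //; rewrite nnegrE; last exact: ltW.
    by rewrite divr_ge0 ?exprn_ge0 ?ltW.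
  apply: (@le_trans _ _ (a k * P * b * 2)).
    apply: ler_wpM2l; first exact: ltW (mulr_gt0 (mulr_gt0 (a0 k) P0) b0).
    apply: le_trans (geometric_sum_lt1 _ (ltW b0) b1) _.
    by rewrite -[leRHS]invrK lef_pV2 ?posrE ?subr_gt0 ?invr_gt0//; move: b4; clear; lra.
  have -> : a k * P * b * 2 = a k * (P * b * 2) by ring.
  apply: ler_wpM2l; first exact: ltW.
  have : P * b <= 16^-1 by rewrite ler_pdivrMr// mulrC ler_pdivlMr// mulrC.
  by clear; lra.
have total (x : R) k n : 0 <= x -> x < 1 -> 8^-1 <= la ^+ k * (1 - x) ->
    \sum_(0 <= i < n) a i * x ^+ n_ i <= 2 * a k.
  move=> x0 x1 kx.
  have t0 i : 0 <= a i * x ^+ n_ i by rewrite mulr_ge0 ?exprn_ge0// ltW.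
  have tle i : a i * x ^+ n_ i <= a i.
    by rewrite -[leRHS]mulr1; apply: ler_wpM2l; [exact: ltW|apply: exprn_ile1; lra].
  apply: (@le_trans _ _ (\sum_(0 <= i < k.+1 + n) a i * x ^+ n_ i)).
    rewrite (@big_cat_nat _ _ _ n 0 (k.+1 + n))//= ?leq_addl// lerDl.
    by apply: sumr_ge0.
  rewrite (@big_cat_nat _ _ _ k.+1 0 (k.+1 + n))//= ?leq_addr//.
  have H1 := tail x k (k.+1 + n)%N x0 x1 kx.
  have H2 : \sum_(0 <= i < k.+1) a i * x ^+ n_ i <= a k / 8 + a k.
    apply: (@le_trans _ _ (\sum_(0 <= i < k.+1) a i)); first by apply: ler_sum.
    by rewrite big_nat_recr//= lerD2r.
  by have := a0 k; move: H1 H2; clear; lra.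
pose g k z : R[i] := (a k)%:C%C * z ^+ n_ k.
have normg k z : normc (g k z) = a k * normc z ^+ n_ k.
  by rewrite normcM normcX normc_real gtr0_norm.
pose f z := csum (fun k => g k z).
exists lam, f; split.
- by rewrite -(ler_nat R) ltW.
- move=> z z1; apply/derivable_is_cderive; have {}z1 : normc z < 1 by [].
  (* Increments shorter than [(1 - |z|) / 2] stay in the disk of radius [rho], so that the
     remainders, the derivatives and the terms all have the common majorant [M]. *)
  pose rho := (1 + normc z) / 2; pose eta := 1 - rho.
  have nz := normc_ge0 z.
  have rho1 : rho < 1 by move: z1; rewrite /rho; clear; lra.
  have rho2 : 2^-1 <= rho by move: nz; rewrite /rho; clear; lra.
  have rho0 : 0 < rho by move: rho2; clear; lra.
  have eta0 : 0 < eta by rewrite subr_gt0.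
  have zrho : normc z <= rho by move: z1; rewrite /rho; clear; lra.
  pose C0 := w 0%N * (N%:R / eta) ^+ N.
  have C00 : 0 <= C0 by rewrite mulr_ge0 ?exprn_ge0 ?divr_ge0 ?ler0n ?ltW.
  have mb i : a i * ((n_ i)%:R ^+ 2 * rho ^+ n_ i) <= C0 * b ^+ i.
    have H1 : a i <= L ^+ i * w 0%N by have := ale 0%N i; rewrite addn0 (aE 0%N) expr0 mul1r.
    have H2 : rho ^+ n_ i <= (N%:R / (la ^+ i * eta)) ^+ N.
      by apply: decay; rewrite ?(ltW rho0)// mulr_gt0 ?exprn_gt0.
    apply: (@le_trans _ _ (L ^+ i * w 0%N * ((la ^+ i) ^+ 2 * (N%:R / (la ^+ i * eta)) ^+ N))).
      apply: ler_pM => //; first exact: ltW.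
        by rewrite mulr_ge0 ?exprn_ge0 ?ler0n ?(ltW rho0).
      by rewrite nE; apply: ler_wpM2l => //; rewrite !exprn_ge0// ltW.
    have -> : (N%:R / (la ^+ i * eta)) ^+ N = (N%:R / eta) ^+ N * (la ^+ N)^-1 ^+ i.
      rewrite exprVn -!exprM (mulnC N) exprM -[in RHS]exprVn -exprMn.
      by congr (_ ^+ _); field; rewrite expf_neq0 ?gt_eqF.
    have -> : (la ^+ i) ^+ 2 = (la ^+ 2) ^+ i by rewrite -!exprM mulnC.
    have -> : L ^+ i * w 0%N * ((la ^+ 2) ^+ i * ((N%:R / eta) ^+ N * (la ^+ N)^-1 ^+ i)) =
        C0 * (L * la ^+ 2 / la ^+ N) ^+ i.
      by rewrite (exprMn i (L * la ^+ 2)) (exprMn i L) /C0; ring.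
    apply: ler_wpM2l => //; apply: lerXn2r => //; rewrite nnegrE; last exact: ltW.
    by apply/ltW; rewrite divr_gt0 ?exprn_gt0// mulr_gt0// exprn_gt0.
  pose M i := a i * ((n_ i)%:R ^+ 2 * rho ^+ n_ i) / rho ^+ 2.
  have r20 : 0 < rho ^+ 2 by rewrite exprn_gt0.
  have M0 i : 0 <= M i.
    apply: divr_ge0; last exact: ltW.
    apply: mulr_ge0; first exact: ltW.
    by apply: mulr_ge0; apply: exprn_ge0 => //; exact: ltW.
  pose B := C0 / rho ^+ 2 * (1 - b)^-1.
  have MB n : \sum_(0 <= i < n) M i <= B.
    apply: (@le_trans _ _ (C0 / rho ^+ 2 * \sum_(0 <= i < n) b ^+ i)).
      rewrite mulr_sumr; apply: ler_sum => i _.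
      have -> : C0 / rho ^+ 2 * b ^+ i = C0 * b ^+ i / rho ^+ 2 by rewrite mulrAC.
      by apply: ler_wpM2r => //; rewrite invr_ge0; exact: ltW.
    apply: ler_wpM2l; first by apply: divr_ge0 => //; exact: ltW.
    by apply: geometric_sum_lt1 => //; exact: ltW.
  have n1 i : 1 <= (n_ i)%:R :> R by rewrite ler1n.
  have r21 : rho ^+ 2 <= 1 by apply: exprn_ile1; rewrite ltW.
  pose d i : R[i] := (a i)%:C%C * ((n_ i)%:R * z ^+ (n_ i).-1).
  exists (csum d).
  apply: (@csum_cderive R g d z ((1 - normc z) / 2) M B) => //.
  + by rewrite divr_gt0// subr_gt0.
  + move=> i h hr.
    have zh : normc (z + h) <= rho.
      by apply: le_trans (ler_normcD _ _) _; move: hr; rewrite /rho; clear; lra.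
    have := monomial_second_order (n_ i) zrho zh.
    have -> : g i (z + h) - g i z - h * d i =
      (a i)%:C%C * ((z + h) ^+ n_ i - z ^+ n_ i - h * ((n_ i)%:R * z ^+ (n_ i).-1)).
      by rewrite /g /d; ring.
    set E := normc (_ - _) => H; rewrite normcM normc_real (gtr0_norm (a0 i)) -/E.
    rewrite /M -!mulrA; apply: ler_wpM2l; first exact: ltW.
    rewrite (mulrC _ (normc h ^+ 2)) !mulrA ler_pdivlMr// mulrC.
    by apply: le_trans H _; rewrite !expr2 !mulrA.
  + move=> n; apply: le_trans (MB n); apply: ler_sum => i _.
    rewrite normcM normc_real (gtr0_norm (a0 i)) normcM normc_nat normcX /M -mulrA.
    apply: ler_wpM2l; first exact: ltW.
    have Z : normc z ^+ (n_ i).-1 <= rho ^+ n_ i / rho ^+ 2.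
      have {2}-> : n_ i = (n_ i).-1.+1 by rewrite prednK.
      rewrite ler_pdivlMr// (exprSr rho (n_ i).-1).
      apply: (@le_trans _ _ (rho ^+ (n_ i).-1 * rho ^+ 2)).
        apply: ler_wpM2r; first exact: ltW.
        by apply: lerXn2r; rewrite ?nnegrE//; exact: ltW.
      apply: ler_wpM2l; first by apply: exprn_ge0; exact: ltW.
      by rewrite expr2 -[leRHS]mulr1; apply: ler_wpM2l; exact: ltW.
    have -> : (n_ i)%:R ^+ 2 * rho ^+ n_ i / rho ^+ 2 = (n_ i)%:R * ((n_ i)%:R * (rho ^+ n_ i / rho ^+ 2)) :> R.
      by rewrite expr2 !mulrA.
    apply: ler_wpM2l; first exact: ler0n.
    by rewrite -[leLHS]mul1r; apply: ler_pM => //; exact: exprn_ge0.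
  + move=> h hr n; apply: le_trans (MB n); apply: ler_sum => i _.
    have zh : normc (z + h) <= rho.
      by apply: le_trans (ler_normcD _ _) _; move: hr; rewrite /rho; clear; lra.
    rewrite normg /M -mulrA; apply: ler_wpM2l; first exact: ltW.
    rewrite ler_pdivlMr//.
    apply: (@le_trans _ _ (rho ^+ n_ i * 1)).
      apply: ler_pM; rewrite ?exprn_ge0 ?normc_ge0 ?(ltW rho0)//.
      by apply: lerXn2r; rewrite ?nnegrE ?normc_ge0// ltW.
    by rewrite mulrC; apply: ler_wpM2r; [rewrite exprn_ge0// ltW|exact: exprn_ege1].
- move=> k z z1 kz.
  have kz' : 8^-1 <= la ^+ k.+1 * (1 - normc z) by apply: le_trans kz; lra.
  have T n : \sum_(0 <= i < n) normc (g i z) <= 2 * a k.+1.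
    under eq_bigr do rewrite normg.
    by apply: total => //; exact: normc_ge0.
  by have := csum_tail (m := 0) T T; rewrite big_geq// subr0 aE.
- move=> k z z1 kz1 kz2.
  have -> : powR lam%:R sigma ^+ k * w k = a k by rewrite aE.
  have T n : \sum_(0 <= i < n) normc (g i z) <= 2 * a k.
    under eq_bigr do rewrite normg.
    by apply: total => //; exact: normc_ge0.
  have T' n : \sum_(k.+1 <= i < n) normc (g i z) <= a k / 8.
    under eq_bigr do rewrite normg.
    by apply: tail => //; exact: normc_ge0.
  have := csum_tail T T'; rewrite big_nat_recr// -/(f z) => H1.
  have H2 : normc (\sum_(0 <= i < k) g i z) <= a k / 8.
    apply: le_trans (ler_normc_sum _ _ _) _; apply: le_trans (alow k).
    apply: ler_sum => i _; rewrite normg -[leRHS]mulr1; apply: ler_wpM2l; first exact: ltW.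
    by apply: exprn_ile1; [exact: normc_ge0|exact: ltW].
  (* Bernoulli's inequality with [n_k (1 - |z|) <= 1/2]. The terms before and after each cost
     [a k / 8], which leaves [a k / 4]. *)
  have H3 : a k / 2 <= normc (g k z).
    rewrite normg; apply: ler_wpM2l; first exact: ltW.
    have := @expr_lower R (1 - normc z) (n_ k); rewrite subKr nE => H.
    apply: le_trans (H _ _); first by move: kz2; clear; lra.
      by rewrite subr_ge0 ltW.
    by rewrite gerBl normc_ge0.
  set S := \sum_(0 <= i < k) g i z in H1 H2; set G := g k z in H1 H3.
  have H4 : G = f z - (f z - (S + G)) - S by ring.
  have := ler_normcB (f z - (f z - (S + G))) S; rewrite -H4.
  have := ler_normcB (f z) (f z - (S + G)).
  by have := a0 k; move: H1 H2 H3; clear; lra.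
Qed.

End LacunaryExample.

Section LacunaryAT.
Context {R : realType}.
Implicit Types (f : R[i] -> R[i]) (t x p q u v : R).
Local Notation mu := (@lebesgue_measure R).

(** Condensation: the block [2^m <= k < 2^(m+1)] has [2^m] terms, each at most [2^(-m r)], hence is
    dominated by [y^m]. *)
Lemma pseries_bounded (r : R) : 1 < r ->
  exists B, forall n, \sum_(0 <= k < n) powR k.+1%:R (- r) <= B.
Proof.
move=> r1; pose y := powR 2 (1 - r).
have y1 : y < 1 by rewrite /y -opprB; apply: powRN_lt1; rewrite ?ltr1n// subr_gt0.
have y0 : 0 <= y by exact: powR_ge0.
exists (1 + (1 - y)^-1) => n.
have H m : \sum_(0 <= k < 2 ^ m) powR k.+1%:R (- r) <= 1 + \sum_(0 <= k < m) y ^+ k.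
  elim: m => [|m IH].
    by rewrite expn0 big_nat1 powR1 (@big_geq _ _ _ 0 0)// addr0.
  rewrite expnS mul2n -addnn (@big_cat_nat _ _ _ (2 ^ m)%N)//= ?leq_addr//.
  rewrite big_nat_recr//= addrA; apply: lerD => //.
  have c2 : (0 : R) < 2 ^+ m by rewrite exprn_gt0.
  have -> : y ^+ m = \sum_(2 ^ m <= k < 2 ^ m + 2 ^ m) powR (2 ^+ m) (- r).
    rewrite sumr_const_nat addKn -[RHS]mulr_natr natrX /y powR_exprn//.
    rewrite powRD; last by apply/implyP => _; rewrite gt_eqF.
    by rewrite powRr1 ?(ltW c2)// mulrC.
  rewrite big_nat_cond [leRHS]big_nat_cond; apply: ler_sum => k /andP[/andP[k1 _] _].
  rewrite !powRN lef_pV2 ?posrE ?powR_gt0 ?ltr0n//.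
  apply: ler_powR2; [by rewrite ltW// (lt_trans _ r1)|exact: ltW|].
  by rewrite -natrX ler_nat; exact: leqW.
apply: (@le_trans _ _ (\sum_(0 <= k < 2 ^ n) powR k.+1%:R (- r))).
  have n2 : (n <= 2 ^ n)%N by apply/ltnW/ltn_expl.
  by rewrite (@big_cat_nat _ _ _ n 0 (2 ^ n))//= lerDl; apply: sumr_ge0 => k _; exact: powR_ge0.
by apply: le_trans (H n) _; rewrite lerD2l; exact: geometric_sum_lt1.
Qed.

Let regroup (A X Y W : R) k :
  A * (X ^+ k.+1 * W) * Y ^+ k = A * X * ((X * Y) ^+ k * W).
Proof. by rewrite exprS exprMn; ring. Qed.

(** The weights [(k+1)^(-1/u)] make the shells of the [(u, beta)] integral contribute a harmonic
    series. For [(q, alpha)] the shells are bounded by [y^k * (k+1)^(-q/u)] with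
    [y = lam^(-(s - sigma) q)], summable because [y < 1], or [y = 1] and [q > u]. Both hold at every
    vertex. *)
Lemma AT_lacunary p q u v alpha beta : 0 < p -> 0 < q -> 0 < u -> 0 < v -> -2 < alpha -> -2 < beta ->
  (beta + 2) / u < (alpha + 2) / q \/ ((alpha + 2) / q = (beta + 2) / u /\ u < q) ->
  exists2 f, AT q alpha p f & ~ AT u beta v f.
Proof.
move=> p0 q0 u0 v0 a2 b2; set s := (alpha + 2) / q; set sg := (beta + 2) / u => crit.
have sg0 : 0 < sg by rewrite divr_gt0// -ltrBlDr sub0r.
have iu0 : 0 < u^-1 by rewrite invr_gt0.
pose w (k : nat) : R := powR k.+1%:R (- u^-1).
have w0 k : 0 < w k by rewrite powR_gt0// ltr0n.
have wdec k : w k.+1 <= w k.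
  rewrite /w !powRN lef_pV2 ?posrE ?powR_gt0 ?ltr0n//.
  by apply: ler_powR2; [exact: ltW|exact: ler0n|rewrite ler_nat].
have wK k : w k <= powR 2 u^-1 * w k.+1.
  rewrite /w !powRN ler_pdivlMr ?powR_gt0 ?ltr0n// mulrC ler_pdivrMr ?powR_gt0 ?ltr0n//.
  rewrite -powRM//; apply: ler_powR2; [exact: ltW|exact: ler0n|].
  by rewrite -natrM ler_nat mul2n -addnn addSn ltnS leq_addl.
have w1 k : w k <= 1.
  rewrite /w powRN invf_le1 ?powR_gt0 ?ltr0n//.
  have := @ler_powR2 R 1 k.+1%:R u^-1 (ltW iu0) ler01; rewrite powR1; apply.
  by rewrite ler1n.
have K0 : 0 < powR 2 u^-1 :> R by rewrite powR_gt0.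
have [lam [f [lam4 fa fup flow]]] := lacunary sg0 K0 w0 wdec wK.
set la : R := lam%:R in fup flow; pose L := powR la sg; rewrite -/L in fup flow.
have la4 : 4 <= la by rewrite ler_nat.
have la0 : 0 < la by move: la4; clear; lra.
have L0 : 0 < L by rewrite powR_gt0.
have mI : measurable (`[0%R, (2 * pi)%R] : set (measurableTypeR R)) by exact: measurable_itv.
have muI : mu `[0%R, (2 * pi)%R] = (2 * pi)%:E.
  by rewrite lebesgue_measure_itv/= lte_fin mulr_gt0 ?pi_gt0// oppr0 adde0.
exists f.
  split=> //; rewrite tent_norm_powE.
  (* Shells of ratio [1/lam] follow the gaps: [h > b^(k+1)] is the condition under which the series
     is at most twice its coefficient of index [k + 1]. *)
  pose b := la^-1; have b0 : 0 < b by rewrite invr_gt0.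
  have b2' : b <= 2^-1 by rewrite lef_pV2 ?posrE//; move: la4; clear; lra.
  pose y := powR L q * powR b (alpha + 2).
  have y0 : 0 <= y by rewrite mulr_ge0 ?powR_ge0.
  have yE : y = powR la (- ((s - sg) * q)).
    rewrite /y /L (@powR_inv R la) ?(ltW la0)// -powRrM -powRD; last by apply/implyP => _; rewrite gt_eqF.
    by congr powR; rewrite /s; field; rewrite gt_eqF.
  have [B SB] : exists B, forall n, \sum_(0 <= k < n) y ^+ k * powR (w k.+1) q <= B.
    case: crit => [ss|[ss uq]].
      have y1 : y < 1.
        rewrite yE; apply: powRN_lt1; first by move: la4; clear; lra.
        by rewrite mulr_gt0// subr_gt0.
      exists (1 - y)^-1 => n; apply: le_trans (geometric_sum_lt1 n y0 y1).
      apply: ler_sum => k _; rewrite -[leRHS]mulr1; apply: ler_wpM2l; first exact: exprn_ge0.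
      by have := ler_powR2 (ltW q0) (ltW (w0 k.+1)) (w1 k.+1); rewrite powR1.
    have uq1 : 1 < q / u by rewrite ltr_pdivlMr// mul1r.
    have [B HB] := pseries_bounded uq1; exists B => n; apply: le_trans (HB n).
    apply: ler_sum => k _; rewrite yE ss subrr mul0r oppr0 powRr0 expr1n mul1r.
    apply: (@le_trans _ _ (powR (w k) q)); first exact: ler_powR2 (ltW q0) (ltW (w0 _)) (wdec _).
    by rewrite /w -powRrM mulNr mulrC.
  pose c k := powR (2 * (L ^+ k.+1 * w k.+1)) q * powR (b ^+ k) (alpha + 2).
  have c0 k : 0 <= c k by rewrite mulr_ge0 ?powR_ge0.
  pose D : R := 16 * b ^- 2 * powR 2 `|alpha|.
  have D0 : 0 <= D by rewrite !mulr_ge0 ?powR_ge0// invr_ge0 exprn_ge0// ltW.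
  pose M := D * (powR 2 q * powR L q * B).
  have bnd t : (cone_integral f q alpha t <= M%:E)%E.
    apply: le_trans (@cone_integral_shells R f q alpha t b c b0 b2' c0 _) _.
      move=> k z zc h h1 h2.
      have z1 : normc (Complex z.1 z.2) < 1 by exact: (cone_disk zc).
      have h0 : 0 < h by rewrite subr_gt0.
      apply: ler_pM; rewrite ?powR_ge0//; apply: ler_powR2; rewrite ?normc_ge0 ?(ltW q0) ?(ltW h0)//.
        apply: fup => //; rewrite -/h -ler_pdivrMl ?exprn_gt0// mulr1 -exprVn; exact: ltW.
      by move: a2; clear; lra.
    apply: nneseries_le_real => [k|n]; first by rewrite mulr_ge0.
    rewrite -mulr_sumr -/D /M; apply: ler_wpM2l => //.
    have -> : \sum_(0 <= k < n) c k = powR 2 q * powR L q * \sum_(0 <= k < n) y ^+ k * powR (w k.+1) q.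
      rewrite mulr_sumr; apply: eq_bigr => k _.
      rewrite /c powRM ?mulr_ge0 ?exprn_ge0 ?(ltW L0) ?(ltW (w0 _))//.
      rewrite powRM ?exprn_ge0 ?(ltW L0) ?(ltW (w0 _))//.
      by rewrite -!powR_exprn ?(ltW L0) ?(ltW b0)// regroup.
    by apply: ler_wpM2l => //; rewrite mulr_ge0 ?powR_ge0.
  apply: (@le_lt_trans _ _ (\int[mu]_(t in `[0%R, (2 * pi)%R]) (cst (poweR M%:E (p / q)) t))%E).
    apply: ge0_le_integral_nomeas => t _; first exact: poweR_ge0.
    by apply: ler_poweR => //; [rewrite divr_ge0 ?ltW|exact: cone_integral_ge0].
  by rewrite integral_cst// -[X in (_ * X)%E]/(mu `[0%R, (2 * pi)%R]) muI poweR_EFin -EFinM ltry.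
move=> [_]; rewrite tent_norm_powE.
(* The range [h k / 2 < d < 2 * h k] reads [1/8 < lam^k * d < 1/2], which is where the [k]-th term
   dominates. *)
pose h k := (4 * la ^+ k)^-1.
have lak k : 0 < la ^+ k by rewrite exprn_gt0.
have h0 k : 0 < h k by rewrite invr_gt0 mulr_gt0.
pose d := powR 4 (- u) * powR 8 (- (beta + 2)).
have d0 : 0 < d by rewrite mulr_gt0 ?powR_gt0.
pose c (k : nat) := d * k.+1%:R^-1.
have c400 : (0 : R) < 400 by rewrite ltr0n.
have full t : cone_integral f u beta t = +oo%E.
  have H n : ((powR 2 (- `|beta|) / 400 * \sum_(0 <= k < n) c k)%:E <= cone_integral f u beta t)%E.
    apply: (@cone_integral_ge_shells R f u beta t h c) => //.
    - move=> k; rewrite /h lef_pV2 ?posrE ?mulr_gt0//.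
      have : 1 <= la ^+ k by apply: exprn_ege1; move: la4; clear; lra.
      by clear; lra.
    - move=> k; rewrite /h -invfM lef_pV2 ?posrE ?mulr_gt0// exprS.
      rewrite -mulrA (mulrC (la ^+ k)); apply: ler_wpM2l => //.
      by apply: ler_wpM2r => //; exact: ltW.
    - by move=> k; rewrite mulr_ge0 ?invr_ge0// ltW.
    move=> k z zc x x1 x2.
    have z1 : normc (Complex z.1 z.2) < 1 by exact: (cone_disk zc).
    have x0 : 0 < x by rewrite subr_gt0.
    have e1 : 8^-1 <= la ^+ k * x.
      rewrite mulrC -ler_pdivrMr//; apply: ltW; apply: le_lt_trans x1.
      by rewrite /h le_eqVlt; apply/orP; left; apply/eqP; field; rewrite gt_eqF.
    have e2 : la ^+ k * x <= 2^-1.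
      rewrite mulrC -ler_pdivlMr//; apply: ltW; apply: lt_le_trans x2 _.
      by rewrite /h le_eqVlt; apply/orP; left; apply/eqP; field; rewrite gt_eqF.
    have := flow k _ z1 e1 e2 => F.
    apply: (@le_trans _ _ (powR (L ^+ k * w k / 4) u * powR (8^-1 / la ^+ k) (beta + 2))); last first.
      apply: ler_pM; rewrite ?powR_ge0//; apply: ler_powR2 => //.
      - exact: ltW.
      - by rewrite divr_ge0 ?mulr_ge0 ?exprn_ge0 ?(ltW L0) ?(ltW (w0 k)).
      - by move: b2; clear; lra.
      - by rewrite divr_ge0 ?invr_ge0// ltW.
      - by rewrite ler_pdivrMr// mulrC.
    have La : powR (L ^+ k) u = powR (la ^+ k) (beta + 2).
      rewrite /L powR_exprn ?(ltW la0)// -powRrM; congr powR.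
      by rewrite /sg divfK// gt_eqF.
    have wu : powR (w k) u = k.+1%:R^-1.
      by rewrite /w -powRrM mulNr mulVf ?gt_eqF// powR_inv1.
    rewrite !powRM ?invr_ge0 ?mulr_ge0 ?exprn_ge0 ?(ltW L0) ?(ltW (w0 k)) ?(ltW (lak k))//.
    rewrite La wu (@powR_inv R 4)// (@powR_inv R 8)// (@powR_inv R (la ^+ k)) ?(ltW (lak k))//.
    rewrite /c /d !powRN le_eqVlt; apply/orP; left; apply/eqP.
    by field; rewrite !gt_eqF ?powR_gt0.
  (* A finite cone integral would bound the partial sums of the harmonic series. *)
  apply/eqP; rewrite -leye_eq leNgt; apply/negP => fin.
  have E : cone_integral f u beta t = (fine (cone_integral f u beta t))%:E.
    by rewrite fineK// ge0_fin_numE// cone_integral_ge0.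
  set F := fine _ in E; apply: (@dvg_harmonic R).
  have P0 : 0 < powR 2 (- `|beta|) / 400 * d :> R.
    by rewrite !mulr_gt0 ?powR_gt0 ?invr_gt0 ?ltr0n.
  apply: (@bounded_series_cvg R _ (F / (powR 2 (- `|beta|) / 400 * d))) => n.
  rewrite ler_pdivlMr// [leLHS]mulrC -[leLHS]mulrA.
  have := H n; rewrite E lee_fin; apply: le_trans; apply: ler_wpM2l.
    by apply: divr_ge0; [exact: powR_ge0|exact: ltW].
  by rewrite mulr_sumr; apply: ler_sum => k _; rewrite ger0_norm ?harmonic_ge0.
have -> : (\int[mu]_(t in `[0%R, (2 * pi)%R]) poweR (cone_integral f u beta t) (v / u) =
    \int[mu]_(t in `[0%R, (2 * pi)%R]) (cst +oo t))%E.
  by apply: eq_integral => t _; rewrite full poweRyr// gt_eqF// divr_gt0.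
rewrite integral_cst// -[X in (_ * X)%E]/(mu `[0%R, (2 * pi)%R]) muI.
by rewrite mulyr gtr0_sg ?mulr_gt0 ?pi_gt0// mul1e.
Qed.

End LacunaryAT.

Theorem corollary1p2 (R : realType) (p q u v alpha beta : R)
    (hp : 0 < p) (hq : 0 < q) (hu : 0 < u) (hv : 0 < v)
    (halpha : -2 < alpha) (hbeta : -2 < beta) :
  AT q alpha p `<=` AT u beta v <->
  (p < v /\
   p^-1 - v^-1 + (alpha + 2) / q - (beta + 2) / u <= 0) \/
  (v <= p /\
   ((alpha + 2) / q - (beta + 2) / u < 0 \/
    ((alpha + 2) / q - (beta + 2) / u = 0 /\ q <= u))).
Proof.
split; last exact: AT_sub.
move=> sub.
have no_peak : ~ v^-1 + (beta + 2) / u < p^-1 + (alpha + 2) / q.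
  by move=> /(AT_peak hp hq hu hv halpha hbeta)[f /sub].
have no_lac : ~ ((beta + 2) / u < (alpha + 2) / q \/
    ((alpha + 2) / q = (beta + 2) / u /\ u < q)).
  by move=> /(AT_lacunary hp hq hu hv halpha hbeta)[f /sub].
(* For [p < v] the absence of the first counterexample is the inequality of (i). For [v <= p] the
   absence of the second one leaves, of the three orders of [s] and [sigma], exactly (ii). *)
have [pv|vp] := ltP p v; [left|right]; split => //.
  by move/negP: no_peak; rewrite -leNgt; clear; lra.
have [lt|gt|eq] := ltgtP ((alpha + 2) / q) ((beta + 2) / u).
- by left; rewrite subr_lt0.
- by case: no_lac; left.
- right; rewrite eq subrr; split=> //; rewrite leNgt; apply/negP => uq.
  by case: no_lac; right.
Qed.
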